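(* Let $G$ be a connected four-dimensional Lie group with Lie algebra $(\mathfrak{g},[\cdot,\cdot])$, let $\mathfrak{q}\subset\mathfrak{g}$ be a three-dimensional subspace generating $\mathfrak{g}$, and let $d$ be an arbitrary left-invariant sub-Finsler quasimetric on $G$ defined by a seminorm $F$ on $\mathfrak{q}$. Below, for an adapted basis $(e_1,e_2,e_3)$ of $\mathfrak{q}$ and $s\in\{1,-1\}$, put $g_s(t)=\exp\left(ste_2/F(se_2)\right)$, $t\in\mathbb{R}$ (an abnormal extremal). 1. Every abnormal extremal of $(G,d)$ is nonstrongly abnormal in each of the following cases: (a) $\mathfrak{g}=\mathfrak{g}_{2,1}\oplus2\mathfrak{g}_1$ or $\mathfrak{g}=\mathfrak{g}_{3,1}\oplus\mathfrak{g}_1$; (b) $\mathfrak{g}$ is one of $\mathfrak{g}_{3,2}\oplus\mathfrak{g}_1$, $\mathfrak{g}_{3,4}^{\alpha}\oplus\mathfrak{g}_1$ ($0\le\alpha\ne1$), $\mathfrak{g}_{4,3}$, $\mathfrak{g}_{3,5}^{\alpha}\oplus\mathfrak{g}_1$ ($\alpha\ge0$), $\mathfrak{g}_{4,1}$, $\mathfrak{g}_{3,6}\oplus\mathfrak{g}_1$, $\mathfrak{g}_{3,7}\oplus\mathfrak{g}_1$, $\mathfrak{g}_{4,8}^{-1}$, $\mathfrak{g}_{4,9}^{0}$, and $\mathfrak{q}$ contains the center $\mathfrak{C}(\mathfrak{g})$. 2. Every abnormal extremal of $(G,d)$ is strongly abnormal in each of the following cases: (a) $\mathfrak{g}$ is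 one of $\mathfrak{g}_{3,3}\oplus\mathfrak{g}_1$, $\mathfrak{g}_{4,2}^{1}$, $\mathfrak{g}_{4,5}^{\alpha,1}$, $\mathfrak{g}_{4,5}^{\alpha,\alpha}$, $-1\le\alpha<1$, $\alpha\ne0$; (b) $\mathfrak{g}=2\mathfrak{g}_{2,1}$ and $\mathfrak{q}$ contains a one-dimensional ideal of $\mathfrak{g}$; (c) $\mathfrak{g}=\mathfrak{g}_{3,6}\oplus\mathfrak{g}_1$ and $\mathfrak{q}$ has an adapted basis $(e_1,e_2,e_3=[e_1,e_2])$ such that $0\ne[e_2,e_3]\parallel e_2$; (d) $\mathfrak{g}$ is one of $\mathfrak{g}_{3,2}\oplus\mathfrak{g}_1$, $\mathfrak{g}_{3,4}^{\alpha}\oplus\mathfrak{g}_1$ ($0\le\alpha\ne1$), $\mathfrak{g}_{4,3}$, $\mathfrak{g}_{4,2}^{\alpha}$ ($\alpha\notin\{0,1\}$), $\mathfrak{g}_{4,4}$, $\mathfrak{g}_{4,5}^{\alpha,\beta}$ ($-1<\alpha<\beta<1$, $\alpha\beta\ne0$, or $\alpha=-1$, $0<\beta<1$), $\mathfrak{g}_{4,6}^{\alpha,\beta}$ ($\alpha>0$, $\beta\in\mathbb{R}$), $\mathfrak{g}_{4,7}$, $\mathfrak{g}_{4,8}^{\alpha}$ ($-1<\alpha<1$), $\mathfrak{g}_{4,9}^{\alpha}$ ($\alpha>0$), and $\mathfrak{q}$ contains a one-dimensional noncentral ideal of $\mathfrak{g}$. 3. In each of the following cases, with respect to the indicated adapted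 basis, the abnormal extremal $g_s$ (and every its left shift) is nonstrongly abnormal if and only if $F_U(k(s),s,0)=1/F(0,s,0)$ for some $k(s)\in\mathbb{R}$: (a) $\mathfrak{g}=\mathfrak{g}_{4,10}$ and $(e_1,e_2,e_3=[e_1,e_2])$ is an adapted basis of $\mathfrak{q}$; (b) $\mathfrak{g}=2\mathfrak{g}_{2,1}$ and $\mathfrak{q}$ has an adapted basis $(e_1,e_2,e_3)$ such that $[e_1,e_2]=0$ and $0\ne[e_2,e_3]\parallel e_3$; (c) $\mathfrak{g}$ is one of $\mathfrak{g}_{3,2}\oplus\mathfrak{g}_1$, $\mathfrak{g}_{3,4}^{\alpha}\oplus\mathfrak{g}_1$ ($0\le\alpha\ne1$), $\mathfrak{g}_{4,3}$, $\mathfrak{g}_{3,5}^{\alpha}\oplus\mathfrak{g}_1$ ($\alpha\ge0$), $\mathfrak{g}_{4,1}$, $\mathfrak{g}_{4,2}^{\alpha}$ ($\alpha\notin\{0,1\}$), $\mathfrak{g}_{4,4}$, $\mathfrak{g}_{4,5}^{\alpha,\beta}$ ($-1<\alpha<\beta<1$, $\alpha\beta\ne0$, or $\alpha=-1$, $0<\beta<1$), $\mathfrak{g}_{4,6}^{\alpha,\beta}$ ($\alpha>0$, $\beta\in\mathbb{R}$), and $\mathfrak{q}$ has an adapted basis $(e_1,e_2,e_3=[e_1,e_2])$ such that $[e_2,e_3]=0$; (d) $\mathfrak{g}=\mathfrak{g}_{4,8}^{0}$ and $\mathfrak{q}$ has an adapted basis $(e_1,e_2,e_3=[e_1,e_2])$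 such that $C_{23}^1=C_{23}^2=0$. 4. In each of the following cases, with respect to the indicated adapted basis, the abnormal extremal $g_s$ (and every its left shift) is nonstrongly abnormal if and only if $F_U(0,s,0)=1/F(0,s,0)$: (a) $\mathfrak{g}=\mathfrak{g}_{3,6}\oplus\mathfrak{g}_1$ or $\mathfrak{g}=\mathfrak{g}_{3,7}\oplus\mathfrak{g}_1$, and $\mathfrak{q}$ has an adapted basis $(e_1,e_2,e_3=[e_1,e_2])$ such that $0\ne[e_2,e_3]\parallel e_1$; (b) $\mathfrak{g}$ is one of $\mathfrak{g}_{4,7}$, $\mathfrak{g}_{4,8}^{\alpha}$ ($-1\le\alpha<1$, $\alpha\ne0$), $\mathfrak{g}_{4,9}^{\alpha}$ ($\alpha\ge0$), and $\mathfrak{q}$ has an adapted basis $(e_1,e_2,e_3=[e_1,e_2])$ such that $C_{23}^1\ne0$, $C_{23}^2=0$.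
   Context: A subspace $\mathfrak{q}\subset\mathfrak{g}$ generates $\mathfrak{g}$ if the smallest Lie subalgebra containing it is $\mathfrak{g}$. An adapted basis of a three-dimensional generating subspace $\mathfrak{q}$ is a basis $(e_1,e_2,e_3)$ of $\mathfrak{q}$ such that $(e_1,e_2,e_3,e_4:=[e_1,e_3])$ is a basis of $\mathfrak{g}$ and, with $[e_i,e_j]=\sum_kC_{ij}^ke_k$, one has $C_{12}^4=C_{23}^4=0$. $x\parallel y$ means collinear. A seminorm $F$ on $\mathfrak{q}$ here is a function $F:\mathfrak{q}\to[0,\infty)$ with $F(u+v)\le F(u)+F(v)$, $F(\lambda u)=\lambda F(u)$ for $\lambda\ge 0$, and $F(u)>0$ for $u\ne 0$ (not necessarily $F(-u)=F(u)$). Put $U=\{u\in\mathfrak{q}: F(u)\le 1\}$. The left-invariant sub-Finsler quasimetric $d$ defined by $F$ is: $d(g,h)$ is the minimal time $T\ge 0$ for which there is an absolutely continuous curve from $g$ to $h$ on $[0,T]$ with $\dot g(t)=dl_{g(t)}(u(t))$ for a measurable $u(t)\in U$, where $l_g(h)=gh$. In the coordinates of a basis $(e_1,e_2,e_3)$ of $\mathfrak{q}$: $F(u_1,u_2,u_3):=F(u_1e_1+u_2e_2+u_3e_3)$ and $F_U(x,y,z)=\max_{(u_1,u_2,u_3)\in U}(xu_1+yu_2+zu_3)$. Extremals. An extremal of $(G,d)$ is an absolutely continuous curve $g:\Omega\to G$ on a maximal interval $\Omega\subset\mathbb{R}$, with a measurable control $u(t)\in\mathfrak{q}$ such that $\dot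 g(t)=dl_{g(t)}(u(t))$ and $F(u(t))=1$ for almost all $t$, for which there is a nowhere zero absolutely continuous $\psi:\Omega\to\mathfrak{g}^*$ (covectors being identified by left translations) such that for almost all $t$: $(\psi(t)(v))'=\psi(t)([u(t),v])$ for all $v\in\mathfrak{g}$, and $\psi(t)(u(t))=\max_{u\in U}\psi(t)(u)=M$ with a constant $M\ge 0$ (Pontryagin Maximum Principle). The extremal is abnormal (with respect to $\psi$) if $M=0$ and normal (with respect to $\psi$) if $M>0$. It is nonstrongly abnormal if it is abnormal with respect to some $\psi$ and normal with respect to another $\psi$; an abnormal extremal that is not nonstrongly abnormal is strongly abnormal. The Lie algebras have a basis $E_1,E_2,E_3,E_4$ with the following nonzero commutators (up to antisymmetry); in $\mathfrak{g}_{3,j}\oplus\mathfrak{g}_1$ the summand $\mathfrak{g}_1=\langle E_4\rangle$ is central: $\mathfrak{g}_{2,1}\oplus2\mathfrak{g}_1$: $[E_1,E_2]=E_1$. $2\mathfrak{g}_{2,1}$: $[E_1,E_2]=E_1$, $[E_3,E_4]=E_3$. $\mathfrak{g}_{3,1}\oplus\mathfrak{g}_1$: $[E_2,E_3]=E_1$. $\mathfrak{g}_{3,2}\oplus\mathfrak{g}_1$: $[E_2,E_3]=E_1-E_2$, $[E_3,E_1]=E_1$. $\mathfrak{g}_{3,3}\oplus\mathfrak{g}_1$: $[E_2,E_3]=-E_2$, $[E_3,E_1]=E_1$. $\mathfrak{g}_{3,4}^{\alpha}\oplus\mathfrak{g}_1$: $[E_2,E_3]=E_1-\alpha E_2$,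 $[E_3,E_1]=\alpha E_1-E_2$. $\mathfrak{g}_{3,5}^{\alpha}\oplus\mathfrak{g}_1$: $[E_2,E_3]=E_1-\alpha E_2$, $[E_3,E_1]=\alpha E_1+E_2$. $\mathfrak{g}_{3,6}\oplus\mathfrak{g}_1$: $[E_2,E_3]=E_1$, $[E_3,E_1]=E_2$, $[E_1,E_2]=-E_3$. $\mathfrak{g}_{3,7}\oplus\mathfrak{g}_1$: $[E_2,E_3]=E_1$, $[E_3,E_1]=E_2$, $[E_1,E_2]=E_3$. $\mathfrak{g}_{4,1}$: $[E_2,E_4]=E_1$, $[E_3,E_4]=E_2$. $\mathfrak{g}_{4,2}^{\alpha}$: $[E_1,E_4]=\alpha E_1$, $[E_2,E_4]=E_2$, $[E_3,E_4]=E_2+E_3$. $\mathfrak{g}_{4,3}$: $[E_1,E_4]=E_1$, $[E_3,E_4]=E_2$. $\mathfrak{g}_{4,4}$: $[E_1,E_4]=E_1$, $[E_2,E_4]=E_1+E_2$, $[E_3,E_4]=E_2+E_3$. $\mathfrak{g}_{4,5}^{\alpha,\beta}$: $[E_1,E_4]=E_1$, $[E_2,E_4]=\beta E_2$, $[E_3,E_4]=\alpha E_3$. $\mathfrak{g}_{4,6}^{\alpha,\beta}$: $[E_1,E_4]=\alpha E_1$, $[E_2,E_4]=\beta E_2-E_3$, $[E_3,E_4]=E_2+\beta E_3$. $\mathfrak{g}_{4,7}$: $[E_1,E_4]=2E_1$, $[E_2,E_4]=E_2$, $[E_3,E_4]=E_2+E_3$, $[E_2,E_3]=E_1$. $\mathfrak{g}_{4,8}^{\alpha}$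 ($-1\le\alpha\le1$): $[E_1,E_4]=(1+\alpha)E_1$, $[E_2,E_4]=E_2$, $[E_3,E_4]=\alpha E_3$, $[E_2,E_3]=E_1$. $\mathfrak{g}_{4,9}^{\alpha}$: $[E_1,E_4]=2\alpha E_1$, $[E_2,E_4]=\alpha E_2-E_3$, $[E_3,E_4]=E_2+\alpha E_3$, $[E_2,E_3]=E_1$. $\mathfrak{g}_{4,10}$: $[E_1,E_3]=E_1$, $[E_2,E_3]=E_2$, $[E_1,E_4]=-E_2$, $[E_2,E_4]=E_1$.
   Formalization: Item 1 is proved only for abnormal extremals whose control u(t) has a continuous version (left shifts of the g_s); with merely measurable controls it fails, since a curve reversing direction along exp(te_2) with e_2 central is abnormal but never normal. *)

(* Defs.v *)
(* MathComp-Analysis *)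
From HB Require Import structures.
From mathcomp Require Import all_boot all_order all_algebra.
From mathcomp Require Import all_classical all_reals all_analysis.

Set Implicit Arguments.
Unset Strict Implicit.
Unset Printing Implicit Defensive.

Import Order.TTheory GRing.Theory Num.Theory.
Import numFieldNormedType.Exports.

Local Open Scope classical_set_scope.
Local Open Scope ring_scope.

(* Meaningful for an open set A and finite-dimensional V, where it is the
   usual class C^k. *)
Fixpoint Ck {R : realType} {V W : normedModType R} (k : nat) (A : set V)
    (f : V -> W) : Prop :=
  match k with
  | 0 => forall x, A x -> {for x, continuous f}
  | k'.+1 => (forall x, A x -> differentiable f x) /\
             (forall v, Ck k' A (fun x => 'D_v f x))
  end.

Definition smooth_on {R : realType} {V W : normedModType R} (A : set V)
    (f : V -> W) : Prop :=
  forall k, Ck k A f.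

Record chart (R : realType) (n : nat) (G : Type) := Chart {
  chart_dom : set G;
  chart_fun : G -> 'rV[R]_n;
  chart_inv : 'rV[R]_n -> G }.

Definition chart_img {R : realType} {n : nat} {G : Type} (c : chart R n G) :
    set 'rV[R]_n :=
  chart_fun c @` chart_dom c.

Definition is_chart {R : realType} {n : nat} {G : topologicalType}
    (c : chart R n G) : Prop :=
  [/\ open (chart_dom c),
      open (chart_img c),
      {in chart_dom c, cancel (chart_fun c) (chart_inv c)},
      (forall x, chart_dom c x -> {for x, continuous (chart_fun c)}) &
      (forall y, chart_img c y -> {for y, continuous (chart_inv c)})].

(* The chart conditions on multiplication and inversion describe smoothness on
   open sets only because both maps are required to be continuous. *)
HB.mixin Record isLieGroup (R : realType) (n : nat) G
    of Group G & Topological G := {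
  lie_hausdorff : hausdorff_space G;
  lie_second_countable : @second_countable G;
  atlas : set (chart R n G);
  atlas_chart : forall c, atlas c -> is_chart c;
  atlas_cover : forall x : G, exists2 c, atlas c & chart_dom c x;
  atlas_compatible : forall c1 c2, atlas c1 -> atlas c2 ->
    smooth_on (chart_fun c1 @` (chart_dom c1 `&` chart_dom c2))
      (chart_fun c2 \o chart_inv c1);
  lie_mul_continuous : continuous (fun z : G * G => (z.1 * z.2)%g);
  lie_inv_continuous : continuous (fun x : G => (x^-1)%g);
  lie_mul_smooth : forall c1 c2 c3, atlas c1 -> atlas c2 -> atlas c3 ->
    smooth_on
      [set z : 'rV[R]_n * 'rV[R]_n |
        [/\ chart_img c1 z.1, chart_img c2 z.2 &
            chart_dom c3 (chart_inv c1 z.1 * chart_inv c2 z.2)%g]]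
      (fun z => chart_fun c3 (chart_inv c1 z.1 * chart_inv c2 z.2)%g);
  lie_inv_smooth : forall c1 c2, atlas c1 -> atlas c2 ->
    smooth_on
      [set y | chart_img c1 y /\ chart_dom c2 ((chart_inv c1 y)^-1)%g]
      (fun y => chart_fun c2 ((chart_inv c1 y)^-1)%g) }.

#[short(type="lieGroupType")]
HB.structure Definition LieGroup (R : realType) (n : nat) :=
  {G of isLieGroup R n G & Group G & Topological G}.

Definition smooth_fun {R : realType} {n : nat} {G : lieGroupType R n}
    (f : G -> R) : Prop :=
  forall c : chart R n G, atlas c -> smooth_on (chart_img c) (f \o chart_inv c).

(* Tangent vectors at the identity are derivations of the algebra of smooth
   functions; nothing is required on functions that are not smooth. *)
Definition derivation_at_one {R : realType} {n : nat} {G : lieGroupType R n}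
    (delta : (G -> R) -> R) : Prop :=
  (forall (a : R) (f1 f2 : G -> R), smooth_fun f1 -> smooth_fun f2 ->
     delta (fun x => a * f1 x + f2 x) = a * delta f1 + delta f2) /\
  (forall f1 f2 : G -> R, smooth_fun f1 -> smooth_fun f2 ->
     delta (fun x => f1 x * f2 x) = delta f1 * f2 1%g + f1 1%g * delta f2).

(* [dl x delta] is the tangent vector dl_x(delta) at x, where l_x y = x y. *)
Definition dl {R : realType} {n : nat} {G : lieGroupType R n} (x : G)
    (delta : (G -> R) -> R) : (G -> R) -> R :=
  fun f => delta (fun y => f (x * y)%g).

Record lieAlgebra (R : realType) := LieAlgebra {
  lie_space :> vectType R;
  bracket : lie_space -> lie_space -> lie_space;
  bracket_linear : forall a x y z,
    bracket (a *: x + y) z = a *: bracket x z + bracket y z;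
  bracket_alternating : forall x, bracket x x = 0;
  bracket_jacobi : forall x y z,
    bracket x (bracket y z) + bracket y (bracket z x) +
    bracket z (bracket x y) = 0 }.

Arguments bracket {R l}.

(* [D] identifies the vector space g with the tangent space of G at the
   identity; the bracket is the commutator of left-invariant vector fields,
   the field of v being x |-> dl x (D v). *)
Record lie_algebra_of {R : realType} {n : nat} {G : lieGroupType R n}
    {g : lieAlgebra R} (D : g -> (G -> R) -> R) : Prop := {
  lie_derivation : forall v, derivation_at_one (D v);
  lie_linear : forall (a : R) u v f, smooth_fun f ->
    D (a *: u + v) f = a * D u f + D v f;
  lie_inj : forall v, (forall f, smooth_fun f -> D v f = 0) -> v = 0;
  lie_surj : forall delta, derivation_at_one delta ->
    exists v, forall f, smooth_fun f -> D v f = delta f;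
  lie_commutator : forall u v f, smooth_fun f ->
    D (bracket u v) f = D u (fun x => dl x (D v) f) - D v (fun x => dl x (D u) f) }.

(* [gamma t] is exp(tX). *)
Definition one_parameter_subgroup {R : realType} {n : nat}
    {G : lieGroupType R n} {g : lieAlgebra R} (D : g -> (G -> R) -> R)
    (X : g) (gamma : R -> G) : Prop :=
  (forall s t, gamma (s + t) = (gamma s * gamma t)%g) /\
  (forall f, smooth_fun f -> is_derive (0 : R) 1 (f \o gamma) (D X f)).

Section AbsoluteContinuity.
Variable R : realType.

Definition abs_continuous (a b : R) (f : R -> R) : Prop :=
  forall e : R, 0 < e -> exists2 d : R, 0 < d &
    forall (m : nat) (s t : 'I_m -> R),
      (forall i, [/\ a <= s i, s i <= t i & t i <= b]) ->
      (forall i j, i != j -> t i <= s j \/ t j <= s i) ->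
      \sum_(i < m) (t i - s i) < d ->
      \sum_(i < m) `|f (t i) - f (s i)| < e.

Definition locally_abs_continuous (Om : set R) (f : R -> R) : Prop :=
  forall a b, a <= b -> `[a, b] `<=` Om -> abs_continuous a b f.

Definition almost_all (Om : set R) (P : R -> Prop) : Prop :=
  {ae (@lebesgue_measure R), forall t, Om t -> P t}.

End AbsoluteContinuity.

Section SubFinsler.
Variables (R : realType) (n : nat) (G : lieGroupType R n) (g : lieAlgebra R).
Variables (D : g -> (G -> R) -> R) (q : {vspace g}) (F : g -> R).

Definition generating : Prop :=
  forall S : {vspace g}, (q <= S)%VS ->
    (forall x y, x \in S -> y \in S -> bracket x y \in S) -> S = fullv.

(* The values of F outside q are irrelevant. *)
Definition seminorm_on : Prop :=
  [/\ (forall u, u \in q -> 0 <= F u),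
      (forall u v, u \in q -> v \in q -> F (u + v) <= F u + F v),
      (forall (a : R) u, 0 <= a -> u \in q -> F (a *: u) = a * F u) &
      (forall u, u \in q -> u != 0 -> 0 < F u)].

Definition unit_ball : set g := [set u | u \in q /\ F u <= 1].

Local Notation dual := 'Hom(g, R^o).

(* Curves are total functions; only their values on Om matter. *)
Definition trajectory (Om : set R) (x : R -> G) (u : R -> g) : Prop :=
  [/\ (forall f : G -> R, smooth_fun f -> locally_abs_continuous Om (f \o x)),
      (forall p : dual, measurable_fun Om (fun t => p (u t) : R)),
      (forall t, Om t -> u t \in q) &
      almost_all Om (fun t => forall f : G -> R, smooth_fun f ->
        is_derive t 1 (f \o x) (dl (x t) (D (u t)) f))].

Definition reachable_in (T : R) (x y : G) : Prop :=
  0 <= T /\ exists (c : R -> G) (u : R -> g),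
    [/\ trajectory `[0, T] c u, (forall t, 0 <= t <= T -> unit_ball (u t)),
        c 0 = x & c T = y].

Definition is_subFinsler_quasimetric (d : G -> G -> R) : Prop :=
  forall x y, reachable_in (d x y) x y /\
    forall T, reachable_in T x y -> d x y <= T.

Definition pontryagin (Om : set R) (u : R -> g) (psi : R -> dual) (M : R) :
    Prop :=
  [/\ (forall t, Om t -> psi t != 0),
      (forall v, locally_abs_continuous Om (fun t => psi t v)),
      almost_all Om (fun t => forall v : g,
        is_derive t 1 (fun r => psi r v : R) (psi t (bracket (u t) v))) &
      almost_all Om (fun t => psi t (u t) = M /\
        forall w, unit_ball w -> psi t w <= M)].

Definition extremal_with (Om : set R) (x : R -> G) (u : R -> g)
    (psi : R -> dual) (M : R) : Prop :=
  [/\ is_interval Om, (exists a b, [/\ a < b, Om a & Om b]),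
      trajectory Om x u, almost_all Om (fun t => F (u t) = 1) &
      0 <= M /\ pontryagin Om u psi M].

Definition extremal_arc (Om : set R) (x : R -> G) : Prop :=
  exists u psi M, extremal_with Om x u psi M.

(* The interval of definition is maximal: the curve does not extend to an
   extremal arc on a larger interval, with any covector. *)
Definition extremal (Om : set R) (x : R -> G) : Prop :=
  extremal_arc Om x /\
  forall (Om' : set R) (x' : R -> G), Om `<=` Om' ->
    (forall t, Om t -> x' t = x t) -> extremal_arc Om' x' -> Om' = Om.

Definition abnormal_wrt (Om : set R) (x : R -> G) (psi : R -> dual) : Prop :=
  extremal Om x /\ exists u, extremal_with Om x u psi 0.

Definition normal_wrt (Om : set R) (x : R -> G) (psi : R -> dual) : Prop :=
  extremal Om x /\ exists u M, 0 < M /\ extremal_with Om x u psi M.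

Definition abnormal (Om : set R) (x : R -> G) : Prop :=
  exists psi, abnormal_wrt Om x psi.

Definition nonstrongly_abnormal (Om : set R) (x : R -> G) : Prop :=
  (exists psi, abnormal_wrt Om x psi) /\ (exists psi, normal_wrt Om x psi).

Definition strongly_abnormal (Om : set R) (x : R -> G) : Prop :=
  abnormal Om x /\ ~ nonstrongly_abnormal Om x.

(* The left-translated velocity has a continuous version on Om. This excludes
   the abnormal extremals that run back and forth along a left shift of
   exp(R e2), with velocities e2 / F(e2) and - e2 / F(- e2): such a curve is
   never normal. *)
Definition continuous_velocity (Om : set R) (x : R -> G) : Prop :=
  exists2 u, trajectory Om x u &
    forall p : dual, {within Om, continuous (fun t => p (u t) : R)}.

Definition frame (e1 e2 e3 : g) : 4.-tuple g :=
  [tuple e1; e2; e3; bracket e1 e3].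

(* The indices i, j, k run from 1 to 4. *)
Definition structure_constant (e1 e2 e3 : g) (i j k : nat) : R :=
  let e := frame e1 e2 e3 in coord e (inord k.-1) (bracket e`_i.-1 e`_j.-1).

Definition adapted_basis (e1 e2 e3 : g) : Prop :=
  [/\ basis_of q [:: e1; e2; e3],
      basis_of fullv (frame e1 e2 e3),
      structure_constant e1 e2 e3 1 2 4 = 0 &
      structure_constant e1 e2 e3 2 3 4 = 0].

(* The supremum is a maximum, the unit ball being compact. *)
Definition support_fun (e1 e2 e3 : g) (x y z : R) : R :=
  sup [set r | exists u1 u2 u3,
    unit_ball (u1 *: e1 + u2 *: e2 + u3 *: e3) /\
    r = x * u1 + y * u2 + z * u3].

Definition collinear (x y : g) : Prop :=
  (x \in <[y]>%VS) || (y \in <[x]>%VS).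

Definition central (x : g) : Prop := forall y, bracket x y = 0.

Definition contains_center : Prop := forall x, central x -> x \in q.

Definition is_ideal (I : {vspace g}) : Prop :=
  forall x y, x \in I -> bracket y x \in I.

Definition contains_line_ideal : Prop :=
  exists I : {vspace g}, [/\ is_ideal I, \dim I = 1%N & (I <= q)%VS].

Definition contains_noncentral_line_ideal : Prop :=
  exists I : {vspace g}, [/\ is_ideal I, \dim I = 1%N, (I <= q)%VS &
    ~ (forall x, x \in I -> central x)].

End SubFinsler.

Section LowDimensionalAlgebras.
Variables (R : realType) (g : lieAlgebra R).

(* [c E1 E2 E3 E4] lists [E1,E2], [E1,E3], [E1,E4], [E2,E3], [E2,E4], [E3,E4]. *)
Definition has_brackets (c : g -> g -> g -> g -> seq g) : Prop :=
  exists E1 E2 E3 E4, basis_of fullv [:: E1; E2; E3; E4] /\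
    [:: bracket E1 E2; bracket E1 E3; bracket E1 E4;
        bracket E2 E3; bracket E2 E4; bracket E3 E4] = c E1 E2 E3 E4.

Implicit Types a b : R.

Definition is_g21_2g1 := has_brackets (fun E1 E2 E3 E4 =>
  [:: E1; 0; 0; 0; 0; 0]).
Definition is_2g21 := has_brackets (fun E1 E2 E3 E4 =>
  [:: E1; 0; 0; 0; 0; E3]).
Definition is_g31_g1 := has_brackets (fun E1 E2 E3 E4 =>
  [:: 0; 0; 0; E1; 0; 0]).
Definition is_g32_g1 := has_brackets (fun E1 E2 E3 E4 =>
  [:: 0; - E1; 0; E1 - E2; 0; 0]).
Definition is_g33_g1 := has_brackets (fun E1 E2 E3 E4 =>
  [:: 0; - E1; 0; - E2; 0; 0]).
Definition is_g34_g1 a := has_brackets (fun E1 E2 E3 E4 =>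
  [:: 0; - (a *: E1 - E2); 0; E1 - a *: E2; 0; 0]).
Definition is_g35_g1 a := has_brackets (fun E1 E2 E3 E4 =>
  [:: 0; - (a *: E1 + E2); 0; E1 - a *: E2; 0; 0]).
Definition is_g36_g1 := has_brackets (fun E1 E2 E3 E4 =>
  [:: - E3; - E2; 0; E1; 0; 0]).
Definition is_g37_g1 := has_brackets (fun E1 E2 E3 E4 =>
  [:: E3; - E2; 0; E1; 0; 0]).
Definition is_g41 := has_brackets (fun E1 E2 E3 E4 =>
  [:: 0; 0; 0; 0; E1; E2]).
Definition is_g42 a := has_brackets (fun E1 E2 E3 E4 =>
  [:: 0; 0; a *: E1; 0; E2; E2 + E3]).
Definition is_g43 := has_brackets (fun E1 E2 E3 E4 =>
  [:: 0; 0; E1; 0; 0; E2]).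
Definition is_g44 := has_brackets (fun E1 E2 E3 E4 =>
  [:: 0; 0; E1; 0; E1 + E2; E2 + E3]).
Definition is_g45 a b := has_brackets (fun E1 E2 E3 E4 =>
  [:: 0; 0; E1; 0; b *: E2; a *: E3]).
Definition is_g46 a b := has_brackets (fun E1 E2 E3 E4 =>
  [:: 0; 0; a *: E1; 0; b *: E2 - E3; E2 + b *: E3]).
Definition is_g47 := has_brackets (fun E1 E2 E3 E4 =>
  [:: 0; 0; 2 *: E1; E1; E2; E2 + E3]).
Definition is_g48 a := has_brackets (fun E1 E2 E3 E4 =>
  [:: 0; 0; (1 + a) *: E1; E1; E2; a *: E3]).
Definition is_g49 a := has_brackets (fun E1 E2 E3 E4 =>
  [:: 0; 0; (2 * a) *: E1; E1; a *: E2 - E3; E2 + a *: E3]).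
Definition is_g410 := has_brackets (fun E1 E2 E3 E4 =>
  [:: 0; E1; - E2; E2; E1; 0]).

End LowDimensionalAlgebras.

(* Main.v *)
(** A covector of an abnormal extremal vanishes on q, which forces the velocity
    to be u = s e2 / F(s e2). By the Jacobi identity ad e2 preserves q, so the
    restriction to q of a normal covector along exp(tu) solves a linear equation
    of its own. Such an extremal, defined for all large times, is normal if and
    only if some p in q* satisfies p <= F, p(u) = 1 and p([e2, q]) = 0: such a p
    extends to a constant covector; conversely, boundedness of the covector on q
    yields F(u + w) >= 1 for all w in [e2, q], and the Hahn-Banach theorem gives
    p. In case 1, e2 is central; in case 2, e2 is in [e2, q], which excludes p;
    in cases 3 and 4, [e2, q] is spanned by e3, respectively by e1 and e3, and
    the condition on F_U says that p exists. A maximal interval is unbounded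
    because a trajectory with constant control stays in a compact set near a
    finite end of its interval, so it can be prolonged. *)
From HB Require Import structures.
Require Import Defs.
From mathcomp Require Import all_boot all_order all_algebra.
From mathcomp Require Import all_classical all_reals all_analysis.
From mathcomp Require Import ring lra zify.

Set Implicit Arguments.
Unset Strict Implicit.
Unset Printing Implicit Defensive.

Import Order.TTheory GRing.Theory Num.Theory.
Import numFieldNormedType.Exports.

Local Open Scope classical_set_scope.
Local Open Scope ring_scope.

(** * Maps of class C^k *)

(** The direction [e2] has an invariant meaning: modulo [q], the bracket is a nonzero alternating
    form on the three-dimensional space [q], and [e2] spans its radical. A central vector of [q], or
    a line ideal inside [q], also lies in this radical, hence on the line of [e2]; only through such
    facts do the multiplication tables enter. An abnormal extremal may still switch between the two
    unit velocities along [e2]. If it is also normal, the value at [e2] of the normal covector is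
    constant and its sign excludes switching. Therefore strong abnormality is proved for all
    abnormal extremals, while nonstrong abnormality needs a continuous velocity. Tangent vectors are
    derivations and curves are seen only through smooth functions, so the analysis is done without
    integrals and flows: differential inequalities holding almost everywhere are integrated by a
    covering argument, left-invariant fields are shown to be smooth by a dimension count, and a
    curve of constant control is prolonged by left translates of a piece of itself. *)

Section CkCalculus.
Variable R : realType.

Section General.
Variables V W : normedModType R.
Implicit Types (A B : set V) (f g : V -> W).

Lemma differentiable_near0 f x : (\forall y \near x, f y = 0) ->
  differentiable f x.
Proof.
move=> f0; apply/diffP.
(* The differential is a value picked by choice, so its specification needs one witness: the zero
   map, with zero remainder near [x]. *)
apply: (@getPex _ (fun df : {linear V -> W} => continuous df /\
  forall y, f y = f (lim (nbhs x)) + df (y - lim (nbhs x))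
                  +o_(y \near x) (y - lim (nbhs x)))).
have [df df0] : exists df : {linear V -> W}, df =1 fun=> 0 by exists (\0%R : {linear V -> W}).
exists df; split; first by rewrite (_ : (df : V -> W) = fun=> 0); [exact: cst_continuous|exact: funext].
rewrite lim_id //.
move=> y; have := (eqaddoP (nbhs x) f (fun y => f x + df (y - x)) (fun y => y - x)).2.
move=> fE; apply: (congr1 (@^~ y) (fE _)) => e e0; near=> z.
by rewrite !fctE df0 (nbhs_singleton f0) (near f0 z) // !(addr0, oppr0) normr0 mulr_ge0 // ltW.
Unshelve. all: by end_near. Qed.

Lemma near_eq_differentiable f g x : (\forall y \near x, f y = g y) ->
  differentiable f x -> differentiable g x.
Proof.
move=> fg fd; rewrite -[g](subrK f); apply: differentiableD => //.
apply: differentiable_near0; near=> y; rewrite !fctE (near fg y) // subrr //.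
Unshelve. all: by end_near. Qed.

Lemma Ck_sub k A B f : B `<=` A -> Ck k A f -> Ck k B f.
Proof.
move=> BA; elim: k f => [|k IH] f /=; first by move=> fc x /BA; apply: fc.
by case=> fd fD; split=> [x /BA|v]; [exact: fd|exact: IH].
Qed.

(** [Ck] is a condition at the points of [A], on derivatives taken in the whole space, so a cover by
    sets of any shape is enough. *)
Lemma Ck_local k A f :
  (forall x, A x -> exists2 B, B x & Ck k B f) -> Ck k A f.
Proof.
elim: k f => [|k IH] f /= fl.
  by move=> x /fl[B Bx]; apply.
split=> [x /fl[B Bx []]|v]; first by move=> + _; apply.
by apply: IH => x /fl[B Bx [_ fD]]; exists B.
Qed.

Lemma Ck_congr k A f g : open A -> (forall x, A x -> f x = g x) ->
  Ck k A f -> Ck k A g.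
Proof.
move=> oA.
have nfg (f' g' : V -> W) x : (forall x, A x -> f' x = g' x) -> A x ->
    \forall y \near x, f' y = g' y.
  by move=> fg Ax; near=> y; apply: fg; near: y; exact: open_nbhs_nbhs.
elim: k f g => [|k IH] f g fg /=.
  move=> fc x Ax; rewrite /prop_for /continuous_at -(fg x Ax).
  by apply: cvg_trans (fc x Ax); apply: near_eq_cvg; exact: nfg.
case=> fd fD; split=> [x Ax|v].
  by apply: (near_eq_differentiable (nfg _ _ _ fg Ax)); exact: fd.
apply: (IH ('D_v f)) => // x Ax.
by apply: near_eq_derive; exact: nfg.
Unshelve. all: by end_near. Qed.

Lemma Ck_pred k A f : Ck k.+1 A f -> Ck k A f.
Proof.
elim: k f => [|k IH] f [fd fD].
  by move=> x Ax; apply: differentiable_continuous; exact: fd.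
by split=> // v; apply: IH; exact: fD.
Qed.

Lemma Ck_cst k A (c : W) : Ck k A (fun=> c).
Proof.
elim: k c => [|k IH] c /=; first by move=> x _; exact: cst_continuous.
split=> [x _|v]; first exact: differentiable_cst.
suff -> : (fun x => 'D_v (fun=> c) x) = fun=> 0 by exact: IH.
by apply: funext => x; rewrite derive_cst.
Qed.

Lemma Ck_add k A f g : open A -> Ck k A f -> Ck k A g ->
  Ck k A (fun x => f x + g x).
Proof.
move=> oA; elim: k f g => [|k IH] f g /=.
  by move=> fc gc x Ax; apply: cvgD; [exact: fc|exact: gc].
case=> fd fD [gd gD]; split=> [x Ax|v].
  by apply: differentiableD; [exact: fd|exact: gd].
apply: Ck_congr (IH _ _ (fD v) (gD v)) => // x Ax.
by rewrite deriveD //; apply: diff_derivable; [exact: fd|exact: gd].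
Qed.

End General.

Lemma Ck_linear_comp (V W Z : normedModType R) k (A : set V) (f : V -> W)
    (l : {linear W -> Z}) : continuous l -> open A -> Ck k A f ->
  Ck k A (l \o f).
Proof.
move=> lc oA; elim: k f => [|k IH] f /=.
  by move=> fc x Ax; apply: continuous_comp; [exact: fc|exact: lc].
case=> fd fD; split=> [x Ax|v].
  by apply: differentiable_comp; [exact: fd|exact: linear_differentiable].
apply: Ck_congr (IH _ (fD v)) => // x Ax.
rewrite deriveE; last by apply: differentiable_comp; [exact: fd|exact: linear_differentiable].
rewrite diff_comp; [|exact: fd|exact: linear_differentiable].
by rewrite /= diff_lin // deriveE //; exact: fd.
Qed.

Lemma Ck_comp_affine (V W Z : normedModType R) k (A : set W) (B : set V)
    (f : W -> Z) (l : {linear V -> W}) (c : W) : continuous l ->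
  (forall x, B x -> A (c + l x)) -> Ck k A f ->
  Ck k B (fun x => f (c + l x)).
Proof.
move=> lc BA; elim: k f => [|k IH] f /=.
  move=> fc x Bx; apply: (@continuous_comp _ _ _ (fun x => c + l x) f).
    by apply: (@cvgD _ _ _ _ _ (cst c) l); [exact: cvg_cst|exact: (lc x)].
  by apply: fc; exact: BA.
case=> fd fD; split=> [x Bx|v].
  apply: (@differentiable_comp _ _ _ _ (fun x => c + l x) f).
    by apply: differentiableD => //; exact: linear_differentiable.
  by apply: fd; exact: BA.
(* The difference quotients on both sides are the same, so the derivatives agree as total functions
   and the induction hypothesis applies to ['D_(l v) f]. *)
suff -> : (fun x => 'D_v (fun x => f (c + l x)) x) =
  fun x => 'D_(l v) f (c + l x) by exact: (IH ('D_(l v) f) (fD _)).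
apply: funext => x; rewrite /derive /=.
by under eq_fun do rewrite linearP addrCA.
Qed.

Lemma Ck_mul (V : normedModType R) k (A : set V) (f g : V -> R) : open A ->
  Ck k A f -> Ck k A g -> Ck k A (fun x => f x * g x).
Proof.
move=> oA; elim: k f g => [|k IH] f g.
  by move=> fc gc x Ax; apply: cvgM; [exact: fc|exact: gc].
move=> fS gS; move: (fS) (gS) => [fd fD] [gd gD]; split=> [x Ax|v].
  by apply: differentiableM; [exact: fd|exact: gd].
have fk := Ck_pred fS; have gk := Ck_pred gS.
have := Ck_add oA (IH _ _ fk (gD v)) (IH _ _ gk (fD v)).
apply: Ck_congr => // x Ax.
by rewrite deriveM //; apply: diff_derivable; [exact: fd|exact: gd].
Qed.

Lemma Ck_sum (V W : normedModType R) k (A : set V) n (f : 'I_n -> V -> W) :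
  open A -> (forall i, Ck k A (f i)) -> Ck k A (fun x => \sum_i f i x).
Proof.
move=> oA; elim: n f => [|n IH] f fC.
  suff -> : (fun x => \sum_i f i x) = fun=> 0 by exact: Ck_cst.
  by apply: funext => x; rewrite big_ord0.
suff -> : (fun x => \sum_i f i x) = fun x => f ord0 x + \sum_i f (lift ord0 i) x.
  by apply: Ck_add => //; apply: IH.
by apply: funext => x; rewrite big_ord_recl.
Qed.

Definition coord_linear n (i : 'I_n) : 'rV[R]_n -> R := fun y => y 0 i.

Lemma coord_linear_is_linear n (i : 'I_n) : linear (@coord_linear n i : _ -> R^o).
Proof. by move=> a u v; rewrite /coord_linear !mxE. Qed.

HB.instance Definition _ n (i : 'I_n) := GRing.isLinear.Build R 'rV[R]_n R^o _
  (@coord_linear n i) (coord_linear_is_linear i).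

Lemma Ck_coord (V : normedModType R) n k (A : set V) (f : V -> 'rV[R]_n)
  (i : 'I_n) : open A -> Ck k A f -> Ck k A (fun x => f x 0 i : R).
Proof.
by apply: (Ck_linear_comp (l := @coord_linear n i)); exact: coord_continuous.
Qed.

(** The chain rule differentiates [f] in the direction ['D_v g x], which moves with [x]. Expanding
    it in the standard basis leaves derivatives of [f] in fixed directions, to which the induction
    hypothesis applies. *)
Lemma Ck_comp (V : normedModType R) n k (A : set 'rV[R]_n) (B : set V)
    (f : 'rV[R]_n -> R) (g : V -> 'rV[R]_n) : open B ->
  (forall x, B x -> A (g x)) -> Ck k A f -> Ck k B g -> Ck k B (f \o g).
Proof.
move=> oB BA; elim: k f g BA => [|k IH] f g BA.
  move=> fc gc x Bx; apply: continuous_comp; first exact: gc.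
  by apply: fc; exact: BA.
move=> [fd fD] gS; move: (gS) => [gd gD]; split=> [x Bx|v].
  by apply: differentiable_comp; [exact: gd|apply: fd; exact: BA].
have gk := Ck_pred gS.
have : Ck k B (fun x => \sum_i ('D_v g x) 0 i * 'D_(delta_mx 0 i) f (g x)).
  apply: Ck_sum => // i; apply: Ck_mul => //.
    by apply: Ck_coord => //; exact: gD.
  exact: (IH _ _ BA (fD _) gk).
apply: Ck_congr => // x Bx.
have fdx := fd _ (BA _ Bx); have gdx := gd _ Bx.
rewrite [RHS]deriveE; last exact: differentiable_comp.
rewrite diff_comp //= -(deriveE _ gdx) [in RHS](row_sum_delta ('D_v g x)).
rewrite linear_sum; apply: eq_bigr => i _.
by rewrite linearZ /= -deriveE.
Qed.

End CkCalculus.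

(** * Functions flat at 0 and smooth bumps *)

Section FlatFunction.
Variable R : realType.
Implicit Types (p : {poly R}) (x : R).

(** The exponential dominates each term of its series, so the monomial of degree i times exp(-y) is
    at most i!. *)
Lemma horner_expRN_bounded p :
  exists C, forall y, 0 <= y -> `|p.[y]| * expR (- y) <= C.
Proof.
exists (\sum_(i < size p) `|p`_i| * i`!%:R) => y y0.
have yi i : y ^+ i * expR (- y) <= i`!%:R.
  rewrite expRN ler_pdivrMr ?expR_gt0 //.
  case: i => [|i]; first by rewrite expr0 mul1r; apply: le_trans (expR_ge1Dx y); rewrite lerDl.
  have := expR_ge1Dxn i y0.
  have f0 : 0 < i.+1`!%:R :> R by rewrite ltr0n fact_gt0.
  rewrite -ler_pdivrMl // => /(le_trans _); apply.
  by rewrite mulrC lerDr.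
rewrite horner_coef; apply: le_trans (_ : (\sum_(i < size p) `|p`_i * y ^+ i|) * expR (- y) <= _).
  by rewrite ler_wpM2r ?expR_ge0 // ler_norm_sum.
rewrite mulr_suml; apply: ler_sum => i _.
by rewrite normrM -mulrA ler_wpM2l // ger0_norm ?exprn_ge0.
Qed.

(* All derivatives of [flat 1], i.e. of exp(-1/x) extended by 0, are of the
   form [flat p]. *)
Definition flat p x : R := if 0 < x then p.[x^-1] * expR (- x^-1) else 0.

(** The previous bound for ['X^2 * p] at [x^-1] gains the factor [x ^+ 2]. Quadratic decay makes the
    difference quotient at 0 tend to 0. *)
Lemma flat_sqr_bounded p : exists2 C, 0 < C & forall x, `|flat p x| <= C * `|x| ^+ 2.
Proof.
have [C hC] := horner_expRN_bounded ('X^2 * p).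
have C0 : 0 <= C by apply: le_trans (hC 0 (lexx 0)); rewrite mulr_ge0 ?expR_ge0.
exists (C + 1); first by rewrite ltr_wpDl.
move=> x; apply: (@le_trans _ _ (C * `|x| ^+ 2)); last by rewrite ler_wpM2r ?exprn_ge0 ?lerDl.
rewrite /flat; case: ifPn => x0; last by rewrite normr0 mulr_ge0 ?exprn_ge0.
have := hC x^-1; rewrite invr_ge0 (ltW x0) => /(_ isT).
have -> : `|('X^2 * p).[x^-1]| = `|p.[x^-1]| / `|x| ^+ 2.
  by rewrite hornerM hornerXn exprVn mulrC normrM normfV normrX.
rewrite normrM (ger0_norm (expR_ge0 _)) mulrAC ler_pdivrMr //.
by rewrite exprn_gt0 // normr_gt0 gt_eqF.
Qed.

(** Differentiating p(1/x) exp(-1/x) brings out the factor 1/x^2 and leaves p - p' at 1/x. The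
    result is again of the form [flat], so smoothness follows by induction over all polynomials at
    once. *)
Lemma is_derive_flat p x : is_derive x 1 (flat p) (flat ('X^2 * (p - p^`())) x).
Proof.
have [x0|x0|x0] := ltrgtP x 0.
- rewrite [X in is_derive _ _ _ X]/flat ltNge (ltW x0) /=.
  apply: (near_eq_is_derive (f := cst 0)).
  near=> y; rewrite /flat ltNge ifN // negbK ltW //.
  by near: y; exact: lt_nbhsl.
- rewrite [X in is_derive _ _ _ X]/flat x0.
  have dV : is_derive x 1 (@GRing.inv R) (- x^-1 ^+ 2).
    have := @is_deriveV R id x 1 1 (lt0r_neq0 x0) (is_derive_id _ _).
    by rewrite /GRing.scale /= mulr1 exprVn.
  have d1 : is_derive x 1 (horner p \o @GRing.inv R) (p^`().[x^-1] * - x^-1 ^+ 2).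
    exact: is_derive1_comp.
  have d2 : is_derive x 1 (expR \o (fun x => - x^-1)) (expR (- x^-1) * x^-1 ^+ 2).
    by apply: is_derive1_comp; rewrite -[_ ^+ 2]opprK; exact: is_deriveN.
  apply: (near_eq_is_derive (f := (horner p \o @GRing.inv R) * (expR \o (fun x => - x^-1)))).
    by near=> y; rewrite /flat ifT //; near: y; exact: lt_nbhsr.
  apply: (is_derive_eq (is_deriveM d1 d2)).
  rewrite /= hornerM hornerXn hornerD hornerN /GRing.scale /=; ring.
- have [C C0 hC] := flat_sqr_bounded p.
  rewrite x0 [X in is_derive _ _ _ X]/flat ltxx.
  have f0 : flat p 0 = 0 by rewrite /flat ltxx.
  have cv : (fun h => h^-1 *: ((flat p \o shift 0) (h *: 1) - flat p 0)) @ 0^' --> (0 : R).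
    apply/cvgrPdist_le => e e0; near=> h.
    have h0 : h != 0 by near: h; exact: nbhs_dnbhs_neq.
    rewrite sub0r normrN f0 subr0 /= addr0 /GRing.scale /= mulr1 normrM normfV.
    rewrite ler_pdivrMl ?normr_gt0 //.
    apply: le_trans (hC h) _; rewrite mulrC expr2 -mulrA ler_wpM2l //.
    rewrite -ler_pdivlMr //; near: h; apply: dnbhs0_le; exact: divr_gt0.
  by apply: DeriveDef; [apply/cvg_ex; exists 0|exact: cvg_lim].
Unshelve. all: by end_near. Qed.

Lemma Ck_flat k (A : set R) p : Ck k A (flat p).
Proof.
have dflat q x : differentiable (flat q) x.
  by apply/derivable1_diffP; have [] := is_derive_flat q x.
elim: k p => [|k IH] p.
  by move=> x _; exact: differentiable_continuous.
split=> [x _|v]; first exact: dflat.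
suff -> : (fun x => 'D_v (flat p) x) = flat ((v : R)%:P * ('X^2 * (p - p^`()))) by exact: IH.
apply: funext => x; rewrite deriveE // -[v]mulr1 -[v * 1]/(v *: (1 : R)) linearZ.
rewrite -deriveE //; have [_ ->] := is_derive_flat p x.
rewrite /flat; case: ifP => _; last exact: mulr0.
by rewrite [in RHS]hornerM hornerC -[in RHS]mulrA [v%:A]mulr1.
Qed.

Lemma Ck_comp_real (V : normedModType R) k (A : set R) (B : set V)
    (f : R -> R) (g : V -> R) : open B ->
  (forall x : V, B x -> A (g x)) -> Ck k A f -> Ck k B g -> Ck k B (f \o g).
Proof.
move=> oB BA; elim: k f g BA => [|k IH] f g BA.
  move=> fc gc x Bx; apply: continuous_comp; first exact: gc.
  by apply: fc; exact: BA.
move=> [fd fD] gS; move: (gS) => [gd gD]; split=> [x Bx|v].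
  by apply: differentiable_comp; [exact: gd|apply: fd; exact: BA].
have gk := Ck_pred gS.
have : Ck k B (fun x : V => 'D_v g x * 'D_1 f (g x)).
  by apply: Ck_mul => //; [exact: gD|exact: (IH _ _ BA (fD 1) gk)].
apply: Ck_congr => // x Bx.
have fdx := fd _ (BA _ Bx); have gdx := gd _ Bx.
rewrite [RHS]deriveE; last exact: differentiable_comp.
rewrite diff_comp //= -(deriveE _ gdx).
by rewrite -[in RHS](mulr1 ('D_v g x)) -[_ * 1]/(_ *: (1 : R)) linearZ -deriveE.
Qed.

Lemma Ck_id (V : normedModType R) k (A : set V) : Ck k A (@id V).
Proof.
case: k => [|k]; first by move=> x _; exact: cvg_id.
split=> [x _|v]; first exact: ex_diff.
suff -> : (fun x : V => 'D_v (@id V) x) = fun=> v by exact: Ck_cst.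
by apply: funext => x; rewrite derive_id.
Qed.

(** The squared Euclidean distance is smooth, unlike the maximum norm of row vectors; the Euclidean
    ball lies inside the ball of that norm with the same radius. *)
Definition smooth_bump n (y0 : 'rV[R]_n) (r : R) (y : 'rV[R]_n) : R :=
  flat 1 (r ^+ 2 - \sum_i (y 0 i - y0 0 i) ^+ 2).

Lemma Ck_shifted_coord n k (y0 : 'rV[R]_n) i :
  Ck k setT (fun y : 'rV[R]_n => y 0 i - y0 0 i : R).
Proof.
apply: Ck_add; [exact: openT| |exact: Ck_cst].
by apply: Ck_coord; [exact: openT|exact: Ck_id].
Qed.

Lemma Ck_smooth_bump n k (y0 : 'rV[R]_n) r : Ck k setT (smooth_bump y0 r).
Proof.
apply: (@Ck_comp_real _ _ setT _ (flat 1)) => //; [exact: openT|exact: Ck_flat|].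
apply: Ck_add; [exact: openT|exact: Ck_cst|].
suff -> : (fun y : 'rV[R]_n => - \sum_i (y 0 i - y0 0 i) ^+ 2 : R) =
    fun y => (- 1) * \sum_i (y 0 i - y0 0 i) ^+ 2.
  apply: Ck_mul; [exact: openT|exact: Ck_cst|].
  apply: Ck_sum; first exact: openT.
  by move=> i; apply: Ck_mul; [exact: openT| |]; exact: Ck_shifted_coord.
by apply: funext => y; rewrite mulN1r.
Qed.

Lemma smooth_bump_center_gt0 n (y0 : 'rV[R]_n) r : 0 < r -> 0 < smooth_bump y0 r y0.
Proof.
move=> r0; rewrite /smooth_bump big1 => [|i _]; last by rewrite subrr expr0n.
by rewrite subr0 /flat exprn_gt0 // hornerC mul1r expR_gt0.
Qed.

Lemma smooth_bump_support n (y0 : 'rV[R]_n) r y : 0 < r -> smooth_bump y0 r y != 0 ->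
  `|y0 - y| <= r.
Proof.
move=> r0; rewrite /smooth_bump /flat; case: ifPn => [|_]; last by rewrite eqxx.
rewrite subr_gt0 => lt_r _; rewrite /Num.Def.normr /= mx_normrE.
apply: bigmax_le => [|[i j] _]; first exact: ltW.
rewrite ord1 -(ler_pXn2r (n := 2)) ?nnegrE ?(ltW r0) // !mxE distrC.
apply: (le_trans _ (ltW lt_r)); rewrite real_normK ?num_real //.
by rewrite (bigD1 j) //= lerDl sumr_ge0 // => k _; rewrite sqr_ge0.
Qed.

End FlatFunction.

(** * Absolutely continuous functions *)

Section AbsolutelyContinuous.
Variable R : realType.
Implicit Types (a b s t : R) (f g : R -> R) (U : set R).

Lemma ae_imply (P Q : R -> Prop) : {ae (@lebesgue_measure R), forall t, P t} ->
  (forall t, P t -> Q t) -> {ae (@lebesgue_measure R), forall t, Q t}.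
Proof. by move=> aeP PQ; apply: negligibleS aeP => t /= nQ Pt; exact/nQ/PQ. Qed.

Lemma ae_and (P Q : R -> Prop) : {ae (@lebesgue_measure R), forall t, P t} ->
  {ae (@lebesgue_measure R), forall t, Q t} ->
  {ae (@lebesgue_measure R), forall t, P t /\ Q t}.
Proof.
move=> aeP aeQ; apply: negligibleS (negligibleU aeP aeQ) => t /= nPQ.
by have [Pt|] := pselect (P t); [right=> Qt; exact: nPQ|left].
Qed.

(** The intervals are listed from right to left, between [a] and [hi], so that an argument moving to
    the right adds the newest one at the head. They may touch or be degenerate. *)
Fixpoint chain a U (hi : R) (l : seq (R * R)) : Prop :=
  match l with
  | [::] => a <= hi
  | (s, t) :: l' => [/\ t <= hi, s <= t, `[s, t] `<=` U & chain a U s l']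
  end.

Lemma chain_ge a U hi l : chain a U hi l -> a <= hi.
Proof.
elim: l hi => [//|[s t] l IH] hi /= [thi st _ /IH as_].
exact: le_trans as_ (le_trans st thi).
Qed.

Lemma chain_le a U hi hi' l : hi <= hi' -> chain a U hi l -> chain a U hi' l.
Proof.
move=> hh; case: l => [|[s t] l] /=; first by move/le_trans; exact.
by case=> thi st sU c; split=> //; exact: le_trans hh.
Qed.

Lemma chain_nth a U hi l : chain a U hi l -> forall i, (i < size l)%N ->
  [/\ a <= (nth (0, 0) l i).1, (nth (0, 0) l i).1 <= (nth (0, 0) l i).2 &
      (nth (0, 0) l i).2 <= hi].
Proof.
elim: l hi => [//|[s t] l IH] hi /= [thi st _ c] [_ /=|i /(IH _ c)[a1 a2 a3]].
  by split=> //; exact: chain_ge c.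
by split=> //; apply: le_trans a3 (le_trans st thi).
Qed.

Lemma chain_disjoint a U hi l : chain a U hi l -> forall i j,
  (i < j)%N -> (j < size l)%N -> (nth (0, 0) l j).2 <= (nth (0, 0) l i).1.
Proof.
elim: l hi => [//|[s t] l IH] hi /= [thi st _ c] [|i] [|j] //= ij jl.
  by have [] := chain_nth c jl.
exact: (IH _ c).
Qed.

(** Half-open intervals keep touching neighbours disjoint, so that their measures add up. *)
Lemma chain_measure a U hi l : measurable U -> chain a U hi l ->
  ((\sum_(p <- l) (p.2 - p.1))%:E <= lebesgue_measure (U `&` `[a, hi[))%E.
Proof.
move=> mU; elim: l hi => [|[s t] l IH] hi /=; first by rewrite big_nil.
case=> thi st sU c; rewrite big_cons /=.
have mst : measurable (`[s, t[ : set R) by exact: measurable_itv.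
have mas : measurable (U `&` `[a, s[ : set R) by exact: measurableI.
apply: (@le_trans _ _ (lebesgue_measure (`[s, t[ `|` (U `&` `[a, s[)))).
  rewrite measureU //; last first.
    rewrite -subset0 => x [] /=; rewrite !in_itv /= => /andP[sx _] [_ /andP[_]].
    by rewrite ltNge sx.
  rewrite EFinD leeD //; last exact: IH.
  rewrite [leRHS](lebesgue_measure_itv `[s, t[) /= lte_fin; case: ltP => // ts.
  by rewrite lee_fin subr_le0.
apply: le_measure; rewrite ?inE; [exact: measurableU|exact: measurableI|].
have as_ := chain_ge c.
move=> x [] /=; rewrite !in_itv /=.
  move=> /andP[sx xt]; split.
    by apply: sU; rewrite /= in_itv /= sx ltW.
  by rewrite (le_trans as_ sx) (lt_le_trans xt thi).
move=> [Ux /andP[ax xs]]; split=> //.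
by rewrite ax (lt_le_trans xs (le_trans st thi)).
Qed.

(* [a, b] is cut into a chain of subintervals on each of which [f] grows with slope at most [e],
   except for subintervals inside the small open set [U] containing the
   exceptional points, whose total contribution is at most [e]. *)
Lemma abs_continuous_nonincreasing a b f : a <= b -> abs_continuous a b f ->
  {ae (@lebesgue_measure R), forall t, `[a, b]%classic t ->
    exists2 d, d <= 0 & is_derive t 1 f d} ->
  f b <= f a.
Proof.
move=> ab fac [N [mN N0 fN]].
suff fe e : 0 < e -> f b - f a <= e * (b - a) + e.
  rewrite -subr_le0; apply/ler_addgt0Pr => e e0; rewrite add0r.
  have k0 : 0 < b - a + 1 by rewrite ltr_wpDl // subr_ge0.
  have := fe _ (divr_gt0 e0 k0); move=> /le_trans; apply.
  rewrite -mulrA -mulrDr [X in _ * X](_ : _ = (b - a + 1) / (b - a + 1)).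
    by rewrite mulrV ?mulr1 // unitfE gt_eqF.
  by rewrite mulrDl mulrC mul1r.
move=> e0; have [d d0 fd] := fac _ e0.
have [U [oU NU UNd]] : exists U : set R, [/\ open U, N `<=` U &
    (lebesgue_measure (U `\` N) < d%:E)%E].
  by apply: lebesgue_regularity_outer => //; rewrite ?N0 // [X in (X < _)%E]N0 ltry.
have Ud : (lebesgue_measure U < d%:E)%E.
  have mU : measurable (U : set R) by exact: measurable_realfun.open_measurable.
  have -> : lebesgue_measure U =
      (lebesgue_measure (U `\` N) + lebesgue_measure (U `&` N))%E by exact: measureDI.
  rewrite [X in (_ + X)%E](_ : _ = 0%E) ?adde0 //.
  apply/eqP; rewrite -measure_le0 -N0; apply: le_measure; rewrite ?inE //.
  by apply: measurableI => //; exact: measurable_realfun.open_measurable.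
have small l : chain a U b l -> \sum_(p <- l) `|f p.2 - f p.1| < e.
  move=> c; rewrite (big_nth (0, 0)) big_mkord.
  apply: (fd (size l) (fun i => (nth (0, 0) l i).1) (fun i => (nth (0, 0) l i).2)).
  - by move=> i; exact: chain_nth c _ (ltn_ord i).
  - move=> i j ij; have [lt_ij|lt_ji|/val_inj eij] := ltngtP i j.
    + by right; exact: chain_disjoint c _ _ lt_ij (ltn_ord j).
    + by left; exact: chain_disjoint c _ _ lt_ji (ltn_ord i).
    + by rewrite eij eqxx in ij.
  - rewrite -(big_mkord xpredT (fun i => (nth (0, 0) l i).2 - (nth (0, 0) l i).1)).
    rewrite -(big_nth (0, 0) xpredT (fun p => p.2 - p.1)) -lte_fin.
    apply: le_lt_trans (chain_measure (measurable_realfun.open_measurable oU) c) _.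
    apply: le_lt_trans Ud; apply: le_measure; rewrite ?inE; last exact: subIsetl.
      by apply: measurableI => //; exact: measurable_realfun.open_measurable.
    exact: measurable_realfun.open_measurable.
(* Induction along the real line: [P] holds at [a], passes to the supremum [c] of the points where
   it holds, and would pass beyond [c] if [c] were less than [b]. *)
pose P t := [/\ a <= t, t <= b & exists2 l, chain a U t l &
  f t - f a <= e * (t - a) + \sum_(p <- l) `|f p.2 - f p.1|].
have Pa : P a.
  split; [exact: lexx|exact: ab|exists [::]; first exact: lexx].
  by rewrite big_nil !subrr mulr0 addr0.
have loc c : a <= c -> c <= b -> exists2 h, 0 < h & forall s t,
    c - h < s -> s <= c -> c <= t -> t < c + h ->
    f t - f s <= e * (t - s) \/ `[s, t] `<=` U.
  move=> ac cb; have [Nc|Nc] := pselect (N c).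
    have /nbhs_ballP[h /= h0 hU] : nbhs c U by apply: open_nbhs_nbhs; split=> //; exact: NU.
    exists h => // s t cs sc ct th; right=> x /=; rewrite in_itv /= => /andP[sx xt].
    by apply: hU; rewrite /ball /= ltr_norml; apply/andP; split; lra.
  have [d1 d10 [fc fc1]] : exists2 d, d <= 0 & is_derive c 1 f d.
    by apply: contrapT => Hc; apply: Nc; apply: fN => /=; apply: contra_not Hc; apply; rewrite in_itv /= ac cb.
  have : (fun h => h^-1 *: ((f \o shift c) (h *: 1) - f c)) @ 0^' --> d1.
    by rewrite -fc1.
  move=> /cvgrPdist_lt /(_ _ e0) [h /= h0 hd].
  have key x : `|x| < h -> x != 0 -> (f (x + c) - f c) / x < e.
    move=> xh x0; have := hd x; rewrite /ball_ /= sub0r normrN => /(_ xh x0).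
    rewrite /shift /= /GRing.scale /= mulr1 mulrC ltr_norml => /andP[k1 _]; lra.
  exists h => // s t cs sc ct th; left.
  have k1 : f t - f c <= e * (t - c).
    have [->|tc] := eqVneq t c; first by rewrite !subrr mulr0.
    have tc0 : 0 < t - c by rewrite subr_gt0 lt_neqAle eq_sym tc.
    have := key (t - c); rewrite subrK gt_eqF // gtr0_norm // => /(_ _ isT) k.
    by rewrite -ler_pdivrMr // ltW // k //; lra.
  have k2 : f c - f s <= e * (c - s).
    have [->|sc1] := eqVneq s c; first by rewrite !subrr mulr0.
    have sc0 : s - c < 0 by rewrite subr_lt0 lt_neqAle sc1.
    have := key (s - c); rewrite subrK lt_eqF // ltr0_norm // => /(_ _ isT) k.
    have {}k : (f s - f c) / (s - c) < e by apply: k; lra.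
    by move: k; rewrite ltr_ndivrMr // => k; lra.
  lra.
have step c h s t : P s -> (forall s t, c - h < s -> s <= c -> c <= t -> t < c + h ->
    f t - f s <= e * (t - s) \/ `[s, t] `<=` U) ->
    c - h < s -> s <= c -> c <= t -> t < c + h -> t <= b -> P t.
  move=> [as_ sb [l cl fl]] hc cs sc ct th tb; split=> //.
    exact: le_trans as_ (le_trans sc ct).
  have [fst|stU] := hc s t cs sc ct th.
    exists l; first by apply: chain_le cl; exact: le_trans sc ct.
    by move: fl fst; set S := \sum_(p <- l) _; lra.
  exists ((s, t) :: l); first by split=> //; exact: le_trans sc ct.
  rewrite big_cons /=; move: fl (ler_norm (f t - f s)).
  have : 0 <= e * (t - s) by apply: mulr_ge0; [exact: ltW|rewrite subr_ge0; exact: le_trans ct].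
  by set S := \sum_(p <- l) _; lra.
pose c := sup [set t | P t].
have supP : has_sup [set t | P t] by split; [exists a|exists b => t []].
have Pc : P c.
  have ac : a <= c by apply: ub_le_sup => //; case: supP.
  have cb : c <= b by apply: ge_sup; [exists a|move=> t []].
  have [h h0 hc] := loc c ac cb.
  have [s Ps cs] := sup_adherent h0 supP.
  by apply: (step c h s c Ps hc) => //; [apply: ub_le_sup => //; case: supP|rewrite ltrDl].
have cb : c = b.
  case: (Pc) => ac cb _; apply/eqP; rewrite eq_le cb /= leNgt; apply/negP => cb'.
  have [h h0 hc] := loc c ac cb.
  have : P (Num.min b (c + h / 2)).
    apply: (step c h c _ Pc hc) => //; rewrite ?ltrBlDr ?ltrDl ?ge_min ?lexx //.
      by rewrite le_min cb lerDl divr_ge0 // ltW.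
    by rewrite gt_min; apply/orP; right; lra.
  move=> /(ub_le_sup (proj2 supP)); rewrite -/c ge_min leNgt cb' /=; lra.
case: Pc; rewrite cb => _ _ [l cl fl]; have := small l cl; lra.
Qed.

Lemma lipschitz_abs_continuous a b f C :
  (forall s t, a <= s -> s <= t -> t <= b -> `|f t - f s| <= C * (t - s)) ->
  abs_continuous a b f.
Proof.
move=> fC e e0; pose K := `|C| + 1.
have K0 : 0 < K by rewrite ltr_wpDl.
exists (e / K); first exact: divr_gt0.
move=> m s t st _ sd; apply: (@le_lt_trans _ _ (K * \sum_(i < m) (t i - s i))).
  rewrite mulr_sumr; apply: ler_sum => i _; have [as_ sit tb] := st i.
  apply: le_trans (fC _ _ as_ sit tb) _; rewrite ler_wpM2r ?subr_ge0 //.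
  by apply: le_trans (ler_norm C) _; rewrite lerDl.
by rewrite mulrC -ltr_pdivlMr.
Qed.

Lemma abs_continuousD a b f g : abs_continuous a b f -> abs_continuous a b g ->
  abs_continuous a b (fun t => f t + g t).
Proof.
move=> fa ga e e0; have e20 : 0 < e / 2 by rewrite divr_gt0.
have [d1 d10 fd] := fa _ e20; have [d2 d20 gd] := ga _ e20.
exists (Num.min d1 d2); first by rewrite lt_min d10.
move=> m s t st dis; rewrite lt_min => /andP[sd1 sd2].
apply: (@le_lt_trans _ _ (\sum_(i < m) `|f (t i) - f (s i)| + \sum_(i < m) `|g (t i) - g (s i)|)).
  rewrite -big_split; apply: ler_sum => i _.
  by rewrite opprD addrACA ler_normD.
by rewrite (splitr e) ltrD ?fd ?gd.
Qed.

Lemma abs_continuousN a b f : abs_continuous a b f ->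
  abs_continuous a b (fun t => - f t).
Proof.
move=> fa e e0; have [d d0 fd] := fa _ e0; exists d => // m s t st dis sd.
apply: le_lt_trans (fd m s t st dis sd); apply: ler_sum => i _.
by rewrite -opprD normrN.
Qed.

Lemma abs_continuous_eq a b f g : (forall t, a <= t <= b -> f t = g t) ->
  abs_continuous a b f -> abs_continuous a b g.
Proof.
move=> fg fa e e0; have [d d0 fd] := fa _ e0; exists d => // m s t st dis sd.
apply: le_lt_trans (fd m s t st dis sd); apply: ler_sum => i _.
have [as_ sit tb] := st i; rewrite !fg ?as_ ?tb ?(le_trans sit tb) //.
by rewrite (le_trans as_ sit).
Qed.

Lemma abs_continuous_shift a b c f : abs_continuous a b f ->
  abs_continuous (a + c) (b + c) (fun t => f (t - c)).
Proof.
move=> fa e e0; have [d d0 fd] := fa _ e0; exists d => // m s t st dis sd.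
apply: (fd m (fun i => s i - c) (fun i => t i - c)).
- by move=> i; have [? ? ?] := st i; split; lra.
- by move=> i j /dis[]; [left|right]; lra.
- by under eq_bigr do rewrite opprB addrA subrK.
Qed.

Lemma abs_continuous_glue a m b f : a <= m -> m <= b -> abs_continuous a m f ->
  abs_continuous m b f -> abs_continuous a b f.
Proof.
move=> am mb f1 f2 e e0; have e20 : 0 < e / 2 by rewrite divr_gt0.
have [d1 d10 fd1] := f1 _ e20; have [d2 d20 fd2] := f2 _ e20.
exists (Num.min d1 d2); first by rewrite lt_min d10.
move=> n s t st dis; rewrite lt_min => /andP[sd1 sd2].
(* Clamping every interval to each side of [m] treats an interval across [m] like the others; those
   on the wrong side become degenerate. *)
pose lo x := Num.min x m; pose hi x := Num.max x m.
have lo_mono x y : x <= y -> lo x <= lo y /\ lo y - lo x <= y - x.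
  by rewrite /lo !minElt; case: (ltP x m); case: (ltP y m); split; lra.
have hi_mono x y : x <= y -> hi x <= hi y /\ hi y - hi x <= y - x.
  by rewrite /hi !maxElt; case: (ltP x m); case: (ltP y m); split; lra.
have lohi x : f x = f (lo x) + f (hi x) - f m.
  by rewrite /lo /hi !minElt !maxElt; case: ltP; lra.
apply: (@le_lt_trans _ _ (\sum_(i < n) `|f (lo (t i)) - f (lo (s i))| +
    \sum_(i < n) `|f (hi (t i)) - f (hi (s i))|)).
  rewrite -big_split /=; apply: ler_sum => i _; rewrite (lohi (t i)) (lohi (s i)).
  by apply: le_trans (ler_normD _ _); rewrite le_eqVlt; apply/orP; left; apply/eqP; congr (`|_|); lra.
rewrite (splitr e) ltrD //.
- apply: (fd1 n (lo \o s) (lo \o t)).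
  + move=> i; have [as_ sit tb] := st i; split=> /=.
    * by rewrite le_min as_ am.
    * exact: (lo_mono _ _ sit).1.
    * by rewrite ge_min lexx orbT.
  + by move=> i j /dis[]/lo_mono[? _]; [left|right].
  + apply: le_lt_trans sd1; apply: ler_sum => i _; have [_ sit _] := st i.
    exact: (lo_mono _ _ sit).2.
- apply: (fd2 n (hi \o s) (hi \o t)).
  + move=> i; have [as_ sit tb] := st i; split=> /=.
    * by rewrite le_max lexx orbT.
    * exact: (hi_mono _ _ sit).1.
    * by rewrite ge_max tb mb.
  + by move=> i j /dis[]/hi_mono[? _]; [left|right].
  + apply: le_lt_trans sd2; apply: ler_sum => i _; have [_ sit _] := st i.
    exact: (hi_mono _ _ sit).2.
Qed.

Lemma abs_continuous_slope_le a b f C : a <= b -> abs_continuous a b f ->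
  {ae (@lebesgue_measure R), forall t, `[a, b]%classic t ->
    exists2 d, d <= C & is_derive t 1 f d} ->
  f b - f a <= C * (b - a).
Proof.
move=> ab fa fd.
have lin : abs_continuous a b (fun t => - C * t).
  apply: (@lipschitz_abs_continuous _ _ _ `|C|) => s t _ st _.
  by rewrite -mulrBr normrM normrN [`|t - s|]ger0_norm ?subr_ge0.
suff : f b + - C * b <= f a + - C * a by lra.
apply: (@abs_continuous_nonincreasing a b (fun t => f t + - C * t)) => //.
  exact: abs_continuousD.
apply: (ae_imply fd) => t ft /ft[d dC {}fd]; exists (d - C); first by rewrite subr_le0.
apply: (@is_deriveD _ _ _ f (fun t => - C * t)) => //.
by have := @is_deriveZ R R R id (- C) t 1 1 (is_derive_id _ _); rewrite [_ *: 1]mulr1.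
Qed.

Lemma abs_continuous_lipschitz a b f C : a <= b -> abs_continuous a b f ->
  {ae (@lebesgue_measure R), forall t, `[a, b]%classic t ->
    exists2 d, `|d| <= C & is_derive t 1 f d} ->
  `|f b - f a| <= C * (b - a).
Proof.
move=> ab fa fd; rewrite ler_norml; apply/andP; split; last first.
  apply: abs_continuous_slope_le => //; apply: (ae_imply fd) => t ft /ft[d dC {}fd].
  by exists d => //; apply: le_trans (ler_norm _) dC.
rewrite lerNl opprB.
rewrite (_ : f a - f b = - f b - - f a); last by rewrite opprK addrC.
apply: (@abs_continuous_slope_le a b (fun t => - f t)) => //.
  exact: abs_continuousN.
apply: (ae_imply fd) => t ft /ft[d dC {}fd]; exists (- d); last exact: is_deriveN.
by apply: le_trans (ler_norm _) _; rewrite normrN.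
Qed.

Lemma derivable_continuous_abs_continuous a b f f' :
  (forall t, is_derive t 1 f (f' t)) -> continuous f' -> abs_continuous a b f.
Proof.
move=> fd f'c; have [ba|ab] := ltP b a.
  apply: (@lipschitz_abs_continuous _ _ _ 0) => s t as_ st tb.
  by exfalso; lra.
have [c cab cmax] := @EVT_max R (fun t => `|f' t|) a b ab
  (continuous_subspaceT (fun t => continuous_comp (f'c t) (@norm_continuous _ R _))).
apply: (@lipschitz_abs_continuous _ _ _ `|f' c|) => s t as_ st tb.
have fc : {within `[s, t], continuous f}.
  apply: continuous_subspaceT => x; apply: differentiable_continuous.
  by apply/derivable1_diffP; have [] := fd x.
have [x xst ->] := @MVT_segment R f f' s t st (fun x _ => fd x) fc.
rewrite normrM [`|t - s|]ger0_norm ?subr_ge0 // ler_wpM2r ?subr_ge0 //.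
by apply: cmax; move: xst; rewrite !in_itv /= => /andP[? ?]; apply/andP; split; lra.
Qed.

Lemma almost_all_exists a b (Om : set R) (P : R -> Prop) : a < b ->
  `[a, b] `<=` Om -> almost_all Om P -> exists2 t, `[a, b]%classic t & P t.
Proof.
move=> ab abO [N [mN N0 PN]]; apply: contrapT => nP.
have : (lebesgue_measure (`[a, b] : set R) <= lebesgue_measure N)%E.
  apply: le_measure; rewrite ?inE //.
  move=> t tab; apply: PN => /= Pt; apply: nP; exists t => //.
  by apply: Pt; exact: abO.
by rewrite lebesgue_measure_itv /= lte_fin ab N0 -EFinD lee_fin leNgt subr_gt0 ab.
Qed.

End AbsolutelyContinuous.

(** * Smooth functions on a Lie group *)

Section LieGroupCalculus.
Variables (R : realType) (n : nat) (G : lieGroupType R n).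
Implicit Types (c : chart R n G) (f : G -> R) (x h : G).

Lemma atlas_is_chart c : atlas c -> is_chart c.
Proof. exact: atlas_chart. Qed.

Lemma chart_funK c x : atlas c -> chart_dom c x ->
  chart_inv c (chart_fun c x) = x.
Proof. by move=> /atlas_is_chart[_ _ cK _ _] xc; apply: cK; rewrite inE. Qed.

Lemma chart_inv_dom c (y : 'rV[R]_n) : atlas c -> chart_img c y ->
  chart_dom c (chart_inv c y) /\ chart_fun c (chart_inv c y) = y.
Proof. by move=> ac [x xc <-]; rewrite chart_funK. Qed.

Lemma chart_img_fun c x : chart_dom c x -> chart_img c (chart_fun c x).
Proof. by exists x. Qed.

Lemma chart_preimage_open c (O : set G) : atlas c -> open O ->
  open (chart_img c `&` chart_inv c @^-1` O).
Proof.
move=> ac oO; have [_ oimg _ _ ci] := atlas_is_chart ac.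
rewrite openE => y [yc Oy]; apply: filterI.
  exact: open_nbhs_nbhs.
by apply: (ci y yc); exact: open_nbhs_nbhs.
Qed.

Lemma smooth_fun_continuous f : smooth_fun f -> continuous f.
Proof.
move=> fs x; have [c ac xc] := atlas_cover x.
have [odom oimg cK cf ci] := atlas_is_chart ac.
have fc : {for x, continuous ((f \o chart_inv c) \o chart_fun c)}.
  apply: continuous_comp; first exact: cf.
  by apply: (fs c ac 0%N); exact: chart_img_fun.
rewrite /prop_for /continuous_at -[in X in _ --> X](chart_funK ac xc).
apply: cvg_trans fc; apply: near_eq_cvg; near=> y.
rewrite /= chart_funK //; near: y; exact: open_nbhs_nbhs.
Unshelve. all: by end_near. Qed.

(** Multiplication is known to be smooth only where the product stays in one chart. Around each pair
    such a chart is chosen, and continuity of the product makes the corresponding set of pairs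
    open. *)
Lemma smooth_fun_mul2 f c1 c2 : smooth_fun f -> atlas c1 -> atlas c2 ->
  smooth_on [set z : 'rV[R]_n * 'rV[R]_n | chart_img c1 z.1 /\ chart_img c2 z.2]
    (fun z => f (chart_inv c1 z.1 * chart_inv c2 z.2)%g).
Proof.
move=> fs ac1 ac2 k; apply: Ck_local => z0 [z01 z02].
have [c3 ac3 z03] := atlas_cover (chart_inv c1 z0.1 * chart_inv c2 z0.2)%g.
have [_ oimg1 _ _ ci1] := atlas_is_chart ac1.
have [_ oimg2 _ _ ci2] := atlas_is_chart ac2.
have [odom3 oimg3 _ _ _] := atlas_is_chart ac3.
pose O := [set z : 'rV[R]_n * 'rV[R]_n | [/\ chart_img c1 z.1, chart_img c2 z.2 &
  chart_dom c3 (chart_inv c1 z.1 * chart_inv c2 z.2)%g]].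
have oO : open O.
  rewrite openE => z [z1 z2 z3].
  have mc : (fun w : 'rV[R]_n * 'rV[R]_n => (chart_inv c1 w.1 * chart_inv c2 w.2)%g)
      @ z --> (chart_inv c1 z.1 * chart_inv c2 z.2)%g.
    apply: (@cvg_comp _ _ _ (fun w : 'rV[R]_n * 'rV[R]_n => (chart_inv c1 w.1, chart_inv c2 w.2))
      (fun w : G * G => (w.1 * w.2)%g)); last exact: (@lie_mul_continuous R n G (_, _)).
    apply: cvg_pair.
      by apply: (@continuous_comp _ _ _ fst (chart_inv c1)); [exact: cvg_fst|exact: ci1].
    by apply: (@continuous_comp _ _ _ snd (chart_inv c2)); [exact: cvg_snd|exact: ci2].
  near=> w; split.
  - near: w; apply: (@cvg_fst _ _ (nbhs z.1) (nbhs z.2)) => /=.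
    exact: open_nbhs_nbhs.
  - near: w; apply: (@cvg_snd _ _ (nbhs z.1) (nbhs z.2)) => /=.
    exact: open_nbhs_nbhs.
  - by near: w; apply: mc; exact: open_nbhs_nbhs.
exists O; first by split.
apply: (@Ck_congr _ _ _ _ _ ((f \o chart_inv c3) \o
  (fun z => chart_fun c3 (chart_inv c1 z.1 * chart_inv c2 z.2)%g))) => //.
  by move=> z [_ _ z3]; rewrite /= chart_funK.
apply: (@Ck_comp _ _ _ _ (chart_img c3)) => //.
- by move=> z [_ _ z3]; exact: chart_img_fun.
- exact: fs.
- exact: lie_mul_smooth.
Unshelve. all: by end_near. Qed.

(** With these injections, freezing one factor of a product is an affine change of variables, as
    [Ck_comp_affine] requires. *)
Definition inl_linear : 'rV[R]_n -> 'rV[R]_n * 'rV[R]_n := fun y => (y, 0).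
Definition inr_linear : 'rV[R]_n -> 'rV[R]_n * 'rV[R]_n := fun y => (0, y).

Lemma inl_linear_is_linear : linear inl_linear.
Proof. by move=> a u v; apply/pair_equal_spec; rewrite /= scaler0 addr0. Qed.

Lemma inr_linear_is_linear : linear inr_linear.
Proof. by move=> a u v; apply/pair_equal_spec; rewrite /= scaler0 addr0. Qed.

HB.instance Definition _ := GRing.isLinear.Build R 'rV[R]_n
  ('rV[R]_n * 'rV[R]_n)%type _ inl_linear inl_linear_is_linear.
HB.instance Definition _ := GRing.isLinear.Build R 'rV[R]_n
  ('rV[R]_n * 'rV[R]_n)%type _ inr_linear inr_linear_is_linear.

Lemma inl_linear_continuous : continuous inl_linear.
Proof.
move=> y; apply: differentiable_continuous.
by apply: (@differentiable_pair _ _ _ _ id (cst 0)) => //; exact: differentiable_cst.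
Qed.

Lemma inr_linear_continuous : continuous inr_linear.
Proof.
move=> y; apply: differentiable_continuous.
by apply: (@differentiable_pair _ _ _ _ (cst 0) id) => //; exact: differentiable_cst.
Qed.

Lemma smooth_fun_left_translate f h : smooth_fun f ->
  smooth_fun (fun x => f (h * x)%g).
Proof.
move=> fs c ac k; have [c1 ac1 hc1] := atlas_cover h.
have := @Ck_comp_affine R _ _ _ k _ (chart_img c) _ inr_linear
  (chart_fun c1 h, 0) inr_linear_continuous _ (smooth_fun_mul2 fs ac1 ac k).
rewrite /inr_linear /=; under eq_fun do rewrite addr0 add0r chart_funK //.
apply => y yc /=; rewrite addr0 add0r; split=> //; exact: chart_img_fun.
Qed.

Definition chart_derivative c (v : 'rV[R]_n) f : R :=
  'D_v (f \o chart_inv c) (chart_fun c 1%g).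

Lemma smooth_fun_differentiable f c x : smooth_fun f -> atlas c ->
  chart_dom c x -> differentiable (f \o chart_inv c) (chart_fun c x).
Proof.
by move=> fs ac xc; have [fd _] := fs c ac 1%N; apply: fd; exact: chart_img_fun.
Qed.

Lemma chart_derivative_derivation c v : atlas c -> chart_dom c 1%g ->
  derivation_at_one (chart_derivative c v).
Proof.
move=> ac c1; split=> [a f1 f2 s1 s2|f1 f2 s1 s2]; rewrite /chart_derivative.
- have d1 := diff_derivable (v := v) (smooth_fun_differentiable s1 ac c1).
  have d2 := diff_derivable (v := v) (smooth_fun_differentiable s2 ac c1).
  have d3 : derivable (a \*: (f1 \o chart_inv c)) (chart_fun c 1%g) v by exact: derivableZ.
  have := deriveD d3 d2; rewrite deriveZ //.
- have d1 := diff_derivable (v := v) (smooth_fun_differentiable s1 ac c1).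
  have d2 := diff_derivable (v := v) (smooth_fun_differentiable s2 ac c1).
  have := @deriveM _ _ (f1 \o chart_inv c) (f2 \o chart_inv c) _ v d1 d2.
  rewrite /= chart_funK // => ->; by rewrite /GRing.scale /= addrC mulrC.
Qed.

(** This is the derivative in the direction [(0, v)] of a smooth function of two variables,
    restricted to the slice where the second variable is 1. It costs one order of differentiability,
    whence [k.+1]. *)
Lemma smooth_chart_derivative_translates c v f : atlas c -> chart_dom c 1%g ->
  smooth_fun f -> smooth_fun (fun x => chart_derivative c v (fun y => f (x * y)%g)).
Proof.
move=> ac c1 fs c' ac' k.
have [_ /(_ (0, v)) H] := smooth_fun_mul2 fs ac' ac k.+1.
have [_ oimg _ _ _] := atlas_is_chart ac'.
have CkD := @Ck_comp_affine R _ _ _ k _ (chart_img c') _ inl_linear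
  (0, chart_fun c 1%g) inl_linear_continuous _ H.
have eP y : (0, chart_fun c 1%g) + inl_linear y = (y, chart_fun c 1%g).
  by apply/pair_equal_spec; rewrite /= add0r addr0.
apply: (Ck_congr oimg _ (CkD _)) => y yc; rewrite eP.
  rewrite /chart_derivative /derive /=.
  by under eq_fun do rewrite scaler0 add0r.
by split=> //; exact: chart_img_fun.
Qed.

(** * Extension by zero of functions supported in a chart *)

Section Extension.
Variables (c : chart R n G) (phi : 'rV[R]_n -> R) (y0 : 'rV[R]_n) (r : R).
Hypotheses (ac : atlas c) (r0 : 0 < r).
Hypothesis phi_smooth : smooth_on setT phi.
Hypothesis phi_support : forall y, phi y != 0 -> `|y0 - y| <= r.
Hypothesis ball_img : closed_ball y0 r `<=` chart_img c.

Definition chart_extend x : R :=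
  if `[< chart_dom c x >] then phi (chart_fun c x) else 0.

Definition chart_ball : set G := chart_inv c @` closed_ball y0 r.

Lemma chart_ball_compact : compact chart_ball.
Proof.
have [_ _ _ _ ci] := atlas_is_chart ac.
apply: continuous_compact.
  apply: continuous_in_subspaceT => y; rewrite inE => yb.
  by apply: ci; exact: ball_img.
apply: bounded_closed_compact; last exact: closed_ball_closed.
exists (`|y0| + r); split; first exact: num_real.
move=> M rM y; rewrite closed_ballE // /closed_ball_ /= => yr.
apply: le_trans (ltW rM); rewrite -[y](subrK y0) addrC -opprB.
by apply: le_trans (ler_normB _ _) _; rewrite lerD2l.
Qed.

Lemma chart_extend_support x : chart_extend x != 0 -> chart_ball x.
Proof.
rewrite /chart_extend; case: asboolP => [xc|]; last by rewrite eqxx.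
move=> /phi_support le_r; exists (chart_fun c x); last exact: chart_funK.
by rewrite closed_ballE.
Qed.

(** The support lies in a compact subset of the chart domain. As [G] is Hausdorff, this subset is
    closed, so the extension vanishes near every point outside the domain. *)
Lemma chart_extend_smooth : smooth_fun chart_extend.
Proof.
move=> c' ac' k; apply: Ck_local => y yc'.
have [odom oimg _ _ _] := atlas_is_chart ac.
have [_ oimg' _ _ _] := atlas_is_chart ac'.
have [xc|xc] := pselect (chart_dom c (chart_inv c' y)).
  exists (chart_img c' `&` chart_inv c' @^-1` (chart_dom c)); first by split.
  apply: (@Ck_congr _ _ _ _ _ (phi \o (chart_fun c \o chart_inv c'))).
  - exact: chart_preimage_open.
  - by move=> z [_ zc]; rewrite /chart_extend /= asboolT.
  apply: (@Ck_comp _ _ _ _ setT) => //; first exact: chart_preimage_open.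
  apply: Ck_sub (atlas_compatible _ _ ac' ac k) => z [zi zc].
  have [zd zK] := chart_inv_dom ac' zi.
  by exists (chart_inv c' z).
exists (chart_img c' `&` chart_inv c' @^-1` (~` chart_ball)).
  split=> //= -[z zb zE]; apply: xc; rewrite -zE.
  exact: (chart_inv_dom ac (ball_img zb)).1.
have ocb : open (~` chart_ball).
  apply: closed_openC; apply: compact_closed; first exact: lie_hausdorff.
  exact: chart_ball_compact.
apply: (@Ck_congr _ _ _ _ _ (fun=> 0)); last exact: Ck_cst.
  exact: chart_preimage_open.
move=> z [_ zb] /=; apply/esym/eqP; apply: contrapT => /negP.
by move=> /chart_extend_support.
Qed.

End Extension.

End LieGroupCalculus.

(** * Left-invariant fields and trajectories *)

Section LieAlgebraOfGroup.
Variables (R : realType) (n : nat) (G : lieGroupType R n) (g : lieAlgebra R).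
Variables (D : g -> (G -> R) -> R).
Hypotheses (g_lie : lie_algebra_of D) (g_dim : \dim {:g} = n).
Implicit Types (f : G -> R) (h : G) (X : g) (c : chart R n G).

Lemma lie_scale a u f : smooth_fun f -> D (a *: u) f = a * D u f.
Proof.
move=> fs; have D0 : D 0 f = 0.
  have := lie_linear g_lie 1 0 0 fs; rewrite scaler0 addr0 mul1r => /eqP.
  by rewrite eq_sym -subr_eq0 addrK => /eqP.
by rewrite -[a *: u]addr0 (lie_linear g_lie) // D0 addr0.
Qed.

Lemma lie_eq u v : (forall f, smooth_fun f -> D u f = D v f) -> u = v.
Proof.
move=> uv; apply/eqP; rewrite -subr_eq0; apply/eqP.
apply: (lie_inj g_lie) => f fs.
by rewrite addrC -scaleN1r (lie_linear g_lie) // uv // mulN1r addNr.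
Qed.

(** A coordinate centred at the image of 1 becomes globally smooth after multiplication by a bump.
    As it vanishes at the centre, the Leibniz rule leaves only the height [b] of the bump as a
    factor. *)
Lemma chart_coordinate_exists c : atlas c -> chart_dom c 1%g ->
  exists f : 'I_n -> G -> R, (forall j, smooth_fun (f j)) /\
  exists2 b, b != 0 & forall j v, chart_derivative c v (f j) = b * v 0 j.
Proof.
move=> ac c1; have [odom oimg _ _ _] := atlas_is_chart ac.
pose y0 := chart_fun c 1%g.
have y0c : nbhs y0 (chart_img c).
  by apply: open_nbhs_nbhs; split=> //; exact: chart_img_fun.
have /nbhs_closedballP[r bc] := y0c.
pose phi j (y : 'rV[R]_n) := smooth_bump y0 r%:num y * (y 0 j - y0 0 j).
have phiS j : smooth_on setT (phi j).
  by move=> k; apply: Ck_mul; [exact: openT|exact: Ck_smooth_bump|exact: Ck_shifted_coord].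
have phi0 j y : phi j y != 0 -> `|y0 - y| <= r%:num.
  by rewrite /phi mulf_eq0 negb_or => /andP[+ _]; exact: smooth_bump_support.
exists (fun j => chart_extend c (phi j)); split.
  by move=> j; exact: (chart_extend_smooth ac _ (phiS j) (phi0 j) bc).
exists (smooth_bump y0 r%:num y0); first by rewrite gt_eqF // smooth_bump_center_gt0.
move=> j v; rewrite /chart_derivative -/y0.
transitivity ('D_v (phi j) y0).
  apply: near_eq_derive; near=> y.
  have yc : chart_img c y by near: y.
  have [yd yK] := chart_inv_dom ac yc.
  by rewrite /chart_extend /= asboolT // yK.
have d1 : is_derive y0 v (smooth_bump y0 r%:num) ('D_v (smooth_bump y0 r%:num) y0).
  by apply/derivableP/diff_derivable; have [+ _] := Ck_smooth_bump 1 y0 r%:num; exact.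
have d2 : is_derive y0 v (@coord_linear R n j - cst (y0 0 j)) (v 0 j - 0).
  apply: is_deriveB.
  have cd : differentiable (@coord_linear R n j) y0 by exact: differentiable_coord.
  apply: DeriveDef; first exact: diff_derivable.
  by rewrite deriveE // (@diff_lin _ _ _ (@coord_linear R n j)) //; exact: coord_continuous.
have [_ e] := is_deriveM d1 d2.
transitivity ('D_v (smooth_bump y0 r%:num * (@coord_linear R n j - cst (y0 0 j))) y0); first by [].
by rewrite e fctE subrr scale0r addr0 subr0.
Unshelve. all: by end_near. Qed.

(* The coordinate derivations at 1 are linearly independent (test them on
   coordinates cut off by a bump function), so they span the n-dimensional g;
   this replaces Hadamard's lemma. *)
Lemma lie_chart_derivative c X : atlas c -> chart_dom c 1%g ->
  exists v, forall f, smooth_fun f -> D X f = chart_derivative c v f.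
Proof.
move=> ac c1.
(* Surjectivity of [D] gives an element of [g] for each coordinate derivation; injectivity of [D]
   makes the choice linear. *)
have [w wP] := choice (fun v => lie_surj g_lie (chart_derivative_derivation v ac c1)).
have w_lin : linear w.
  move=> a u v; apply: lie_eq => f fs.
  rewrite (lie_linear g_lie) // !wP // /chart_derivative.
  have fd := smooth_fun_differentiable fs ac c1.
  by rewrite !deriveE // linearP.
pose W : {linear 'rV[R]_n -> g} := HB.pack w (GRing.isLinear.Build _ _ _ _ w w_lin).
have kerW : lker (linfun W) == 0%VS.
  apply/lker0P => u v; rewrite !lfunE /= => uv.
  have [f [fs [b b0 fb]]] := chart_coordinate_exists ac c1.
  apply/rowP => j; apply: (mulfI b0).
  by rewrite -!fb -!wP // uv.
have imW : (limg (linfun W) = fullv)%VS.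
  apply/eqP; rewrite eqEdim subvf limg_dim_eq; last by rewrite (eqP kerW) capv0.
  by rewrite g_dim dimvf /dim /= mul1n.
have /memv_imgP[v _ ->] : X \in limg (linfun W) by rewrite imW memvf.
by exists v => f fs; rewrite lfunE /= wP.
Qed.

Lemma left_invariant_field_smooth X f : smooth_fun f ->
  smooth_fun (fun x => dl x (D X) f).
Proof.
move=> fs; have [c ac c1] := atlas_cover (1%g : G).
have [v vP] := lie_chart_derivative X ac c1.
rewrite (_ : (fun x => _) = fun x => chart_derivative c v (fun y => f (x * y)%g)).
  exact: smooth_chart_derivative_translates.
by apply: funext => x; rewrite /dl vP //; exact: smooth_fun_left_translate.
Qed.

Lemma left_mul_continuous (h : G) : continuous (fun y : G => (h * y)%g).
Proof.
move=> y; apply: (@cvg_comp _ _ _ (fun y => (h, y)) (fun z : G * G => (z.1 * z.2)%g));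
  last exact: (@lie_mul_continuous R n G (h, y)).
apply: (@cvg_pair _ _ _ (nbhs y) (nbhs h) (nbhs y) _ _ _ (cst h) id); last exact: cvg_id.
exact: cvg_cst.
Qed.

(** A derivation acts on global functions; its locality is inherited from the chart derivative that
    represents it. *)
Lemma left_invariant_field_local X f x : smooth_fun f ->
  (\forall y \near x, f y = 0) -> dl x (D X) f = 0.
Proof.
move=> fs f0; have [c ac c1] := atlas_cover (1%g : G).
have [v vP] := lie_chart_derivative X ac c1.
have [_ _ _ _ ci] := atlas_is_chart ac.
rewrite /dl vP; last exact: smooth_fun_left_translate.
rewrite /chart_derivative -[RHS](derive_cst (0 : R) (chart_fun c 1%g) v).
apply: near_eq_derive.
have cv : (x * chart_inv c y)%g @[y --> chart_fun c 1%g] --> x.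
  rewrite -[X in _ --> X]mulg1 -[X in (x * X)%g](chart_funK ac c1).
  apply: (@cvg_comp _ _ _ (chart_inv c) (fun y => (x * y)%g)); last exact: left_mul_continuous.
  by apply: ci; exact: chart_img_fun.
exact: (cv _ f0).
Qed.

Section Curves.
Variable q : {vspace g}.
Implicit Types (Om : set R) (u : R -> g) (x : R -> G).

(** Test functions composed with left translation by [(x t)^-1] bring the common velocity back to
    the identity, where [D] is injective. *)
Lemma control_unique Om x u1 u2 : trajectory D q Om x u1 ->
  trajectory D q Om x u2 -> almost_all Om (fun t => u1 t = u2 t).
Proof.
move=> [_ _ _ d1] [_ _ _ d2]; apply: (ae_imply (ae_and d1 d2)) => t [{}d1 {}d2] Omt.
apply: lie_eq => f fs.
have fs' := smooth_fun_left_translate (x t)^-1%g fs.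
have [_ e1] := d1 Omt _ fs'; have [_ e2] := d2 Omt _ fs'.
have dlE v : dl (x t) (D v) (fun y => f ((x t)^-1 * y)%g) = D v f.
  by rewrite /dl; congr (D v _); apply: funext => y; rewrite mulKg.
by move: e1; rewrite e2 !dlE.
Qed.

Lemma one_parameter_is_derive X gs h f t : one_parameter_subgroup D X gs ->
  smooth_fun f ->
  is_derive t (1 : R) (fun r => f (h * gs r)%g) (dl (h * gs t)%g (D X) f).
Proof.
move=> [gsD gs0] fs.
have := gs0 _ (smooth_fun_left_translate (h * gs t)%g fs).
rewrite -/(dl _ _ _) -(subrr t) => H.
have := is_derive1_comp (g := shift (- t)) H (is_derive_shift t 1 (- t)).
rewrite mulr1; apply: near_eq_is_derive; near=> r.
by rewrite /= -mulgA -gsD addrC subrK.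
Unshelve. all: by end_near. Qed.

Lemma one_parameter_trajectory X gs h Om : X \in q ->
  one_parameter_subgroup D X gs ->
  trajectory D q Om (fun t => h * gs t)%g (fun=> X).
Proof.
move=> Xq gsX; have gsD := one_parameter_is_derive h _ gsX.
split=> //.
- move=> f fs a b ab _.
  apply: (@derivable_continuous_abs_continuous _ a b _ (fun t => dl (h * gs t)%g (D X) f)).
    by move=> t; exact: gsD.
  move=> t; apply: differentiable_continuous; apply/derivable1_diffP.
  by have [] := gsD _ t (left_invariant_field_smooth X fs).
- by apply: aeW => t _ f fs; exact: gsD.
Qed.

Lemma ae_neq (b : R) : {ae (@lebesgue_measure R), forall t, t != b}.
Proof.
exists [set b]; split; [exact: measurable_set1|exact: lebesgue_measure_set1|].
by move=> t /= /negP; rewrite negbK => /eqP.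
Qed.

Lemma trajectory_lipschitz Om x X f C s t : trajectory D q Om x (fun=> X) ->
  smooth_fun f -> s <= t -> `[s, t] `<=` Om ->
  (forall r, s <= r <= t -> `|dl (x r) (D X) f| <= C) ->
  `|f (x t) - f (x s)| <= C * (t - s).
Proof.
move=> [xac _ _ xd] fs st stO fC.
apply: (@abs_continuous_lipschitz _ s t (f \o x)) => //; first exact: xac.
apply: (ae_imply xd) => r xr rst; exists (dl (x r) (D X) f).
  by apply: fC; move: rst; rewrite /= in_itv.
by apply: xr => //; exact: stO.
Qed.

(* Absolute continuity and the equation a.e. upgrade to the equation at every
   interior point, since the right-hand side is continuous along [x]. *)
Lemma trajectory_is_derive Om x X f t0 : trajectory D q Om x (fun=> X) ->
  smooth_fun f -> nbhs t0 Om ->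
  is_derive t0 (1 : R) (f \o x) (dl (x t0) (D X) f).
Proof.
move=> xT fs /nbhs_ballP[r /= r0 rO].
have ballO a b : t0 - r < a -> b < t0 + r -> `[a, b] `<=` Om.
  move=> ra br t; rewrite /= in_itv /= => /andP[a_t tb]; apply: rO.
  by rewrite /ball /= ltr_norml; apply/andP; split; lra.
set L := dl (x t0) (D X) f; pose gam t := dl (x t) (D X) f.
have fs' := left_invariant_field_smooth X fs.
(* The right-hand side is itself a smooth function evaluated along [x], hence absolutely continuous;
   its continuity at [t0] follows by testing with the single interval between [t0] and [t]. *)
have gam_near e : 0 < e -> exists2 r', 0 < r' <= r &
    forall t, `|t - t0| < r' -> `|gam t - L| <= e.
  move=> e0; have [xac _ _ _] := xT.
  have ab : t0 - r / 2 <= t0 + r / 2 by lra.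
  have sub : `[t0 - r / 2, t0 + r / 2] `<=` Om by apply: ballO; lra.
  have [d d0 dP] := xac _ fs' _ _ ab sub e e0.
  exists (Num.min d (r / 2)); first by rewrite lt_min d0 /= divr_gt0 // ge_min; apply/orP; right; lra.
  move=> t; rewrite lt_min => /andP[td tr].
  have := dP 1%N (fun=> Num.min t t0) (fun=> Num.max t t0).
  rewrite !big_ord1 => H; apply: ltW.
  have [tt0|t0t] := leP t t0.
    move: H td tr; rewrite /Num.min /Num.max; case: ltP => [_|?]; last first.
      have -> : t = t0 by lra.
      by move=> _ _ _; rewrite /gam -/L subrr normr0.
    move=> H td tr; rewrite distrC; apply: H; last first.
    - by move: td; rewrite ltr_norml => /andP[? ?]; lra.
    - by move=> i j; rewrite !ord1 eqxx.
    - by move=> _; move: tr; rewrite ltr_norml => /andP[? ?]; split; lra.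
  move: H td tr; rewrite /Num.min /Num.max; case: ltP => [?|_]; first by lra.
  move=> H td tr; apply: H; last first.
  - by move: td; rewrite ltr_norml => /andP[? ?]; lra.
  - by move=> i j; rewrite !ord1 eqxx.
  - by move=> _; move: tr; rewrite ltr_norml => /andP[? ?]; split; lra.
have slope e s t : 0 < e -> s <= t -> `[s, t] `<=` Om ->
    (forall r, s <= r <= t -> `|gam r - L| <= e) ->
    `|f (x t) - f (x s) - L * (t - s)| <= e * (t - s).
  move=> e0 st stO gL; have [xac _ _ xd] := xT.
  have := @abs_continuous_lipschitz _ s t (fun t => f (x t) + - L * t) e st.
  rewrite (_ : f (x t) + - L * t - (f (x s) + - L * s) = f (x t) - f (x s) - L * (t - s));
    last by lra.
  apply.
    apply: abs_continuousD; first exact: (xac f).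
    apply: (@lipschitz_abs_continuous _ _ _ _ `|L|) => a b _ ab _.
    by rewrite -mulrBr normrM normrN [`|b - a|]ger0_norm ?subr_ge0.
  apply: (ae_imply xd) => a xa ast; exists (gam a - L).
    by apply: gL; move: ast; rewrite /= in_itv.
  apply: (@is_deriveD _ _ _ (f \o x) (fun t => - L * t)); first by apply: xa => //; exact: stO.
  by have := @is_deriveZ R R R id (- L) a 1 1 (is_derive_id _ _); rewrite [_ *: 1]mulr1.
have cv : (fun h : R => h^-1 *: (((f \o x) \o shift t0) (h *: 1) - (f \o x) t0)) @ 0^' --> L.
  apply/cvgrPdist_le => e e0; have [r' /andP[r'0 r'r] gL] := gam_near e e0.
  near=> h.
  have h0 : h != 0 by near: h; exact: nbhs_dnbhs_neq.
  have hr : `|h| < r' by near: h; exact: dnbhs0_lt.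
  move: hr; rewrite ltr_norml => /andP[hr1 hr2].
  rewrite /= /shift /GRing.scale /= mulr1.
  have -> : L - h^-1 * (f (x (h + t0)) - f (x t0)) =
      - h^-1 * (f (x (h + t0)) - f (x t0) - L * h).
    by field.
  rewrite normrM normrN normfV ler_pdivrMl ?normr_gt0 // [_ * e]mulrC.
  move: h0; rewrite neq_lt => /orP[h0|h0].
    have := slope e (h + t0) t0 e0; rewrite (ltr0_norm h0).
    rewrite -normrN (_ : - (f (x t0) - f (x (h + t0)) - L * (t0 - (h + t0))) =
      f (x (h + t0)) - f (x t0) - L * h); last by lra.
    rewrite (_ : t0 - (h + t0) = - h); last by lra.
    apply; [by lra|by apply: ballO; lra|].
    by move=> a /andP[? ?]; apply: gL; rewrite ltr_norml; apply/andP; split; lra.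
  have := slope e t0 (h + t0) e0; rewrite (gtr0_norm h0) addrK; apply; [by lra|by apply: ballO; lra|].
  by move=> a /andP[? ?]; apply: gL; rewrite ltr_norml; apply/andP; split; lra.
by apply: DeriveDef; [apply/cvg_ex; exists L|exact: cvg_lim].
Unshelve. all: by end_near. Qed.

End Curves.
End LieAlgebraOfGroup.

(** * Extension of trajectories *)

Section TrajectoryExtension.
Variables (R : realType) (n : nat) (G : lieGroupType R n) (g : lieAlgebra R).
Variables (D : g -> (G -> R) -> R) (q : {vspace g}).
Hypotheses (g_lie : lie_algebra_of D) (g_dim : \dim {:g} = n).
Implicit Types (Om : set R) (x : R -> G) (f : G -> R) (X : g).

Lemma left_invariant_field_bounded X f (K : set G) : smooth_fun f -> compact K ->
  exists2 C, 0 < C & forall y, K y -> `|dl y (D X) f| <= C.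
Proof.
move=> fs cK; have [[y0 Ky0]|K0] := pselect (K !=set0); last first.
  by exists 1 => // y Ky; exfalso; apply: K0; exists y.
have fc := smooth_fun_continuous (left_invariant_field_smooth g_lie g_dim X fs).
have [||c _ cmax] := @compact_EVT_max G R (fun y => `|dl y (D X) f|) K _ cK.
- by exists y0.
- apply: continuous_subspaceT => y.
  exact: (continuous_comp (fc y) (@norm_continuous _ R _)).
exists (`|dl c (D X) f| + 1); first by rewrite ltr_wpDl.
move=> y Ky; apply: (@le_trans _ _ `|dl c (D X) f|); last by rewrite lerDl.
by apply: cmax; rewrite inE.
Qed.

(** This bounds from below the time needed to leave a compact set. Along an integral curve of [X]
    starting at 1, [beta] decreases at rate at most [C], so the curve is in [K] at all times before
    [beta 1 / C]. By left invariance the same time serves every starting point. *)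
Lemma escape_function X : exists (beta : G -> R) (K : set G) (C : R),
  [/\ smooth_fun beta, 0 < beta 1%g, compact K,
      forall y, beta y != 0 -> K y &
      0 < C /\ forall y, `|dl y (D X) beta| <= C].
Proof.
have [c ac c1] := atlas_cover (1%g : G).
have [odom oimg _ _ _] := atlas_is_chart ac.
pose y0 := chart_fun c 1%g.
have y0c : nbhs y0 (chart_img c).
  by apply: open_nbhs_nbhs; split=> //; exact: chart_img_fun.
have /nbhs_closedballP[r bc] := y0c.
have phiS : smooth_on setT (smooth_bump y0 r%:num) by move=> k; exact: Ck_smooth_bump.
have phi0 y : smooth_bump y0 r%:num y != 0 -> `|y0 - y| <= r%:num by exact: smooth_bump_support.
have r0 : 0 < r%:num by [].
pose beta := chart_extend c (smooth_bump y0 r%:num).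
have bS : smooth_fun beta by exact: (chart_extend_smooth ac r0 phiS phi0 bc).
pose K := chart_ball c y0 r%:num.
have cK : compact K by exact: (chart_ball_compact ac r0 bc).
have bK y : beta y != 0 -> K y by exact: (chart_extend_support ac r0 phi0).
have [C C0 CP] := left_invariant_field_bounded X bS cK.
exists beta, K, C; split=> //.
  by rewrite /beta /chart_extend asboolT // smooth_bump_center_gt0.
split=> // y; have [Ky|nKy] := pselect (K y); first exact: CP.
rewrite (left_invariant_field_local g_lie g_dim) ?normr0 //; first exact: ltW.
have oK : open (~` K).
  by apply: closed_openC; apply: compact_closed => //; exact: lie_hausdorff.
near=> z; apply/eqP; apply: contrapT => /negP /bK.
by near: z; exact: open_nbhs_nbhs.
Unshelve. all: by end_near. Qed.

Lemma trajectory_compact Om x X b : trajectory D q Om x (fun=> X) ->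
  is_interval Om -> (forall s, Om s -> s < b) -> sup Om = b -> Om !=set0 ->
  exists2 s, Om s & exists2 K, compact K & forall t, s <= t < b -> K (x t).
Proof.
move=> xT iO Ob supb O0; have [beta [K [C [bS b1 cK bK [C0 bC]]]]] := escape_function X.
have hO : has_sup Om by split=> //; exists b => s /Ob /ltW.
(* From [s], less time than [beta 1 / C] remains before [b], so the curve stays in the translate of
   [K] by [x s]. *)
have [s Os bs] := sup_adherent (divr_gt0 b1 C0) hO.
exists s => //; exists ((fun y => x s * y)%g @` K).
  by apply: continuous_compact => //; apply: continuous_subspaceT; exact: left_mul_continuous.
move=> t /andP[st tb]; exists ((x s)^-1 * x t)%g; last by rewrite mulVKg.
apply: bK; rewrite gt_eqF //.
have [t' Ot' tt'] : exists2 t', Om t' & t < t'.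
  have bt : 0 < b - t by rewrite subr_gt0.
  have [t' Ot'] := sup_adherent bt hO; rewrite supb => tt'.
  by exists t' => //; lra.
have stO : `[s, t] `<=` Om.
  move=> r; rewrite /= in_itv /= => /andP[sr rt]; apply: iO Os Ot' _ _.
  by rewrite sr (le_trans rt) // ltW.
have := @trajectory_lipschitz R n G g D q Om x X _ C _ _ xT
  (smooth_fun_left_translate (x s)^-1%g bS) st stO.
rewrite mulVg ler_norml => H.
have {H} /andP[H _] : - (C * (t - s)) <= beta ((x s)^-1 * x t)%g - beta 1%g <= C * (t - s).
  apply: H => r _; have := bC ((x s)^-1 * x r)%g; rewrite /dl.
  by rewrite (_ : (fun y => beta (_ * y)%g) = fun y => beta ((x s)^-1 * (x r * y))%g) //;
    apply: funext => y; rewrite mulgA.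
rewrite supb ltrBlDr in bs.
have Cts : C * (t - s) < beta 1%g by rewrite mulrC -ltr_pdivlMr //; lra.
by lra.
Qed.

(* A trajectory with constant control stays in a compact set near a finite
   right end b of its interval, hence has a cluster point there; the Lipschitz
   bounds turn the cluster point into the value at b. *)
Lemma trajectory_extend_endpoint Om x X b : trajectory D q Om x (fun=> X) ->
  is_interval Om -> (forall s, Om s -> s < b) -> sup Om = b -> Om !=set0 ->
  exists x' : R -> G, (forall t, Om t -> x' t = x t) /\
    trajectory D q (Om `|` [set b]) x' (fun=> X).
Proof.
move=> xT iO Ob supb O0.
have [s Os [K cK xK]] := trajectory_compact xT iO Ob supb O0.
have hO : has_sup Om by split=> //; exists b => r /Ob /ltW.
have sO t : s <= t -> t < b -> Om t.
  move=> st tb; have bt : 0 < b - t by rewrite subr_gt0.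
  have [t' Ot'] := sup_adherent bt hO; rewrite supb => tt'.
  by apply: iO Os Ot' _ _; rewrite st /=; lra.
have sb := Ob _ Os.
have Kf : \forall t \near b^'-, K (x t).
  near=> t; apply: xK; apply/andP; split.
    by near: t; exact: nbhs_left_ge.
  by near: t; exact: nbhs_left_lt.
have [p [Kp clp]] := cK (x @ b^'-) _ Kf.
pose x' t := if t < b then x t else p.
have x'x t : Om t -> x' t = x t by move=> /Ob tb; rewrite /x' tb.
exists x'; split=> //; have [xac _ xq xd] := xT; split.
- move=> f fs a1 b1 ab1 abO.
  have b1b : b1 <= b.
    have [/Ob/ltW //|->] : (Om `|` [set b]) b1 by apply: abO; rewrite /= in_itv /= ab1 lexx.
    exact: lexx.
  have [C C0 CP] := left_invariant_field_bounded X fs cK.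
  have lipO t t' : s <= t -> t <= t' -> t' < b -> `|f (x t') - f (x t)| <= C * (t' - t).
    move=> st tt' tb; apply: (trajectory_lipschitz xT fs tt').
      move=> r; rewrite /= in_itv /= => /andP[tr rt']; apply: sO; first exact: le_trans tr.
      exact: le_lt_trans tb.
    move=> r /andP[tr rt']; apply: CP; apply: xK.
    by rewrite (le_trans st tr) (le_lt_trans rt' tb).
  have lipb t : s <= t -> t < b -> `|f p - f (x t)| <= C * (b - t).
    move=> st tb; apply/ler_addgt0Pr => e e0.
    have [||z [[/= r rtb <-] fz]] := clp (x @` [set r | t <= r < b]) (f @^-1` (ball (f p) e)).
    + suff : \forall r \near b^'-, t <= r < b by apply: filterS => r rtb; exists r.
      near=> r; apply/andP; split.
        by near: r; exact: nbhs_left_ge.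
      by near: r; exact: nbhs_left_lt.
    + exact: (smooth_fun_continuous fs (nbhsx_ballx (f p) _ e0)).
    case/andP: rtb => tr rb.
    have l1 := lipO _ _ st tr rb.
    have l2 : C * (r - t) <= C * (b - t) by rewrite ler_wpM2l ?ltW //; lra.
    move: fz; rewrite /ball /= => /ltW fz.
    rewrite -[f p - f (x t)](subrKA (f (x r))).
    apply: le_trans (ler_normD _ _) _; rewrite addrC lerD //.
    exact: le_trans l1 l2.
  have acs a2 : s <= a2 -> abs_continuous a2 b1 (f \o x').
    move=> sa2; apply: (@lipschitz_abs_continuous _ _ _ _ C) => t t' at_ tt' tb /=.
    have st : s <= t by exact: le_trans at_.
    rewrite /x'; case: (ltP t' b) => t'b.
      by rewrite (le_lt_trans tt' t'b); exact: lipO.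
    have -> : t' = b by lra.
    case: (ltP t b) => tb2; first exact: lipb.
    have -> : t = b by lra.
    by rewrite !subrr normr0 mulr0.
  have [sa1|a1s] := leP s a1; first exact: acs.
  have [b1s|sb1] := leP b1 s.
    apply: (@abs_continuous_eq _ _ _ (f \o x)).
      by move=> t /andP[_ tb1]; rewrite /x' /= ifT //; lra.
    apply: xac => // t tab; have [//|/= tb] := abO _ tab.
    by move: tab; rewrite /= in_itv /=; lra.
  apply: (@abs_continuous_glue _ a1 s b1) => //; [exact: ltW|exact: ltW| |exact: acs].
  apply: (@abs_continuous_eq _ _ _ (f \o x)).
    by move=> t /andP[_ ts]; rewrite /x' /= ifT //; lra.
  apply: xac => //; first exact: ltW.
  move=> t; rewrite /= in_itv /= => /andP[a1t ts].
  have [//|/= tb] : (Om `|` [set b]) t by apply: abO; rewrite /= in_itv /= a1t; lra.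
  by exfalso; lra.
- by move=> l; exact: measurable_cst.
- by move=> t _; exact: xq Os.
- apply: (ae_imply (ae_and xd (ae_neq b))) => t [xt tb] [Ot|/= tb']; last by rewrite tb' eqxx in tb.
  move=> f fs; rewrite x'x //.
  have := xt Ot f fs; apply: near_eq_is_derive; near=> r.
  rewrite /= /x' ifT //; near: r; apply: lt_nbhsl; exact: Ob.
Unshelve. all: by end_near. Qed.

(** The field is left-invariant and the control constant, so the piece of the curve over [[a, b]],
    translated on the left by [k] to start at [x b] and delayed by [e], continues the curve. *)
Lemma trajectory_extend_closed Om x X a b : trajectory D q Om x (fun=> X) ->
  is_interval Om -> Om a -> Om b -> a < b -> (forall s, Om s -> s <= b) ->
  exists x' : R -> G, (forall t, Om t -> x' t = x t) /\
    trajectory D q (Om `|` `[b, b + (b - a)]) x' (fun=> X).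
Proof.
move=> xT iO Oa Ob ab Ole; pose e := b - a.
have eE : e = b - a by [].
have [xac _ xq xd] := xT.
pose k := (x b * (x a)^-1)%g.
pose x' t := if t <= b then x t else (k * x (t - e))%g.
have x'x t : Om t -> x' t = x t by move=> /Ole tb; rewrite /x' tb.
have x'k t : b <= t -> x' t = (k * x (t - e))%g.
  rewrite le_eqVlt => /orP[/eqP <-|bt]; last by rewrite /x' leNgt bt.
  by rewrite x'x // /k /e opprB addrC subrK mulgVK.
have e0 : 0 < e by rewrite subr_gt0.
have abO t : a <= t -> t <= b -> Om t by move=> at_ tb; apply: iO Oa Ob _ _; rewrite at_.
exists x'; split=> //; split.
- move=> f fs a1 b1 ab1 abO1.
  have OmP t : a1 <= t -> t <= b1 -> Om t \/ b <= t <= b + e.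
    move=> a1t tb1; have [|] : (Om `|` `[b, b + (b - a)]) t by apply: abO1; rewrite /= in_itv /= a1t.
      by left.
    by rewrite /= in_itv /=; right.
  have left_ac b2 : a1 <= b2 -> b2 <= b1 -> b2 <= b -> abs_continuous a1 b2 (f \o x').
    move=> ab2 b21 b2b; apply: (@abs_continuous_eq _ _ _ (f \o x)).
      by move=> t /andP[_ tb2]; rewrite /x' /= ifT //; exact: le_trans b2b.
    apply: xac => // t; rewrite /= in_itv /= => /andP[a1t tb2].
    have [//|/andP[bt _]] := OmP t a1t (le_trans tb2 b21).
    by have -> : t = b by lra.
  have right_ac a2 : b <= a2 -> a2 <= b1 -> a1 <= a2 -> abs_continuous a2 b1 (f \o x').
    move=> ba2 a2b1 a12; apply: (@abs_continuous_eq _ _ _ (fun t => ((fun y => f (k * y)%g) \o x) (t - e))).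
      by move=> t /andP[a2t _]; rewrite /= x'k //; exact: le_trans a2t.
    rewrite -[a2](subrK e) -[b1](subrK e); apply: abs_continuous_shift.
    apply: xac; [exact: smooth_fun_left_translate|by lra|].
    have b1e : b1 <= b + e.
      have [/Ole|/andP[] //] := OmP b1 ab1 (lexx _); lra.
    by move=> t; rewrite /= in_itv /= => /andP[? ?]; apply: abO; lra.
  have [b1b|bb1] := leP b1 b; first exact: left_ac.
  have [ba1|a1b] := leP b a1; first exact: right_ac.
  apply: (@abs_continuous_glue _ a1 b b1); [exact: ltW|exact: ltW| |].
    by apply: left_ac; rewrite ?lexx // ltW.
  by apply: right_ac; rewrite ?lexx // ltW.
- by move=> l; exact: measurable_cst.
- by move=> t _; exact: xq Oa.
- apply: (ae_imply (ae_and xd (ae_and (ae_neq b) (ae_neq (b + e))))) => t [xt [tb tbe]] Ot f fs.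
  have [t_b|b_t] := ltP t b.
    have {}Ot : Om t by case: Ot => // /=; rewrite in_itv /= leNgt t_b.
    rewrite x'x //; have := xt Ot f fs; apply: near_eq_is_derive; near=> r.
    by rewrite /= /x' ifT //; apply: ltW; near: r; exact: lt_nbhsl.
  have {}b_t : b < t by rewrite lt_neqAle eq_sym tb.
  have {}tbe : t < b + e.
    rewrite lt_neqAle tbe /=; case: Ot => [/Ole|]; first by lra.
    by rewrite /= in_itv /= => /andP[].
  have nO : nbhs (t - e) Om.
    near=> r; apply: abO; apply: ltW.
      by near: r; apply: lt_nbhsr; lra.
    by near: r; apply: lt_nbhsl; lra.
  (* At the earlier time [t - e] the equation is known at every interior point, so no exceptional
     null set has to be translated. *)
  have H := trajectory_is_derive g_lie g_dim xT (smooth_fun_left_translate k fs) nO.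
  have := is_derive1_comp (g := shift (- e)) H (is_derive_shift t 1 (- e)).
  rewrite mulr1 (x'k _ (ltW b_t)) /dl /=.
  rewrite (_ : (fun y => f (k * (x (t - e) * y))%g) = fun y => f (k * x (t - e) * y)%g);
    last by apply: funext => y; rewrite mulgA.
  apply: near_eq_is_derive; near=> r.
  by rewrite /= x'k //; apply: ltW; near: r; exact: lt_nbhsr.
Unshelve. all: by end_near. Qed.

Lemma trajectory_extend Om x X : trajectory D q Om x (fun=> X) ->
  is_interval Om -> (exists a b, [/\ a < b, Om a & Om b]) -> has_ubound Om ->
  exists (Om' : set R) (x' : R -> G), [/\ Om `<=` Om', Om' <> Om, is_interval Om',
    (forall t, Om t -> x' t = x t) & trajectory D q Om' x' (fun=> X)].
Proof.
move=> xT iO [a [b [ab Oa Ob]]] ubO; have O0 : Om !=set0 by exists a.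
have supO s : Om s -> s <= sup Om by move=> Os; exact: ub_le_sup.
have hO : has_sup Om by [].
have [Osup|nOsup] := pselect (Om (sup Om)).
  have asup : a < sup Om by exact: lt_le_trans ab (supO _ Ob).
  have [x' [x'x x'T]] := trajectory_extend_closed xT iO Oa Osup asup supO.
  exists (Om `|` `[sup Om, sup Om + (sup Om - a)]), x'; split=> //.
    move=> /seteqP[sub _]; have := supO (sup Om + (sup Om - a)).
    have H : Om (sup Om + (sup Om - a)).
      by apply: sub; right; rewrite /= in_itv /= lexx andbT; lra.
    by move=> /(_ H); lra.
  move=> u v Ou Ov z /andP[uz zv]; have [zs|sz] := leP z (sup Om).
    left; have [//|] := Ou => [Ou'|]; first by apply: iO Ou' Osup _ _; rewrite uz.
    rewrite /= in_itv /= => /andP[su _]; have -> // : z = sup Om by lra.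
  right; rewrite /= in_itv /= (ltW sz) /= (le_trans zv) //.
  by case: Ov => [/supO|]; [lra|rewrite /= in_itv /= => /andP[]].
have Olt s : Om s -> s < sup Om.
  move=> Os; rewrite lt_neqAle supO // andbT; apply/eqP => ss.
  by apply: nOsup; rewrite -ss.
have [x' [x'x x'T]] := trajectory_extend_endpoint xT iO Olt erefl O0.
exists (Om `|` [set sup Om]), x'; split=> //.
  by move=> /seteqP[sub _]; apply: nOsup; apply: sub; right.
have Oz u z : Om u -> u <= z -> z < sup Om -> Om z.
  move=> Ou uz zs; have sz : 0 < sup Om - z by rewrite subr_gt0.
  have [t Ot tz] := sup_adherent sz hO.
  by apply: iO Ou Ot _ _; rewrite uz /=; lra.
move=> u v Ou Ov z /andP[uz zv].
have vs : v <= sup Om by case: Ov => [/supO|->].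
have [zs|sz] := ltP z (sup Om); last by right => /=; lra.
left; case: Ou => [Ou|/= us]; first exact: Oz Ou uz zs.
by exfalso; lra.
Qed.

End TrajectoryExtension.

(** * Dominated functionals and adapted bases *)

Section Functionals.
Variables (R : realType) (g : vectType R).
Local Notation dual := 'Hom(g, R^o).
Implicit Types (V : {vspace g}) (p : dual) (x u v w : g).

Lemma dualZ p a v : p (a *: v) = a * p v.
Proof. exact: linearZ. Qed.

Lemma dualD p u v : p (u + v) = p u + p v.
Proof. exact: linearD. Qed.

Lemma dualN p v : p (- v) = - p v.
Proof. exact: linearN. Qed.

(** Some coordinate is nonzero on the component [y] of [x] transverse to [V]; composed with the
    projection along [V] and normalized, it is the required functional. *)
Lemma separating_functional V x : x \notin V ->
  exists p, (forall v, v \in V -> p v = 0) /\ p x = 1.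
Proof.
move=> xV; pose y := x - projv V x.
have y0 : y != 0.
  by apply: contraNneq xV => /eqP; rewrite subr_eq0 => /eqP ->; exact: memv_proj.
have [i ci] : exists i, coord (vbasis {:g}) i y != 0.
  apply: contrapT => nc; move/eqP: y0; apply.
  rewrite (coord_vbasis (memvf y)) big1 // => i _.
  have -> : coord (vbasis {:g}) i y = 0; last by rewrite scale0r.
  by apply/eqP; apply: contrapT => /negP ci; apply: nc; exists i.
pose p : dual := (linfun (coord (vbasis {:g}) i : g -> R^o) \o (\1 - projv V))%VF.
have pE v : p v = coord (vbasis {:g}) i (v - projv V v).
  by rewrite comp_lfunE lfunE add_lfunE opp_lfunE id_lfunE.
exists ((p x)^-1 *: p); split=> [v vV|].
  by rewrite scale_lfunE (pE v) projv_id // subrr linear0 scaler0.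
by rewrite scale_lfunE /GRing.scale /= mulVf // pE.
Qed.

End Functionals.

(** * Hahn-Banach extension below an asymmetric seminorm *)

Section HahnBanach.
Variables (R : realType) (g : lieAlgebra R).
Local Notation dual := 'Hom(g, R^o).
Implicit Types (V : {vspace g}) (p : dual) (x u v w : g).
Variables (q : {vspace g}) (F : g -> R).
Hypothesis F_seminorm : seminorm_on q F.

Lemma seminorm0 : F 0 = 0.
Proof.
have [_ _ FZ _] := F_seminorm.
by rewrite -(scale0r 0) FZ ?mem0v // mul0r.
Qed.

Lemma dominated_extension_step V p x : (V <= q)%VS -> x \in q ->
  (forall v, v \in V -> p v <= F v) ->
  exists p', (forall v, v \in V -> p' v = p v) /\
    forall v, v \in (V + <[x]>)%VS -> p' v <= F v.
Proof.
move=> Vq xq pF; have [F0 FD FZ _] := F_seminorm.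
have [xV|xV] := boolP (x \in V).
  exists p; split=> // v /memv_addP[w wV [z zx ->]]; apply: pF.
  by rewrite memvD //; move/vlineP: zx => [t ->]; exact: memvZ.
have [mu [muV mux]] := separating_functional xV.
(* The value at [x] must lie above all [p v - F (v - x)] and below all [F (w + x) - p w];
   subadditivity makes these compatible, and the supremum [al] of the lower bounds is taken. Both
   families are needed because [F] is not symmetric. *)
pose E := [set r : R | exists2 v, v \in V & r = p v - F (v - x)].
have Eub w : w \in V -> ubound E (F (w + x) - p w).
  move=> wV _ [v vV ->]; rewrite lerBrDr addrAC lerBlDr -linearD.
  apply: le_trans (pF _ (memvD vV wV)) _; rewrite addrC.
  have -> : w + v = (w + x) + (v - x) by rewrite addrACA subrr addr0.
  by apply: FD; [apply: memvD|apply: memvB] => //; exact: (subvP Vq).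
have E0 : E !=set0 by exists (p 0 - F (0 - x)), 0; rewrite ?mem0v.
have Eb : has_ubound E by exists (F (0 + x) - p 0); apply: Eub; exact: mem0v.
pose al := sup E.
have al1 w : w \in V -> al <= F (w + x) - p w by move=> wV; apply: ge_sup => //; exact: Eub.
have al2 w : w \in V -> p w - F (w - x) <= al by move=> wV; apply: ub_le_sup => //; exists w.
exists (p + (al - p x) *: mu); split=> [v vV|].
  by rewrite add_lfunE scale_lfunE muV // scaler0 addr0.
move=> _ /memv_addP[v vV [_ /vlineP[t ->] ->]].
have -> : (p + (al - p x) *: mu) (v + t *: x) = p v + t * al.
  rewrite add_lfunE scale_lfunE !dualD !dualZ muV // mux.
  by rewrite add0r mulr1 /GRing.scale /=; ring.
have vq := subvP Vq _ vV; have [t0|t0|->] := ltrgtP t 0.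
- have nt0 : 0 < - t by rewrite oppr_gt0.
  have := al2 _ (memvZ (- t)^-1 vV).
  have -> : (- t)^-1 *: v - x = (- t)^-1 *: (v + t *: x).
    by rewrite scalerDr scalerA invrN mulNr mulVf ?lt_eqF // scaleN1r.
  rewrite FZ ?invr_ge0 ?(ltW nt0) //; last by rewrite memvD ?memvZ.
  rewrite linearZ /= /GRing.scale /= -mulrBr ler_pdivrMl //; lra.
- have := al1 _ (memvZ t^-1 vV).
  have -> : t^-1 *: v + x = t^-1 *: (v + t *: x).
    by rewrite scalerDr scalerA mulVf ?gt_eqF // scale1r.
  rewrite FZ ?invr_ge0 ?(ltW t0) //; last by rewrite memvD ?memvZ.
  rewrite linearZ /= /GRing.scale /= -mulrBr ler_pdivlMl //; lra.
- by rewrite scale0r mul0r !addr0; exact: pF.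
Qed.

Lemma dominated_extension V p : (V <= q)%VS ->
  (forall v, v \in V -> p v <= F v) ->
  exists p', (forall v, v \in V -> p' v = p v) /\ forall v, v \in q -> p' v <= F v.
Proof.
have [k] := ubnP (\dim q - \dim V)%N; elim: k V p => // k IH V p kV Vq pF.
have [qV|] := boolP (q <= V)%VS.
  by exists p; split=> // v vq; apply: pF; exact: (subvP qV).
case/subvPn => x xq xV.
have [p1 [p1p p1F]] := dominated_extension_step Vq xq pF.
have Vxq : (V + <[x]> <= q)%VS by rewrite subv_add Vq -memvE.
have dimlt : (\dim V < \dim (V + <[x]>))%N.
  rewrite (ltn_leqif (dimv_leqif_sup (addvSl V <[x]>))).
  by apply: contra xV => /subvP; apply; rewrite memvE addvSr.
have [||p2 [p2p p2F]] := IH _ p1 _ Vxq.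
- by have := dimvS Vxq; move: kV dimlt; lia.
- exact: p1F.
exists p2; split=> // v vV; rewrite p2p ?p1p //.
exact: (subvP (addvSl V <[x]>)).
Qed.

(** The functional with value 1 at [u] and 0 on [V] is dominated by [F] on their span: a positive
    coefficient of [u] is scaled to 1, where the hypothesis applies, and a nonpositive one is
    trivial since [F] is nonnegative. *)
Lemma supporting_functional V u : (V <= q)%VS -> u \in q ->
  (forall w, w \in V -> 1 <= F (u + w)) ->
  exists p, [/\ forall w, w \in q -> p w <= F w, 1 <= p u &
    forall w, w \in V -> p w = 0].
Proof.
move=> Vq uq uF; have [F0 _ FZ _] := F_seminorm.
have uV : u \notin V.
  apply/negP => uV; have := uF (- u); rewrite memvN subrr seminorm0 => /(_ uV).
  by rewrite ler10.
have [mu [muV muu]] := separating_functional uV.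
have [||p [pmu pF]] := @dominated_extension (<[u]> + V)%VS mu.
- by rewrite subv_add Vq -memvE uq.
- move=> _ /memv_addP[_ /vlineP[t ->] [w wV ->]].
  rewrite linearD linearZ /= muu muV // addr0 /GRing.scale /= mulr1.
  have wq := subvP Vq _ wV.
  have [t0|t0] := leP t 0.
    by apply: le_trans t0 _; apply: F0; rewrite memvD ?memvZ.
  have -> : t *: u + w = t *: (u + t^-1 *: w).
    by rewrite scalerDr scalerA mulfV ?gt_eqF // scale1r.
  rewrite FZ; [|exact: ltW|by rewrite memvD ?memvZ].
  by rewrite ler_pMr // uF // memvZ.
exists p; split=> // [|w wV].
  by rewrite pmu ?muu // (subvP (addvSl _ _)) // memv_line.
by rewrite pmu ?muV // (subvP (addvSr _ _)).
Qed.

End HahnBanach.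

(** * Adapted bases and the alternating form induced by the bracket modulo [q] *)

Section Bracket.
Variables (R : realType) (g : lieAlgebra R).
Local Notation dual := 'Hom(g, R^o).
Implicit Types (x y z : g).

Lemma bracketDl x y z : bracket (x + y) z = bracket x z + bracket y z.
Proof. by have := bracket_linear 1 x y z; rewrite !scale1r. Qed.

Lemma bracket0l z : bracket 0 z = 0.
Proof. by apply: (addrI (bracket 0 z)); rewrite -bracketDl !addr0. Qed.

Lemma bracketZl a x z : bracket (a *: x) z = a *: bracket x z.
Proof. by have := bracket_linear a x 0 z; rewrite !addr0 bracket0l addr0. Qed.

Definition bracket_right y x : g := bracket x y.

Lemma bracket_right_is_linear y : linear (bracket_right y).
Proof. by move=> a u v; exact: bracket_linear. Qed.

HB.instance Definition _ y := GRing.isLinear.Build R g g _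
  (bracket_right y) (bracket_right_is_linear y).

(* The record lieAlgebra only asks for linearity in the first argument;
   antisymmetry comes from the identification with left-invariant fields. *)
Hypothesis bracketC : forall x y, bracket x y = - bracket y x.

Lemma bracketDr x y z : bracket z (x + y) = bracket z x + bracket z y.
Proof. by rewrite bracketC bracketDl opprD -!bracketC. Qed.

Lemma bracketZr a x z : bracket z (a *: x) = a *: bracket z x.
Proof. by rewrite bracketC bracketZl -scalerN -bracketC. Qed.

Lemma bracket0r z : bracket z 0 = 0.
Proof. by rewrite bracketC bracket0l oppr0. Qed.

(** Indices start at 0: for an adapted basis, the functional of index 3 is the coordinate along
    [[e1, e3]], with kernel [q]. *)
Definition frame_coord (e1 e2 e3 : g) (i : nat) : dual :=
  linfun (coord (frame e1 e2 e3) (inord i) : g -> R^o).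

Lemma frame_basis_decomposition e1 e2 e3 v (c := frame_coord e1 e2 e3) :
  basis_of {:g} (frame e1 e2 e3) ->
  v = c 0 v *: e1 + c 1 v *: e2 + c 2 v *: e3 + c 3 v *: bracket e1 e3.
Proof.
move=> fb; rewrite {1}(coord_basis fb (memvf v)).
under eq_bigr => i _ do rewrite -[i in coord _ i]inord_val.
by rewrite !big_ord_recl big_ord0 /= /bump /= !lfunE addr0 !addrA.
Qed.

Section Adapted.
Variables (q : {vspace g}) (e1 e2 e3 : g).
Hypothesis e_adapted : adapted_basis q e1 e2 e3.

Local Notation c := (frame_coord e1 e2 e3).
Local Notation e4 := (bracket e1 e3).

Lemma frame_decomposition v :
  v = c 0 v *: e1 + c 1 v *: e2 + c 2 v *: e3 + c 3 v *: e4.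
Proof.
by have [_ fb _ _] := e_adapted; exact: frame_basis_decomposition.
Qed.

Lemma frame_coord_frame i j : (i < 4)%N -> (j < 4)%N ->
  c i (frame e1 e2 e3)`_j = (j == i)%:R.
Proof.
move=> i4 j4; have [_ fb _ _] := e_adapted.
rewrite lfunE /= -[j in LHS](inordK j4) coord_free ?(basis_free fb) //.
by rewrite -val_eqE /= !inordK.
Qed.

Lemma frame_coord1 : [/\ c 0 e1 = 1, c 1 e1 = 0, c 2 e1 = 0 & c 3 e1 = 0].
Proof. by split; rewrite (@frame_coord_frame _ 0). Qed.
Lemma frame_coord2 : [/\ c 0 e2 = 0, c 1 e2 = 1, c 2 e2 = 0 & c 3 e2 = 0].
Proof. by split; rewrite (@frame_coord_frame _ 1). Qed.
Lemma frame_coord3 : [/\ c 0 e3 = 0, c 1 e3 = 0, c 2 e3 = 1 & c 3 e3 = 0].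
Proof. by split; rewrite (@frame_coord_frame _ 2). Qed.
Lemma frame_coord4 : [/\ c 0 e4 = 0, c 1 e4 = 0, c 2 e4 = 0 & c 3 e4 = 1].
Proof. by split; rewrite (@frame_coord_frame _ 3). Qed.

Lemma adapted_dim : \dim {:g} = 4%N.
Proof. by have [_ fb _ _] := e_adapted; exact: size_basis fb. Qed.

Lemma adapted_mem : [/\ e1 \in q, e2 \in q & e3 \in q].
Proof.
have [qb _ _ _] := e_adapted.
by split; apply: (basis_mem qb); rewrite !inE eqxx ?orbT.
Qed.

Lemma adapted_memP v : v \in q <-> c 3 v = 0.
Proof.
have [q1 q2 q3] := adapted_mem; split=> [|v3]; last first.
  by rewrite (frame_decomposition v) v3 scale0r addr0 !memvD ?memvZ.
have [qb _ _ _] := e_adapted; rewrite -(span_basis qb) !span_cons span_nil addv0.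
move=> /memv_addP[_ /vlineP[a1 ->] [_ /memv_addP[_ /vlineP[a2 ->] [_ /vlineP[a3 ->] ->]] ->]].
have [_ _ _ z1] := frame_coord1; have [_ _ _ z2] := frame_coord2.
have [_ _ _ z3] := frame_coord3.
by rewrite !dualD !dualZ z1 z2 z3 !mulr0 !addr0.
Qed.

Lemma adapted_decomposition v : v \in q ->
  v = c 0 v *: e1 + c 1 v *: e2 + c 2 v *: e3.
Proof.
by move=> /adapted_memP v3; rewrite {1}(frame_decomposition v) v3 scale0r addr0.
Qed.

Lemma adapted_e2_neq0 : e2 != 0.
Proof.
apply/eqP => e20; have [_ /eqP + _ _] := frame_coord2.
by rewrite e20 linear0 eq_sym oner_eq0.
Qed.

Lemma adapted_e2_e1 : bracket e2 e1 \in q.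
Proof.
have [_ _ C12 _] := e_adapted.
by rewrite bracketC memvN; apply/adapted_memP; rewrite lfunE.
Qed.

Lemma adapted_e2_e3 : bracket e2 e3 \in q.
Proof. by have [_ _ _ C23] := e_adapted; apply/adapted_memP; rewrite lfunE. Qed.

Lemma adapted_bracket_e2 v : v \in q -> bracket e2 v \in q.
Proof.
move=> /adapted_decomposition ->.
rewrite !bracketDr !bracketZr bracket_alternating scaler0 addr0.
by rewrite memvD ?memvZ ?adapted_e2_e1 ?adapted_e2_e3.
Qed.

(** The form [c 3 (bracket _ _)] on [q] pairs only [e1] with [e3], so its radical is the line of
    [e2]. Pairing [u] with [e1] and [e3] reads off, up to sign, its coordinates along [e3] and
    [e1]. *)
Lemma adapted_direction u : u \in q -> bracket u e1 \in q -> bracket u e3 \in q ->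
  u = c 1 u *: e2.
Proof.
move=> uq; rewrite {1 2}(adapted_decomposition uq) !bracketDl !bracketZl.
rewrite !bracket_alternating !scaler0 add0r addr0 (bracketC e3 e1) => H1 H3.
have [_ _ _ z4] := frame_coord4.
have u2 : c 2 u = 0.
  have /adapted_memP := H1; have /adapted_memP b := adapted_e2_e1.
  rewrite dualD !dualZ dualN b z4 mulr0 add0r mulrN1.
  by move/eqP; rewrite oppr_eq0 => /eqP.
have u0 : c 0 u = 0.
  have /adapted_memP := H3; have /adapted_memP b := adapted_e2_e3.
  by rewrite dualD !dualZ b z4 mulr0 addr0 mulr1.
by rewrite {1}(adapted_decomposition uq) u0 u2 !scale0r add0r addr0.
Qed.

(** Since [ad e2] preserves [q], the kernel of [c 3], its transpose acts on [c 3] by a scalar. Up to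
    the speed, this is the exponential rate of the abnormal covector. *)
Lemma adapted_abnormal_covector x :
  c 3 (bracket e2 x) = c 3 (bracket e2 e4) * c 3 x.
Proof.
have H v : v \in q -> c 3 (bracket e2 v) = 0.
  by move=> vq; apply/adapted_memP; exact: adapted_bracket_e2.
have [q1 q2 q3] := adapted_mem.
rewrite {1}(frame_decomposition x) !bracketDr !bracketZr !dualD !dualZ.
by rewrite (H _ q1) (H _ q2) (H _ q3) !mulr0 !add0r mulrC.
Qed.

(* By the Jacobi identity [e2, e4] lies in R e4 + [e2, q]. *)
Lemma adapted_constant_covector (p : dual) x :
  (forall v, v \in q -> p (bracket e2 v) = 0) -> p e4 = 0 ->
  p (bracket e2 x) = 0.
Proof.
move=> pq p4; have [q1 q2 q3] := adapted_mem.
suff pe4 : p (bracket e2 e4) = 0.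
  rewrite (frame_decomposition x) !bracketDr !bracketZr !dualD !dualZ.
  by rewrite pe4 !pq // !mulr0 !addr0.
have /eqP := bracket_jacobi e2 e1 e3.
rewrite -addrA addr_eq0 => /eqP ->; rewrite dualN dualD.
have b12 : p (bracket e1 e2) = 0 by rewrite bracketC dualN pq ?oppr0.
have e1K : p (bracket e1 (bracket e3 e2)) = 0.
  rewrite (bracketC e3 e2) -scaleN1r bracketZr dualZ.
  rewrite (adapted_decomposition adapted_e2_e3) !bracketDr !bracketZr !dualD !dualZ.
  by rewrite bracket_alternating linear0 b12 p4 !(mulr0, addr0).
have e3K : p (bracket e3 (bracket e2 e1)) = 0.
  rewrite (adapted_decomposition adapted_e2_e1) !bracketDr !bracketZr !dualD !dualZ.
  rewrite bracket_alternating linear0 (bracketC e3 e1) (bracketC e3 e2) !dualN pq //.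
  by rewrite p4 !mulr0 !oppr0 !mulr0 !addr0.
by rewrite e1K e3K addr0 oppr0.
Qed.

End Adapted.

(** As [q] generates [g] without being [g], it is not a subalgebra, so the bracket modulo [q], read
    by [lam], is a nonzero alternating form. Then [e1], [e3] form a hyperbolic pair and [e2] spans
    the radical. *)
Lemma adapted_exists (q : {vspace g}) : \dim {:g} = 4%N -> \dim q = 3%N ->
  generating q -> exists e1 e2 e3, adapted_basis q e1 e2 e3.
Proof.
move=> dg dq qgen.
have qf : q <> fullv by move=> qf; move: dq; rewrite qf dg.
have [y yq] : exists y, y \notin q.
  apply: contrapT => nq; apply: qf; apply/eqP; rewrite eqEsubv subvf /=.
  by apply/subvP => y _; apply: contrapT => /negP yq; apply: nq; exists y.
have [lam [lamq lamy]] := separating_functional yq.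
have lamP v : lam v = 0 -> v \in q.
  have fullE : (q + <[y]> = fullv)%VS.
    apply/eqP; rewrite eqEdim subvf dg.
    have := ltn_leqif (dimv_leqif_sup (addvSl q <[y]>)).
    rewrite dq => ->; apply: contra yq => /subvP; apply.
    by rewrite memvE addvSr.
  have /memv_addP[w wq [_ /vlineP[t ->] ->]] : v \in (q + <[y]>)%VS by rewrite fullE memvf.
  rewrite dualD dualZ lamq // lamy add0r mulr1 => ->.
  by rewrite scale0r addr0.
have [a [b [aq bq lab]]] : exists a b, [/\ a \in q, b \in q & lam (bracket a b) != 0].
  apply: contrapT => nab; apply: qf; apply: qgen => // a b aq bq; apply: lamP.
  by apply/eqP; apply: contrapT => /negP lab; apply: nab; exists a, b.
have [e1 [e3 [e1q e3q l13]]] : exists e1 e3, [/\ e1 \in q, e3 \in q & lam (bracket e1 e3) = 1].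
  exists a, ((lam (bracket a b))^-1 *: b); split=> //; first exact: memvZ.
  by rewrite bracketZr dualZ mulVf.
have l31 : lam (bracket e3 e1) = - 1 by rewrite bracketC dualN l13.
have [x xq xe] : exists2 x, x \in q & x \notin (<[e1]> + <[e3]>)%VS.
  apply/subvPn; apply/negP => /dimvS; rewrite dq leqNgt ltnS.
  have [le_dim _] := dimv_add_leqif <[e1]> <[e3]>.
  by rewrite (leq_trans le_dim) // !dim_vline; case: (_ != 0); case: (_ != 0).
(* Symplectic Gram-Schmidt: [x] is corrected to be orthogonal to [e1] and [e3] for the form. *)
pose e2 := x - lam (bracket x e3) *: e1 + lam (bracket x e1) *: e3.
have e2q : e2 \in q by rewrite memvD ?memvB ?memvZ.
have l23 : lam (bracket e2 e3) = 0.
  rewrite /e2 !bracketDl -scaleNr !bracketZl bracket_alternating scaler0 addr0.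
  by rewrite dualD dualZ l13 mulr1 subrr.
have l12 : lam (bracket e1 e2) = 0.
  rewrite bracketC dualN /e2 !bracketDl -scaleNr !bracketZl bracket_alternating scaler0 addr0.
  by rewrite dualD dualZ l31 mulrN1 subrr oppr0.
have e2n : e2 \notin (<[e1]> + <[e3]>)%VS.
  apply: contra xe => e2i.
  have -> : x = e2 + lam (bracket x e3) *: e1 - lam (bracket x e1) *: e3.
    by rewrite /e2 addrAC addrK subrK.
  have m1 : e1 \in (<[e1]> + <[e3]>)%VS by rewrite memvE addvSl.
  have m3 : e3 \in (<[e1]> + <[e3]>)%VS by rewrite memvE addvSr.
  by apply: memvB; [apply: memvD => //; exact: memvZ|exact: memvZ].
have e3n : e3 != 0.
  by apply/eqP => e30; move/eqP: l13; rewrite e30 bracket0r linear0 eq_sym oner_eq0.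
have fr3 : free [:: e2; e1; e3].
  rewrite !free_cons nil_free !span_cons span_nil !addv0 e2n /= andbT memv0 e3n andbT.
  apply/vlineP => -[t e1t]; move/eqP: l13.
  by rewrite e1t bracketZl bracket_alternating scaler0 linear0 eq_sym oner_eq0.
have spq : (<<[:: e2; e1; e3]>> <= q)%VS.
  by rewrite !span_cons span_nil addv0 !subv_add -!memvE e1q e2q e3q.
have qb : basis_of q [:: e1; e2; e3].
  have /permPl pe := perm_catCA [:: e1] [:: e2] [:: e3].
  by rewrite (perm_basis _ pe) basisEfree fr3 spq dq.
have fr4 : free [:: bracket e1 e3; e1; e2; e3].
  rewrite free_cons (basis_free qb) andbT; apply/negP.
  by rewrite (span_basis qb) => /lamq/eqP; rewrite l13 oner_eq0.
have fb : basis_of {:g} (frame e1 e2 e3).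
  have /permPl pe := perm_catC [:: e1; e2; e3] [:: bracket e1 e3].
  by rewrite (perm_basis _ pe) basisEfree fr4 subvf dg.
have c3 w : lam w = frame_coord e1 e2 e3 3 w.
  rewrite {1}(frame_basis_decomposition w fb) !dualD !dualZ.
  rewrite (lamq _ e1q) (lamq _ e2q) (lamq _ e3q) l13.
  by rewrite !mulr0 !add0r mulr1.
exists e1, e2, e3; split=> //.
- by have := c3 (bracket e1 e2); rewrite l12 lfunE => /esym.
- by have := c3 (bracket e2 e3); rewrite l23 lfunE => /esym.
Qed.

End Bracket.

(** * Extremals *)

Section Extremals.
Variables (R : realType) (G : lieGroupType R 4) (g : lieAlgebra R).
Variables (D : g -> (G -> R) -> R) (q : {vspace g}) (F : g -> R).
Hypotheses (g_lie : lie_algebra_of D) (F_seminorm : seminorm_on q F).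
Local Notation dual := 'Hom(g, R^o).

Lemma lie_bracketC x y : bracket x y = - bracket y x :> g.
Proof.
rewrite -scaleN1r; apply: (lie_eq g_lie) => f fs.
by rewrite (lie_scale g_lie) // !(lie_commutator g_lie) // mulN1r opprB.
Qed.

Local Notation bC := lie_bracketC.

Variables (e1 e2 e3 : g).
Hypothesis e_adapted : adapted_basis q e1 e2 e3.
Local Notation c := (frame_coord e1 e2 e3).
Local Notation e4 := (bracket e1 e3).

Lemma unit_ball_dominated (p : dual) M : (forall w, unit_ball q F w -> p w <= M) ->
  forall w, w \in q -> p w <= M * F w.
Proof.
move=> pM w wq; have [F0 _ FZ Fpos] := F_seminorm.
have [->|w0] := eqVneq w 0; first by rewrite linear0 (seminorm0 F_seminorm) mulr0.
have Fw := Fpos _ wq w0.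
have := pM ((F w)^-1 *: w); rewrite dualZ mulrC ler_pdivrMr // => -> //.
by split; [exact: memvZ|rewrite FZ ?invr_ge0 ?(ltW Fw) // mulVf ?gt_eqF].
Qed.

(** By homogeneity the bound 0 spreads from the ball, which need not be symmetric, to all of [q],
    where it applies to [w] and to [- w]. *)
Lemma unit_ball_zero (p : dual) : (forall w, unit_ball q F w -> p w <= 0) ->
  forall w, w \in q -> p w = 0.
Proof.
move=> p0 w wq; have H := unit_ball_dominated p0.
have := H (- w); rewrite memvN dualN mul0r => /(_ wq).
by have := H w wq; rewrite mul0r; lra.
Qed.

(** A signed coefficient: [F] may differ at [e2] and [- e2], so the two unit velocities along [e2]
    need not be opposite. *)
Definition speed s : R := s / F (s *: e2).

Section Direction.
Variable s : R.
Hypothesis s_sign : s = 1 \/ s = -1.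

Lemma sign_neq0 : s != 0.
Proof. by case: s_sign => ->; rewrite ?oppr_eq0 oner_eq0. Qed.

Lemma sign_sqr : s * s = 1.
Proof. by case: s_sign => ->; rewrite ?mulrNN mulr1. Qed.

Lemma speed_pos : 0 < F (s *: e2).
Proof.
have [_ q2 _] := adapted_mem e_adapted; have [_ _ _ Fpos] := F_seminorm.
by apply: Fpos; rewrite ?memvZ // scaler_eq0 negb_or sign_neq0 (adapted_e2_neq0 e_adapted).
Qed.

Lemma speed_neq0 : speed s != 0.
Proof. by rewrite mulf_neq0 ?sign_neq0 // invr_eq0 gt_eqF ?speed_pos. Qed.

Lemma speed_mem : speed s *: e2 \in q.
Proof. by have [_ q2 _] := adapted_mem e_adapted; exact: memvZ. Qed.

Lemma speed_unit : F (speed s *: e2) = 1.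
Proof.
have [_ q2 _] := adapted_mem e_adapted; have [_ _ FZ _] := F_seminorm.
rewrite /speed mulrC -scalerA FZ ?memvZ ?invr_ge0 ?(ltW speed_pos) //.
by rewrite mulVf // gt_eqF // speed_pos.
Qed.

End Direction.

Lemma unit_velocity_speed a : F (a *: e2) = 1 -> exists2 s, s = 1 \/ s = -1 &
  a = speed s.
Proof.
have [_ q2 _] := adapted_mem e_adapted; have [_ _ FZ _] := F_seminorm.
have E s : s = 1 \/ s = -1 -> 0 <= s * a -> F (a *: e2) = 1 -> a = speed s.
  move=> s1 sa; have -> : a *: e2 = (s * a) *: (s *: e2).
    by rewrite scalerA mulrAC sign_sqr // mul1r.
  rewrite FZ ?memvZ // => saF; rewrite /speed.
  have Fs := speed_pos s1.
  have -> : (F (s *: e2)) = (s * a)^-1.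
    by apply: (mulfI (x := s * a)); rewrite ?saF ?mulfV //; apply/eqP => sa0;
       move/eqP: saF; rewrite sa0 mul0r eq_sym oner_eq0.
  by rewrite invrK mulrA sign_sqr // mul1r.
move=> Fa; have [a0|a0] := leP 0 a.
  by exists 1; [left|apply: E => //; [left|rewrite mul1r]].
by exists (-1); [right|apply: E => //; [right|rewrite mulN1r oppr_ge0 ltW]].
Qed.

Lemma abnormal_covector_vanishes (Om : set R) u (psi : R -> dual) :
  pontryagin q F Om u psi 0 ->
  almost_all Om (fun t => forall w, w \in q -> psi t w = 0).
Proof.
move=> [_ _ _ pm]; apply: (ae_imply pm) => t H Ot.
by have [_ H'] := H Ot; exact: unit_ball_zero.
Qed.

(** Zeros occur arbitrarily close to [t0], and [f] is continuous. This lets the covector, known to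
    vanish on [q] only almost everywhere, be differentiated there. *)
Lemma abs_continuous_ae_eq0 (Om : set R) (f : R -> R) : is_interval Om ->
  locally_abs_continuous Om f -> almost_all Om (fun t => f t = 0) ->
  forall t0, nbhs t0 Om -> f t0 = 0.
Proof.
move=> iO fac f0 t0 /nbhs_ballP[r /= r0 rO].
apply/eqP; rewrite -normr_le0; apply/ler_addgt0Pr => e e0; rewrite add0r.
have sub : `[t0 - r / 2, t0 + r / 2] `<=` Om.
  by move=> t; rewrite /= in_itv /= => /andP[? ?]; apply: rO; rewrite /ball /= ltr_norml; apply/andP; split; lra.
have [|d d0 dP] := fac _ _ _ sub e e0; first by lra.
pose h := Num.min (d / 2) (r / 2).
have h0 : 0 < h by rewrite lt_min !divr_gt0.
have hd : h < d by rewrite gt_min; apply/orP; left; lra.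
have hr : h <= r / 2 by rewrite ge_min lexx orbT.
have t0h : t0 < t0 + h by lra.
have subh : `[t0, t0 + h] `<=` Om.
  by move=> t; rewrite /= in_itv /= => /andP[? ?]; apply: sub; rewrite /= in_itv /=; apply/andP; split; lra.
have [t tin ft] := almost_all_exists t0h subh f0.
move: tin; rewrite /= in_itv /= => /andP[t1 t2].
have := dP 1%N (fun=> t0) (fun=> t); rewrite !big_ord1 ft sub0r normrN => H.
apply: ltW; apply: H; first by move=> _; split; lra.
  by move=> i j; rewrite !ord1 eqxx.
lra.
Qed.

(** Only two points are discarded. On an unbounded side [sup] or [inf] is a conventional value, and
    discarding it is harmless. *)
Lemma ae_interior (Om : set R) : is_interval Om ->
  almost_all Om (fun t => nbhs t Om).
Proof.
move=> iO.
apply: (ae_imply (ae_and (ae_neq (sup Om)) (ae_neq (inf Om)))) => t [ts ti] Ot.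
have O0 : Om !=set0 by exists t.
have [b Ob tb] : exists2 b, Om b & t < b.
  apply: contrapT => nb; have H : ubound Om t.
    by move=> b Ob; rewrite leNgt; apply/negP => tb; apply: nb; exists b.
  move/eqP: ts; apply; apply/eqP; rewrite eq_le ge_sup // andbT.
  by apply: ub_le_sup => //; exists t.
have [a Oa ta] : exists2 a, Om a & a < t.
  apply: contrapT => na; have H : lbound Om t.
    by move=> a Oa; rewrite leNgt; apply/negP => ta; apply: na; exists a.
  move/eqP: ti; apply; apply/eqP; rewrite eq_le lb_le_inf //=.
  by apply: ge_inf => //; exists t.
near=> r; apply: iO Oa Ob _ _; apply/andP; split; apply: ltW; near: r.
  exact: lt_nbhsr.
exact: lt_nbhsl.
Unshelve. all: by end_near. Qed.

(** The covector is nonzero and vanishes on [q], so it is a nonzero multiple of [c 3].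
    Differentiating its zero values on [q] places [[u t, q]] in [q], hence [u t] in the radical; the
    normalization [F (u t) = 1] leaves two velocities. *)
Lemma abnormal_control (Om : set R) x u (psi : R -> dual) :
  extremal_with D q F Om x u psi 0 ->
  almost_all Om (fun t => exists2 s, s = 1 \/ s = -1 & u t = speed s *: e2).
Proof.
move=> [iO _ [xac um uq xd] Fu [_ pont]].
have pv := abnormal_covector_vanishes pont.
have [pn pac pd pm] := pont.
have [q1 q2 q3] := adapted_mem e_adapted.
have pvi t : nbhs t Om -> forall w, w \in q -> psi t w = 0.
  move=> tO w wq; apply: (@abs_continuous_ae_eq0 Om (fun t => psi t w)) tO => //.
  by apply: (ae_imply pv) => r H Or; exact: H.
apply: (ae_imply (ae_and (ae_interior iO) (ae_and pd Fu))) => t [ti [{}pd {}Fu]] Ot.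
have {}ti := ti Ot; have {}pd := pd Ot; have {}Fu := Fu Ot.
have br0 v : v \in q -> psi t (bracket (u t) v) = 0.
  move=> vq; have [_ <-] := pd v.
  rewrite -[RHS](derive_cst (0 : R) t (1 : R)); apply: near_eq_derive.
  have nn : \forall r \near t, nbhs r Om by apply: nbhs_interior.
  near=> r; apply: pvi => //; near: r; exact: nn.
have psi4 v : psi t v = psi t e4 * c 3 v.
  rewrite {1}(frame_decomposition e_adapted v) !dualD !dualZ.
  by rewrite (pvi t ti _ q1) (pvi t ti _ q2) (pvi t ti _ q3) !mulr0 !add0r mulrC.
have psi40 : psi t e4 != 0.
  apply: contra_notN (elimN eqP (pn t Ot)) => /eqP p40; apply/lfunP => v.
  by rewrite psi4 p40 mul0r lfunE.
have brq v : v \in q -> bracket (u t) v \in q.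
  move=> vq; apply/(adapted_memP e_adapted); apply: (mulfI psi40).
  by rewrite mulr0 -psi4 br0.
have ue := adapted_direction bC e_adapted (uq t Ot) (brq _ q1) (brq _ q3).
have Fc : F (c 1 (u t) *: e2) = 1 by rewrite -ue.
have [s s1 se] := unit_velocity_speed Fc.
by exists s => //; rewrite -se.
Unshelve. all: by end_near. Qed.

(** Along velocities parallel to [e2], the value [K] of the normal covector at [e2] has derivative
    zero almost everywhere, so it is constant. The positive maximum [M] equals [speed s * K], which
    fixes the sign [s] for almost all times. *)
Lemma normal_sign (Om : set R) x u0 u1 (psi0 psi1 : R -> dual) M :
  extremal_with D q F Om x u0 psi0 0 -> extremal_with D q F Om x u1 psi1 M ->
  0 < M -> exists2 s, s = 1 \/ s = -1 &
    almost_all Om (fun t => u1 t = speed s *: e2).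
Proof.
move=> ex0 ex1 M0; have cl := abnormal_control ex0.
have [_ _ T0 _ _] := ex0.
have [iO [a [b [ab Oa Ob]]] T1 _ [_ [_ pac pd pm]]] := ex1.
have cu := control_unique g_lie T1 T0.
have d0 : almost_all Om (fun t => is_derive t (1 : R) (fun r => psi1 r e2) 0).
  apply: (ae_imply (ae_and pd (ae_and cl cu))) => t [{}pd [{}cl {}cu]] Ot.
  have [s _ us] := cl Ot; have := pd Ot e2.
  by rewrite (cu Ot) us bracketZl bracket_alternating scaler0 linear0.
have constK t1 t2 : Om t1 -> Om t2 -> t1 <= t2 -> psi1 t2 e2 = psi1 t1 e2.
  move=> O1 O2 t12; have sub : `[t1, t2] `<=` Om.
    by move=> t; rewrite /= in_itv /= => tt; exact: iO O1 O2 _ tt.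
  have := @abs_continuous_lipschitz _ t1 t2 (fun r => psi1 r e2) 0 t12 (pac e2 _ _ t12 sub).
  rewrite mul0r normr_le0 subr_eq0 => H; apply/eqP; apply: H.
  apply: (ae_imply d0) => t dt tt; exists 0; first by rewrite normr0.
  by apply: dt; exact: sub.
pose K := psi1 a e2.
have KE t : Om t -> psi1 t e2 = K.
  by move=> Ot; have [at_|/ltW ta] := leP a t; [exact: constK|apply/esym; exact: constK].
pose s0 : R := if 0 < K then 1 else -1.
exists s0; first by rewrite /s0; case: ifP; [left|right].
apply: (ae_imply (ae_and pm (ae_and cl cu))) => t [{}pm [{}cl {}cu]] Ot.
have [s s1 us] := cl Ot; have [+ _] := pm Ot.
rewrite (cu Ot) us dualZ KE // => MK; congr (speed _ *: _).
have Fs := speed_pos s1; have Fi : 0 < (F (s *: e2))^-1 by rewrite invr_gt0.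
move: MK; rewrite /speed /s0; case: s1 => -> in Fi *.
  rewrite mul1r => MK; rewrite ifT //.
  by move: M0; rewrite -MK pmulr_rgt0.
rewrite mulN1r mulNr => MK; rewrite ifF //; apply/negbTE; rewrite -leNgt.
by move: M0; rewrite -MK oppr_gt0 pmulr_rlt0 // => /ltW.
Qed.

Lemma trajectory_constant (Om : set R) x u X : trajectory D q Om x u -> X \in q ->
  almost_all Om (fun t => u t = X) -> trajectory D q Om x (fun=> X).
Proof.
move=> [xac um uq xd] Xq uX; split=> //.
by apply: (ae_imply (ae_and xd uX)) => t [{}xd {}uX] Ot f fs; rewrite -(uX Ot); exact: xd.
Qed.

Lemma abnormal_extremal_with (Om : set R) x s : s = 1 \/ s = -1 ->
  is_interval Om -> (exists a b, [/\ a < b, Om a & Om b]) ->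
  trajectory D q Om x (fun=> speed s *: e2) ->
  exists psi, extremal_with D q F Om x (fun=> speed s *: e2) psi 0.
Proof.
move=> s1 iO ab xT; pose k := speed s * c 3 (bracket e2 e4).
pose psi t : dual := expR (k * t) *: c 3; exists psi.
have psiE t v : psi t v = expR (k * t) * c 3 v by rewrite scale_lfunE.
have dpsi v t : is_derive t (1 : R) (fun r => psi r v : R) (k * expR (k * t) * c 3 v).
  have dk : is_derive t (1 : R) (fun r => k * r) k.
    by have := @is_deriveZ R R R id k t 1 1 (is_derive_id _ _); rewrite [_ *: 1]mulr1.
  have := @is_deriveZ R R R _ (c 3 v) t 1 _ (is_derive1_comp (is_derive_expR (k * t)) dk).
  rewrite (_ : c 3 v *: _ = k * expR (k * t) * c 3 v); last by rewrite /GRing.scale /=; ring.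
  by apply: near_eq_is_derive; near=> r; rewrite psiE mulrC.
split=> //.
- by apply: aeW => t _; exact: speed_unit.
split=> //; split.
- move=> t _; apply/eqP => /(congr1 (fun p : dual => p e4)).
  have [_ _ _ z4] := frame_coord4 e_adapted.
  by rewrite psiE z4 mulr1 lfunE => /eqP; rewrite expR_eq0.
- move=> v a b _ _.
  apply: (@derivable_continuous_abs_continuous _ a b _
    (fun t => k * expR (k * t) * c 3 v) (dpsi v)) => t.
  have -> : (fun t => k * expR (k * t) * c 3 v) = (fun t => k * psi t v).
    by apply: funext => r; rewrite psiE mulrA.
  apply: cvgM; first exact: cvg_cst.
  apply: differentiable_continuous; apply/derivable1_diffP.
  by have [] := dpsi v t.
- apply: aeW => t _ v.
  rewrite (_ : psi t (bracket (speed s *: e2) v) = k * expR (k * t) * c 3 v).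
    exact: dpsi.
  rewrite psiE bracketZl dualZ (adapted_abnormal_covector bC e_adapted) /k; ring.
- apply: aeW => t _; split=> [|w [wq _]]; rewrite psiE.
    by rewrite ((adapted_memP e_adapted _).1 (speed_mem s)) mulr0.
  by rewrite ((adapted_memP e_adapted _).1 wq) mulr0.
Unshelve. all: by end_near. Qed.

(** Any trajectory with this constant control carries an abnormal covector on its whole interval, so
    prolonging the trajectory already contradicts maximality. *)
Lemma abnormal_extremal_unbounded (Om : set R) x s : s = 1 \/ s = -1 ->
  extremal D q F Om x -> is_interval Om -> (exists a b, [/\ a < b, Om a & Om b]) ->
  trajectory D q Om x (fun=> speed s *: e2) -> ~ has_ubound Om.
Proof.
move=> s1 [_ maxO] iO ab xT ub.
have g_dim := adapted_dim e_adapted.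
have [Om' [x' [OO' nO' iO' x'x x'T]]] := trajectory_extend g_lie g_dim xT iO ab ub.
apply: nO'; apply: (maxO Om' x') => //.
have [a [b [a_b Oa Ob]]] := ab.
have [|psi ex] := abnormal_extremal_with s1 iO' _ x'T.
  by exists a, b; split=> //; exact: OO'.
by exists (fun=> speed s *: e2), psi, 0.
Qed.

(* With w = [u, v'], the function psi(v') has derivative psi(u + w) - M, at most
   M (F(u + w) - 1). If F(u + w) < 1 then psi(v') tends to -oo, contradicting
   - psi(v') <= M F(- v'). *)
Lemma normal_necessary (Om : set R) x u psi M s : s = 1 \/ s = -1 ->
  extremal_with D q F Om x u psi M -> 0 < M -> ~ has_ubound Om ->
  almost_all Om (fun t => u t = speed s *: e2) ->
  forall v, v \in q -> 1 <= F (speed s *: e2 + bracket e2 v).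
Proof.
move=> s1 [iO [a [b [ab Oa Ob]]] xT _ [_ [_ pac pd pm]]] M0 ub us v vq.
have [F0 _ _ _] := F_seminorm.
rewrite leNgt; apply/negP => Flt; set w := bracket e2 v in Flt.
pose v' := (speed s)^-1 *: v; have v'q : v' \in q by exact: memvZ.
have sv' : bracket (speed s *: e2) v' = w.
  by rewrite /v' (bracketZr bC) bracketZl scalerA mulVf ?speed_neq0 // scale1r.
pose kap := M * (1 - F (speed s *: e2 + w)).
have kap0 : 0 < kap by rewrite mulr_gt0 // subr_gt0.
have wq : w \in q by exact: (adapted_bracket_e2 bC e_adapted).
have slope t : Om t -> a <= t -> psi t v' - psi a v' <= - kap * (t - a).
  move=> Ot at_; have sub : `[a, t] `<=` Om.
    by move=> r; rewrite /= in_itv /= => rr; exact: iO Oa Ot _ rr.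
  apply: (@abs_continuous_slope_le _ a t (fun r => psi r v')) => //; first exact: pac.
  apply: (ae_imply (ae_and pd (ae_and pm us))) => r [{}pd [{}pm {}us]] rr.
  have Or := sub _ rr; exists (psi r w); last first.
    by have := pd Or v'; rewrite (us Or) sv'.
  have [pu pM] := pm Or; rewrite (us Or) in pu.
  have := unit_ball_dominated pM (memvD (speed_mem s) wq).
  by rewrite dualD pu /kap; lra.
(* After time [T] the decrease of [psi v'] at rate [kap] takes it below its lower bound
   [- M * F (- v')]. *)
pose T := a + `|psi a v' + M * F (- v')| / kap.
have aT : a <= T by rewrite lerDl divr_ge0 // ltW.
have [b0 Ob0 Tb0] : exists2 b0, Om b0 & T < b0.
  apply: contrapT => nb; apply: ub; exists T => r Or; rewrite leNgt; apply/negP => Tr.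
  by apply: nb; exists r.
have [b1 Ob1 b01] : exists2 b1, Om b1 & b0 < b1.
  apply: contrapT => nb; apply: ub; exists b0 => r Or; rewrite leNgt; apply/negP => Tr.
  by apply: nb; exists r.
(* The lower bound holds almost everywhere only, so a time is chosen inside a nondegenerate interval
   beyond [T]. *)
have sub : `[b0, b1] `<=` Om.
  by move=> r; rewrite /= in_itv /= => rr; exact: iO Ob0 Ob1 _ rr.
have [t tin [_ pM]] := almost_all_exists b01 sub pm.
have Ot := sub _ tin; move: tin; rewrite /= in_itv /= => /andP[b0t _].
have nv'q : - v' \in q by rewrite memvN.
have := unit_ball_dominated pM nv'q; rewrite dualN => lower.
have := slope t Ot; have Tt : T < t by exact: lt_le_trans b0t.
have at_ : a <= t by rewrite (le_trans aT) // ltW.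
move=> /(_ at_) up.
have : `|psi a v' + M * F (- v')| < kap * (t - a).
  by rewrite -ltr_pdivrMl // [kap^-1 * _]mulrC; move: Tt; rewrite /T; lra.
have := ler_norm (psi a v' + M * F (- v')); lra.
Qed.

Lemma normal_sufficient (Om : set R) x s (p : dual) : s = 1 \/ s = -1 ->
  extremal D q F Om x -> is_interval Om -> (exists a b, [/\ a < b, Om a & Om b]) ->
  trajectory D q Om x (fun=> speed s *: e2) ->
  (forall w, w \in q -> p w <= F w) -> 1 <= p (speed s *: e2) ->
  (forall v, v \in q -> p (bracket e2 v) = 0) ->
  exists psi, normal_wrt D q F Om x psi.
Proof.
move=> s1 ex iO ab xT pF pu p0.
(* The correction changes nothing on [q] and makes the functional vanish at [e4]; it then
   annihilates [[e2, g]], so that a constant covector satisfies the adjoint equation. *)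
pose p' : dual := p - p e4 *: c 3.
have p'E v : p' v = p v - p e4 * c 3 v by rewrite add_lfunE opp_lfunE scale_lfunE.
have p'q v : v \in q -> p' v = p v.
  by move=> vq; rewrite p'E ((adapted_memP e_adapted _).1 vq) mulr0 subr0.
have p'u : p' (speed s *: e2) = 1.
  rewrite p'q ?speed_mem //; apply/eqP; rewrite eq_le pu andbT.
  by rewrite -(speed_unit s1); exact/pF/speed_mem.
have p'0 v : p' (bracket e2 v) = 0.
  apply: (adapted_constant_covector bC e_adapted) => [w wq|].
    by rewrite p'q ?p0 //; exact: (adapted_bracket_e2 bC e_adapted).
  by have [_ _ _ z4] := frame_coord4 e_adapted; rewrite p'E z4 mulr1 subrr.
exists (fun=> p'); split=> //; exists (fun=> speed s *: e2), 1; split=> //.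
split=> //; first by apply: aeW => t _; exact: speed_unit.
split=> //; split.
- move=> t _; apply/eqP => /(congr1 (fun p : dual => p (speed s *: e2))).
  by rewrite p'u lfunE => /eqP; rewrite oner_eq0.
- by move=> v a b _ _; apply: (@lipschitz_abs_continuous _ _ _ _ 0) => t r _ _ _; rewrite subrr normr0 mul0r.
- by apply: aeW => t _ v; rewrite bracketZl dualZ p'0 mulr0; exact: is_derive_cst.
- apply: aeW => t _; split=> // w [wq Fw]; rewrite p'q //.
  exact: le_trans (pF _ wq) Fw.
Qed.

Lemma adapted_span_bracket : exists L : {vspace g}, [/\ (L <= q)%VS,
  (forall v, v \in q -> bracket e2 v \in L) &
  forall w, w \in L -> exists2 v, v \in q & w = bracket e2 v].
Proof.
pose ad := linfun (bracket_right e2); exists (ad @: q)%VS; split.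
- apply/subvP => _ /memv_imgP[v vq ->]; rewrite lfunE /= /bracket_right bC memvN.
  exact: (adapted_bracket_e2 bC e_adapted).
- move=> v vq; rewrite bC memvN; have := memv_img ad vq.
  by rewrite lfunE.
- move=> _ /memv_imgP[v vq ->]; exists (- v); first by rewrite memvN.
  by rewrite lfunE /= /bracket_right -scaleN1r (bracketZr bC) scaleN1r -bC.
Qed.

Lemma nonstrongly_abnormal_iff (Om : set R) x s : s = 1 \/ s = -1 ->
  extremal D q F Om x -> is_interval Om -> (exists a b, [/\ a < b, Om a & Om b]) ->
  trajectory D q Om x (fun=> speed s *: e2) ->
  nonstrongly_abnormal D q F Om x <->
  exists p : dual, [/\ forall w, w \in q -> p w <= F w, 1 <= p (speed s *: e2) &
    forall v, v \in q -> p (bracket e2 v) = 0].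
Proof.
move=> s1 ex iO ab xT; have [psi0 ex0] := abnormal_extremal_with s1 iO ab xT.
split=> [[_ [psi [_ [u [M [M0 ex1]]]]]]|[p [pF pu p0]]]; last first.
  split; first by exists psi0; split=> //; exists (fun=> speed s *: e2).
  exact: (normal_sufficient s1 ex iO ab xT pF pu p0).
have ub := abnormal_extremal_unbounded s1 ex iO ab xT.
have [_ _ T1 _ _] := ex1; have us := control_unique g_lie T1 xT.
have H := normal_necessary s1 ex1 M0 ub us.
have [L [Lq adL LP]] := adapted_span_bracket.
have [|p [pF pu pL]] := supporting_functional F_seminorm Lq (speed_mem s).
  by move=> w /LP[v vq ->]; exact: H.
by exists p; split=> // v vq; apply: pL; exact: adL.
Qed.

End Extremals.

(** * The support function of the unit ball and dominated functionals *)

Section SupportFunction.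
Variables (R : realType) (g : lieAlgebra R) (q : {vspace g}) (F : g -> R).
Hypothesis F_seminorm : seminorm_on q F.
Variables (e1 e2 e3 : g).
Hypothesis e_adapted : adapted_basis q e1 e2 e3.
Local Notation dual := 'Hom(g, R^o).
Local Notation c := (frame_coord e1 e2 e3).
Variable s : R.
Hypothesis s_sign : s = 1 \/ s = -1.
Local Notation Fs := (F (s *: e2)).
Local Notation Fs_gt0 := (speed_pos F_seminorm e_adapted s_sign).

(* For an unbounded set of values the supremum would be 0, hence not 1 / F. *)
Lemma support_fun_eqP k :
  support_fun q F e1 e2 e3 k s 0 = 1 / Fs <->
  forall w, w \in q -> Fs * (k * c 0 w + s * c 1 w) <= F w.
Proof.
rewrite /support_fun; set E := [set r | _]; have F0 := Fs_gt0.
pose p : dual := Fs *: (k *: c 0 + s *: c 1).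
have pE w : p w = Fs * (k * c 0 w + s * c 1 w).
  by rewrite scale_lfunE add_lfunE !scale_lfunE.
have EP w : unit_ball q F w -> E (k * c 0 w + s * c 1 w).
  move=> [wq Fw]; exists (c 0 w), (c 1 w), (c 2 w); split; last by rewrite mul0r addr0.
  by rewrite -(adapted_decomposition e_adapted wq).
split=> [supE w wq|H].
  have hE : has_sup E.
    apply: contrapT => nE; have := sup_out nE; rewrite -/E in supE.
    by rewrite supE => /eqP; rewrite mul1r invr_eq0 gt_eqF.
  rewrite -pE -[F w]mul1r; apply: (unit_ball_dominated F_seminorm) wq => v vU.
  rewrite pE mulrC -ler_pdivlMr // -supE; apply: ub_le_sup; last exact: EP.
  by case: hE.
have ubE : ubound E (1 / Fs).
  move=> _ [u1 [u2 [u3 [[uq Fu] ->]]]]; rewrite ler_pdivlMr // mulrC.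
  have := H _ uq; rewrite !dualD !dualZ.
  have [z1 z2 _ _] := frame_coord1 e_adapted; have [z3 z4 _ _] := frame_coord2 e_adapted.
  have [z5 z6 _ _] := frame_coord3 e_adapted.
  rewrite z1 z2 z3 z4 z5 z6 !mulr0 !mulr1 !addr0 add0r mul0r addr0.
  by move=> /le_trans; apply.
(* The unit velocity along [s *: e2] attains this value for every [k], since its coordinate along
   [e1] is zero. *)
have Eu : E (1 / Fs).
  have uU : unit_ball q F (speed F e2 s *: e2).
    by split; [exact: (speed_mem _ e_adapted)|rewrite (speed_unit F_seminorm e_adapted s_sign)].
  have := EP _ uU; have [z3 z4 _ _] := frame_coord2 e_adapted.
  by rewrite !dualZ z3 z4 !mulr0 mulr1 add0r /speed mulrA sign_sqr.
apply/eqP; rewrite eq_le ge_sup //=; last by exists (1 / Fs).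
by apply: ub_le_sup => //; exists (1 / Fs).
Qed.

Let pk k : dual := Fs *: (k *: c 0 + s *: c 1).

Let pkE k w : pk k w = Fs * (k * c 0 w + s * c 1 w).
Proof. by rewrite scale_lfunE add_lfunE !scale_lfunE. Qed.

Let pk_speed k : 1 <= pk k (speed F e2 s *: e2).
Proof.
have [z3 z4 _ _] := frame_coord2 e_adapted; have F0 := Fs_gt0.
rewrite pkE !dualZ z3 z4 !mulr0 mulr1 add0r /speed.
rewrite (_ : s * (s / Fs) = Fs^-1); last by rewrite mulrA sign_sqr // mul1r.
by rewrite mulfV ?gt_eqF.
Qed.

(** Domination gives the opposite inequality at the unit velocity, where [F] is 1; hence [p] is 1
    there, which determines [p e2]. *)
Let dominated_e2 (p : dual) : (forall w, w \in q -> p w <= F w) ->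
  1 <= p (speed F e2 s *: e2) -> p e2 = Fs * s.
Proof.
move=> pF pu; have F0 := Fs_gt0.
have : p (speed F e2 s *: e2) = 1.
  apply/eqP; rewrite eq_le pu andbT -(speed_unit F_seminorm e_adapted s_sign).
  exact/pF/(speed_mem _ e_adapted).
rewrite dualZ /speed => e; apply: (mulfI (x := s / Fs)).
  by apply: mulf_neq0; [exact: sign_neq0|rewrite invr_eq0 gt_eqF].
by rewrite e mulrA divfK ?gt_eqF // sign_sqr.
Qed.

Lemma support_fun_line :
  (exists k, support_fun q F e1 e2 e3 k s 0 = 1 / Fs) <->
  exists p : dual, [/\ forall w, w \in q -> p w <= F w,
    1 <= p (speed F e2 s *: e2) & p e3 = 0].
Proof.
have F0 := Fs_gt0; split=> [[k /support_fun_eqP H]|[p [pF pu p3]]].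
  exists (pk k); split; [by move=> w wq; rewrite pkE; exact: H|exact: pk_speed|].
  have [z5 z6 _ _] := frame_coord3 e_adapted.
  by rewrite pkE z5 z6 !mulr0 addr0 mulr0.
(* On [q], the functional [p] divided by [Fs] has components [k], [s], 0, the middle one being
   forced by [dominated_e2]. *)
exists (p e1 / Fs); apply/support_fun_eqP => w wq; have := pF w wq.
rewrite {1}(adapted_decomposition e_adapted wq) !dualD !dualZ p3 (dominated_e2 pF pu).
rewrite mulr0 addr0 => /(le_trans _); apply.
rewrite mulrDr (mulrA Fs (p e1 / Fs)) (_ : Fs * (p e1 / Fs) = p e1).
  lra.
by rewrite mulrC divfK ?gt_eqF.
Qed.

Lemma support_fun_point :
  support_fun q F e1 e2 e3 0 s 0 = 1 / Fs <->
  exists p : dual, [/\ forall w, w \in q -> p w <= F w,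
    1 <= p (speed F e2 s *: e2) & p e1 = 0 /\ p e3 = 0].
Proof.
have F0 := Fs_gt0; split=> [/support_fun_eqP H|[p [pF pu [p1 p3]]]].
  exists (pk 0); split; [by move=> w wq; rewrite pkE; exact: H|exact: pk_speed|].
  have [z1 z2 _ _] := frame_coord1 e_adapted; have [z5 z6 _ _] := frame_coord3 e_adapted.
  by split; rewrite pkE ?z2 ?z6 mul0r !mulr0 addr0 mulr0.
apply/support_fun_eqP => w wq; have := pF w wq.
rewrite {1}(adapted_decomposition e_adapted wq) !dualD !dualZ p1 p3 (dominated_e2 pF pu).
by rewrite !mulr0 add0r addr0 mul0r add0r => /(le_trans _); apply; lra.
Qed.

End SupportFunction.

(** * Line ideals and the image of [q] under [ad e2] *)

Section Algebra.
Variables (R : realType) (g : lieAlgebra R).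
Hypothesis bC : forall x y : g, bracket x y = - bracket y x.
Local Notation dual := 'Hom(g, R^o).

Lemma collinear_nonzero (x y : g) : collinear x y -> x != 0 -> y != 0 ->
  exists2 t, t != 0 & x = t *: y.
Proof.
move=> /orP[/vlineP[t xt]|/vlineP[t yt]] x0 y0.
  by exists t => //; apply: contra_neq x0 => t0; rewrite xt t0 scale0r.
have t0 : t != 0 by apply: contra_neq y0 => t0; rewrite yt t0 scale0r.
by exists t^-1; rewrite ?invr_eq0 // yt scalerA mulVf // scale1r.
Qed.

Lemma basis4_decomposition (E1 E2 E3 E4 v : g) :
  basis_of {:g} [:: E1; E2; E3; E4] -> exists a1 a2 a3 a4,
    v = a1 *: E1 + a2 *: E2 + a3 *: E3 + a4 *: E4.
Proof.
move=> b; have := memvf v; rewrite -(span_basis b) !span_cons span_nil addv0.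
move=> /memv_addP[_ /vlineP[a1 ->] [_ /memv_addP[_ /vlineP[a2 ->]
  [_ /memv_addP[_ /vlineP[a3 ->] [_ /vlineP[a4 ->] ->]] ->]] ->]].
by exists a1, a2, a3, a4; rewrite !addrA.
Qed.

Lemma has_brackets_dim cs : @has_brackets R g cs -> \dim {:g} = 4%N.
Proof.
move=> [E1 [E2 [E3 [E4 [b _]]]]].
by rewrite -(span_basis b); apply/eqP; exact: basis_free b.
Qed.

Lemma basis4_neq0 (E1 E2 E3 E4 : g) : basis_of {:g} [:: E1; E2; E3; E4] ->
  [/\ E1 != 0, E2 != 0, E3 != 0 & E4 != 0].
Proof.
by move=> /basis_free fr; split; apply: (free_not0 fr); rewrite !inE eqxx ?orbT.
Qed.

Lemma central_basis (E1 E2 E3 E4 x : g) : basis_of {:g} [:: E1; E2; E3; E4] ->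
  bracket x E1 = 0 -> bracket x E2 = 0 -> bracket x E3 = 0 -> bracket x E4 = 0 ->
  central x.
Proof.
move=> b x1 x2 x3 x4 y; have [a1 [a2 [a3 [a4 ->]]]] := basis4_decomposition y b.
by rewrite !(bracketDr bC) !(bracketZr bC) x1 x2 x3 x4 !scaler0 !addr0.
Qed.

Lemma brackets_in (V : {vspace g}) (E1 E2 E3 E4 : g) :
  basis_of {:g} [:: E1; E2; E3; E4] ->
  bracket E1 E2 \in V -> bracket E1 E3 \in V -> bracket E1 E4 \in V ->
  bracket E2 E3 \in V -> bracket E2 E4 \in V -> bracket E3 E4 \in V ->
  forall x y, bracket x y \in V.
Proof.
move=> b m12 m13 m14 m23 m24 m34 x y.
have N u v : bracket u v \in V -> bracket v u \in V by move=> uv; rewrite bC memvN.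
have m u : bracket u u \in V by rewrite bracket_alternating mem0v.
have [a1 [a2 [a3 [a4 ->]]]] := basis4_decomposition x b.
have [b1 [b2 [b3 [b4 ->]]]] := basis4_decomposition y b.
rewrite !bracketDl !bracketZl !(bracketDr bC) !(bracketZr bC).
by do ![apply: memvD | apply: memvZ] => //; exact: N.
Qed.

Lemma proportional_basis (E1 E2 E3 E4 X Y : g) m1 m2 m3 m4 :
  basis_of {:g} [:: E1; E2; E3; E4] ->
  bracket E1 X = m1 *: X -> bracket E2 X = m2 *: X ->
  bracket E3 X = m3 *: X -> bracket E4 X = m4 *: X ->
  bracket E1 Y = m1 *: Y -> bracket E2 Y = m2 *: Y ->
  bracket E3 Y = m3 *: Y -> bracket E4 Y = m4 *: Y ->
  forall y, exists m, bracket y X = m *: X /\ bracket y Y = m *: Y.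
Proof.
move=> b x1 x2 x3 x4 y1 y2 y3 y4 y.
have [a1 [a2 [a3 [a4 ->]]]] := basis4_decomposition y b.
exists (a1 * m1 + a2 * m2 + a3 * m3 + a4 * m4).
rewrite !bracketDl !bracketZl x1 x2 x3 x4 y1 y2 y3 y4.
by rewrite !scalerA !scalerDl.
Qed.

Section Adapted.
Variables (q : {vspace g}) (e1 e2 e3 : g).
Hypothesis e_adapted : adapted_basis q e1 e2 e3.
Local Notation c := (frame_coord e1 e2 e3).
Local Notation e4 := (bracket e1 e3).

Lemma adapted_central z : z \in q -> z != 0 -> central z -> central e2.
Proof.
move=> zq z0 zc; have H v : bracket z v \in q by rewrite zc mem0v.
have ze := adapted_direction bC e_adapted zq (H _) (H _).
have cz : c 1 z != 0 by apply: contra_neq z0 => cz; rewrite ze cz scale0r.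
move=> y; have := zc y; rewrite ze bracketZl => /eqP.
by rewrite scaler_eq0 (negPf cz) => /eqP.
Qed.

Lemma plane_meets (x y : g) : free [:: x; y] ->
  exists a b, a *: x + b *: y \in q /\ a *: x + b *: y != 0.
Proof.
move=> fr; have y0 : y != 0 by apply: (free_not0 fr); rewrite !inE eqxx orbT.
have [cy|cy] := eqVneq (c 3 y) 0.
  exists 0, 1; rewrite scale1r scale0r add0r; split=> //.
  exact/(adapted_memP e_adapted).
exists (c 3 y), (- c 3 x); split.
  by apply/(adapted_memP e_adapted); rewrite dualD !dualZ mulNr mulrC subrr.
rewrite scaleNr subr_eq0; apply/eqP => e.
move: fr; rewrite free_cons span_seq1 => /andP[/vlineP + _]; apply.
by exists ((c 3 y)^-1 * c 3 x); rewrite -scalerA -e scalerA mulVf // scale1r.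
Qed.

(** All [ad y] act on the plane of [X] and [Y] by scalars, so each of its lines is an ideal; the
    hyperplane [q] contains one of them, and [y0] shows that it is not central. *)
Lemma plane_line_ideal (X Y y0 : g) m0 : free [:: X; Y] ->
  (forall y, exists m, bracket y X = m *: X /\ bracket y Y = m *: Y) ->
  m0 != 0 -> bracket y0 X = m0 *: X -> bracket y0 Y = m0 *: Y ->
  contains_noncentral_line_ideal q.
Proof.
move=> fr H m00 hX hY; have [a [b [zq z0]]] := plane_meets fr.
set z := a *: X + b *: Y in zq z0.
have bz y m : bracket y X = m *: X -> bracket y Y = m *: Y -> bracket y z = m *: z.
  move=> yX yY; rewrite /z (bracketDr bC) !(bracketZr bC) yX yY.
  by rewrite scalerDr !scalerA ![m * _]mulrC.
exists <[z]>%VS; split.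
- move=> _ y /vlineP[k ->]; have [m [yX yY]] := H y.
  by rewrite (bracketZr bC) (bz _ _ yX yY) !memvZ // memv_line.
- by rewrite dim_vline z0.
- by rewrite -memvE.
- move=> /(_ z (memv_line z) y0); rewrite bC (bz _ _ hX hY) => /eqP.
  by rewrite oppr_eq0 scaler_eq0 (negPf m00) (negPf z0).
Qed.

Lemma line_ideal_generator (I : {vspace g}) : \dim I = 1%N ->
  exists2 z, z != 0 & I = <[z]>%VS.
Proof.
move=> dI; have z0 : vpick I != 0 by rewrite vpick0 -dimv_eq0 dI.
exists (vpick I) => //; apply/eqP; rewrite eq_sym eqEdim -memvE memv_pick /=.
by rewrite dI dim_vline z0.
Qed.

(* A line ideal inside q spans the kernel of the form c_4([., .]) on q. *)
Lemma line_ideal_eigen : generating q -> contains_noncentral_line_ideal q ->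
  exists2 w, w \in q & bracket e2 w = e2.
Proof.
move=> qgen [I [iI dI Iq nc]]; have [z z0 Iz] := line_ideal_generator dI.
have zI : z \in I by rewrite Iz memv_line.
have zq : z \in q by exact: (subvP Iq).
have bzI y : bracket z y \in I by rewrite bC memvN; exact: iI.
have bz y : bracket z y \in q by apply: (subvP Iq); exact: bzI.
have ze := adapted_direction bC e_adapted zq (bz _) (bz _).
have cz : c 1 z != 0 by apply: contra_neq z0 => cz; rewrite ze cz scale0r.
have e2z : e2 = (c 1 z)^-1 *: z by rewrite {2}ze scalerA mulVf // scale1r.
(* Otherwise the centralizer of [e2], a subalgebra by the Jacobi identity, would contain the
   generating subspace [q], making [e2] and hence [I] central. *)
have [w wq e2w] : exists2 w, w \in q & bracket e2 w != 0.
  apply: contrapT => nw.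
  pose S := lker (linfun (bracket_right e2)).
  have SP v : (v \in S) = (bracket v e2 == 0) by rewrite memv_ker lfunE.
  have Sf : S = fullv.
    apply: qgen.
      apply/subvP => v vq; rewrite SP bC oppr_eq0.
      by apply: contrapT => /negP e2v; apply: nw; exists v.
    move=> x y; rewrite !SP => /eqP xe /eqP ye.
    have := bracket_jacobi x y e2.
    rewrite ye (bracket0r bC) add0r (bC e2 x) xe oppr0 (bracket0r bC) add0r.
    by rewrite bC => /eqP; rewrite oppr_eq0 => /eqP ->.
  apply: nc => x; rewrite Iz => /vlineP[k ->] y.
  have : y \in S by rewrite Sf memvf.
  rewrite SP bC oppr_eq0 e2z bracketZl scaler_eq0 invr_eq0 (negPf cz) /= => /eqP zy.
  by rewrite bracketZl zy scaler0.
have : bracket e2 w \in I by rewrite e2z bracketZl memvZ.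
rewrite Iz => /vlineP[k kz]; have k0 : k != 0.
  by apply: contra_neq e2w => k0; rewrite kz k0 scale0r.
exists ((k * c 1 z)^-1 *: w); first exact: memvZ.
by rewrite (bracketZr bC) kz invfM scalerA mulrAC mulVf // mul1r -e2z.
Qed.

(** The vector [e3] arises in [[e2, q]] from [[e2, e1] = - e3] in the first alternative and from
    [[e2, e3] = t *: e3] with [t] nonzero in the second. *)
Lemma bracket_e2_line t (p : dual) : bracket e2 e3 = t *: e3 ->
  e3 = bracket e1 e2 \/ bracket e1 e2 = 0 /\ t != 0 ->
  (forall v, v \in q -> p (bracket e2 v) = 0) <-> p e3 = 0.
Proof.
move=> b23 cases; have [q1 q2 q3] := adapted_mem e_adapted; split=> [H|p3 v vq].
  case: cases => [->|[_ t0]]; first by rewrite bC dualN H ?oppr0.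
  by apply: (mulfI t0); rewrite -dualZ -b23 H // mulr0.
have p21 : p (bracket e2 e1) = 0.
  rewrite bC dualN; case: cases => [<-|[-> _]]; first by rewrite p3 oppr0.
  by rewrite linear0 oppr0.
rewrite (adapted_decomposition e_adapted vq) !(bracketDr bC) !(bracketZr bC).
by rewrite b23 bracket_alternating !dualD !dualZ p21 p3 linear0 !mulr0 !addr0.
Qed.

Lemma bracket_e2_plane a t (p : dual) : bracket e2 e3 = a *: e1 + t *: e3 ->
  a != 0 -> e3 = bracket e1 e2 ->
  (forall v, v \in q -> p (bracket e2 v) = 0) <-> p e1 = 0 /\ p e3 = 0.
Proof.
move=> b23 a0 e3E; have [q1 q2 q3] := adapted_mem e_adapted; split=> [H|[p1 p3] v vq].
  have p3 : p e3 = 0 by rewrite e3E bC dualN H ?oppr0.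
  split=> //; apply: (mulfI a0); have := H _ q3.
  by rewrite b23 dualD !dualZ p3 !mulr0 addr0.
have p21 : p (bracket e2 e1) = 0 by rewrite bC dualN -e3E p3 oppr0.
rewrite (adapted_decomposition e_adapted vq) !(bracketDr bC) !(bracketZr bC).
rewrite b23 bracket_alternating !dualD !dualZ dualD !dualZ p21 p1 p3 linear0.
by rewrite !(mulr0, addr0).
Qed.

Lemma adapted_bracket_e2_e3 :
  bracket e2 e3 = structure_constant e1 e2 e3 2 3 1 *: e1 +
    structure_constant e1 e2 e3 2 3 2 *: e2 + c 2 (bracket e2 e3) *: e3.
Proof.
have [_ _ q3] := adapted_mem e_adapted.
rewrite {1}(adapted_decomposition e_adapted (adapted_bracket_e2 bC e_adapted q3)).
by rewrite !lfunE.
Qed.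

(** The derived algebra is the plane of [E1] and [E2]. It contains the independent brackets [e3] and
    [e4], so it is their span and meets [q] in the line of [e3]; and [[e2, e3]] lies in both. *)
Lemma g410_bracket : is_g410 g -> e3 = bracket e1 e2 ->
  exists t, bracket e2 e3 = t *: e3.
Proof.
move=> [E1 [E2 [E3 [E4 [b e]]]]] e3E; case: e => b12 b13 b14 b23 b24 b34.
pose V := (<[E1]> + <[E2]>)%VS.
have V1 : E1 \in V by rewrite memvE addvSl.
have V2 : E2 \in V by rewrite memvE addvSr.
have bV : forall x y, bracket x y \in V.
  by apply: (brackets_in b); rewrite ?b12 ?b13 ?b14 ?b23 ?b24 ?b34 ?memvN ?mem0v.
have [_ fb _ _] := e_adapted.
have fr : free [:: e3; e4].
  by have := basis_free fb; rewrite -[tval _]/([:: e1; e2] ++ [:: e3; e4]); exact: catr_free.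
have VE : V = (<[e3]> + <[e4]>)%VS.
  apply/eqP; rewrite eq_sym eqEdim subv_add -!memvE bV {1}e3E bV /=.
  have -> : (<[e3]> + <[e4]> = <<[:: e3; e4]>>)%VS by rewrite span_cons span_seq1.
  rewrite (eqP fr) /=; have [le_dim _] := dimv_add_leqif <[E1]> <[E2]>.
  by rewrite (leq_trans le_dim) // !dim_vline; case: (_ != 0); case: (_ != 0).
have := bV e2 e3; rewrite VE => /memv_addP[_ /vlineP[t ->] [_ /vlineP[k ->] h]].
exists t; have [_ _ q3] := adapted_mem e_adapted.
have /(adapted_memP e_adapted) := adapted_bracket_e2 bC e_adapted q3.
have [_ _ _ z3] := frame_coord3 e_adapted; have [_ _ _ z4] := frame_coord4 e_adapted.
by rewrite h dualD !dualZ z3 z4 mulr0 add0r mulr1 => ->; rewrite scale0r addr0.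
Qed.

End Adapted.

(** The centre of this algebra is zero: bracketing a central vector with the basis kills its four
    coordinates. *)
Lemma line_ideal_2g21 (q : {vspace g}) : is_2g21 g -> contains_line_ideal q ->
  contains_noncentral_line_ideal q.
Proof.
move=> [E1 [E2 [E3 [E4 [b e]]]]] [I [iI dI Iq]]; exists I; split=> // Ic.
case: e => b12 b13 b14 b23 b24 b34.
have [z z0 Iz] := line_ideal_generator dI.
have zc : central z by apply: Ic; rewrite Iz memv_line.
have [n1 _ n3 _] := basis4_neq0 b.
have [a1 [a2 [a3 [a4 zE]]]] := basis4_decomposition z b.
have := zc E1; have := zc E2; have := zc E3; have := zc E4.
rewrite zE !bracketDl !bracketZl (bC E2 E1) (bC E3 E1) (bC E4 E1) (bC E3 E2).
rewrite (bC E4 E2) (bC E4 E3) b12 b13 b14 b23 b24 b34 !bracket_alternating.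
rewrite !(oppr0, scaler0, addr0, add0r) !scalerN => /eqP + /eqP + /eqP + /eqP.
rewrite !oppr_eq0 !scaler_eq0 (negPf n1) (negPf n3) !orbF.
move=> /eqP h3 /eqP h4 /eqP h1 /eqP h2; move/eqP: z0; apply.
by rewrite zE h1 h2 h3 h4 !scale0r !addr0.
Qed.

End Algebra.

(** * The cases of the theorem *)

Section Classification.
Variables (R : realType) (G : lieGroupType R 4) (g : lieAlgebra R).
Variables (D : g -> (G -> R) -> R) (q : {vspace g}) (F : g -> R).
Hypotheses (g_lie : lie_algebra_of D) (F_seminorm : seminorm_on q F).
Local Notation dual := 'Hom(g, R^o).
Local Notation bC := (lie_bracketC g_lie).
Variables (e1 e2 e3 : g).
Hypothesis e_adapted : adapted_basis q e1 e2 e3.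
Local Notation c := (frame_coord e1 e2 e3).
Local Notation speed := (speed F e2).

Lemma speed1_gt0 : 0 < speed 1.
Proof.
have := speed_pos F_seminorm e_adapted (or_introl erefl : 1 = 1 \/ 1 = -1 :> R).
by rewrite -[speed 1]/(1 / F (1 *: e2)) mul1r invr_gt0.
Qed.

Lemma speedN1_lt0 : speed (- 1) < 0.
Proof.
have := speed_pos F_seminorm e_adapted (or_intror erefl : - 1 = 1 \/ - 1 = -1 :> R).
by rewrite -[speed (-1)]/(-1 / F (-1 *: e2)) mulN1r oppr_lt0 invr_gt0.
Qed.

Lemma frame_coord_speed s : c 1 (speed s *: e2) = speed s.
Proof. by have [_ z _ _] := frame_coord2 e_adapted; rewrite dualZ z mulr1. Qed.

(** If both signs occurred, there would be a zero strictly between. Around it the absolute value of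
    [f] stays below both [a] and [- b] on an interval of positive length, against the values taken
    almost everywhere. *)
Lemma continuous_sign (Om : set R) (f : R -> R) a b : is_interval Om ->
  0 < a -> b < 0 -> {within Om, continuous f} ->
  almost_all Om (fun t => f t = a \/ f t = b) ->
  almost_all Om (fun t => f t = a) \/ almost_all Om (fun t => f t = b).
Proof.
move=> iO a0 b0 fc fab.
have [[t1 O1 f1]|npos] := pselect (exists2 t, Om t & 0 < f t); last first.
  right; apply: (ae_imply fab) => t ft Ot; have [ft'|//] := ft Ot.
  by exfalso; apply: npos; exists t; rewrite ?ft'.
have [[t2 O2 f2]|nneg] := pselect (exists2 t, Om t & f t < 0); last first.
  left; apply: (ae_imply fab) => t ft Ot; have [//|ft'] := ft Ot.
  by exfalso; apply: nneg; exists t; rewrite ?ft'.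
exfalso; pose l := Num.min t1 t2; pose r := Num.max t1 t2.
have t12 : t1 != t2 by apply: contraTneq f1 => ->; rewrite -leNgt ltW.
have lr : l < r by rewrite /l /r; case: (ltgtP t1 t2) t12.
have subO : `[l, r] `<=` Om.
  have Ol : Om l by rewrite /l /Num.min; case: ifP.
  have Or : Om r by rewrite /r /Num.max; case: ifP.
  by move=> t; rewrite /= in_itv /= => tt; exact: iO Ol Or _ tt.
have fc' : {within `[l, r], continuous f} by exact: continuous_subspaceW fc.
have [t0 t0lr ft0] : exists2 t0, t0 \in `[l, r] & f t0 = 0.
  apply: IVT => //; first exact: ltW.
  rewrite /l /r; case: (ltgtP t1 t2) t12 => // _ _.
    by rewrite ge_min le_max (ltW f1) (ltW f2) orbT.
  by rewrite ge_min le_max (ltW f1) (ltW f2) orbT.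
have t0n : t0 != l /\ t0 != r.
  have h1 : t0 != t1 by apply: contraTneq f1 => <-; rewrite ft0 ltxx.
  have h2 : t0 != t2 by apply: contraTneq f2 => <-; rewrite ft0 ltxx.
  by rewrite /l /r /Num.min /Num.max; split; case: ifP.
have t0i : t0 \in `]l, r[.
  move: t0lr; rewrite !in_itv /= => /andP[lt0 t0r].
  by rewrite !lt_neqAle lt0 t0r t0n.2 eq_sym t0n.1.
have [fi _ _] := (continuous_within_itvP f lr).1 fc'.
pose m := Num.min a (- b); have m0 : 0 < m by rewrite lt_min a0 oppr_gt0.
have : \forall t \near t0, `|f t0 - f t| < m.
  by have /cvgrPdist_lt /(_ _ m0) := fi t0 t0i.
have : \forall t \near t0, `]l, r[%classic t by exact: near_in_itvoo.
move=> H1 H2; have [h /= h0 hP] := (nbhs_ballP _ _).1 (filterI H1 H2).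
have sub : `[t0, t0 + h / 2] `<=` ball t0 h.
  by move=> t; rewrite /= in_itv /= => /andP[? ?]; rewrite /ball /= ltr_norml; apply/andP; split; lra.
have sub' : `[t0, t0 + h / 2] `<=` Om.
  move=> t /sub /hP[]; rewrite /= in_itv /= => /andP[? ?] _; apply: subO.
  by rewrite /= in_itv /= !ltW.
have [|t tt ft] := almost_all_exists _ sub' fab; first by lra.
have [_] := hP _ (sub _ tt); rewrite ft0 sub0r normrN lt_min => /andP[fa fb].
case: ft => e; move: fa fb; rewrite e.
  by rewrite gtr0_norm // ltxx.
by rewrite ltr0_norm // ltxx.
Qed.

Lemma abnormal_continuous_velocity (Om : set R) x :
  abnormal D q F Om x -> continuous_velocity D q Om x ->
  exists2 s, s = 1 \/ s = -1 & trajectory D q Om x (fun=> speed s *: e2).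
Proof.
move=> [psi [ex [u0 ex0]]] [u uT uc].
have cl := abnormal_control g_lie F_seminorm e_adapted ex0.
have [iO _ T0 _ _] := ex0; have cu := control_unique g_lie uT T0.
have ucl : almost_all Om (fun t => exists2 s, s = 1 \/ s = -1 & u t = speed s *: e2).
  by apply: (ae_imply (ae_and cl cu)) => t [{}cl {}cu] Ot; rewrite (cu Ot); exact: cl.
have fab : almost_all Om (fun t => c 1 (u t) = speed 1 \/ c 1 (u t) = speed (- 1)).
  apply: (ae_imply ucl) => t ut Ot; have [s [] -> ->] := ut Ot; rewrite frame_coord_speed.
    by left.
  by right.
have const s : s = 1 \/ s = -1 -> almost_all Om (fun t => c 1 (u t) = speed s) ->
    trajectory D q Om x (fun=> speed s *: e2).
  move=> s1 us; apply: (trajectory_constant uT); first exact: (speed_mem _ e_adapted).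
  apply: (ae_imply (ae_and ucl us)) => t [{}ucl {}us] Ot.
  have [s' _ us'] := ucl Ot; have := us Ot.
  by rewrite us' frame_coord_speed => ->.
have [us|us] := continuous_sign iO speed1_gt0 speedN1_lt0 (uc (c 1)) fab.
  by exists 1; [left|apply: const => //; left].
by exists (-1); [right|apply: const => //; right].
Qed.

Lemma central_nonstrongly (Om : set R) x : central e2 ->
  abnormal D q F Om x -> continuous_velocity D q Om x ->
  nonstrongly_abnormal D q F Om x.
Proof.
move=> e2c ab cv; have [s s1 xT] := abnormal_continuous_velocity ab cv.
have [psi [ex [u [iO pts _ _ _]]]] := ab.
apply/(nonstrongly_abnormal_iff g_lie F_seminorm e_adapted s1 ex iO pts xT).
have sq := speed_mem F e_adapted s.
(* With [e2] central, [[e2, q]] is zero, and any functional supporting the unit ball at the velocity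
   will do. *)
have [|p [pF pu _]] := supporting_functional F_seminorm (sub0v q) sq.
  move=> w; rewrite memv0 => /eqP ->.
  by rewrite addr0 (speed_unit F_seminorm e_adapted s1).
by exists p; split=> // v _; rewrite e2c linear0.
Qed.

(** An extremal that switches velocities is covered too: assumed normal, it has one velocity by
    [normal_sign], and then its interval is unbounded above. *)
Lemma eigen_strongly w : w \in q -> bracket e2 w = e2 ->
  forall (Om : set R) x, abnormal D q F Om x -> strongly_abnormal D q F Om x.
Proof.
move=> wq e2w Om x ab; split=> // -[[psi0 [ex [u0 ex0]]] [psi1 [_ [u1 [M [M0 ex1]]]]]].
have [s s1 us] := normal_sign g_lie F_seminorm e_adapted ex0 ex1 M0.
have sq := speed_mem F e_adapted s.
have [iO pts T1 _ _] := ex1; have xT := trajectory_constant T1 sq us.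
have ub := abnormal_extremal_unbounded g_lie F_seminorm e_adapted s1 ex iO pts xT.
(* For this multiple of [w] the bracket with [e2] cancels the velocity, and the criterion would read
   [1 <= F 0]. *)
have := normal_necessary g_lie F_seminorm e_adapted s1 ex1 M0 ub us (memvZ (- speed s) wq).
rewrite (bracketZr bC) e2w scaleNr subrr (seminorm0 F_seminorm).
by rewrite ler10.
Qed.

Section OneParameter.
Variables (s : R) (gs : R -> G) (h : G).
Hypothesis s_sign : s = 1 \/ s = -1.
Hypothesis gs_exp : one_parameter_subgroup D ((s / F (s *: e2)) *: e2) gs.

Lemma one_parameter_shift_trajectory :
  trajectory D q setT (fun t => h * gs t)%g (fun=> speed s *: e2).
Proof.
apply: (one_parameter_trajectory g_lie (adapted_dim e_adapted)) => //.
exact: (speed_mem _ e_adapted).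
Qed.

Lemma setT_interval : is_interval [set: R]. Proof. by []. Qed.

Lemma setT_points : exists a b : R, [/\ a < b, [set: R] a & [set: R] b].
Proof. by exists 0, 1; split. Qed.

Lemma one_parameter_extremal : extremal D q F setT (fun t => h * gs t)%g.
Proof.
have [psi ex] := abnormal_extremal_with g_lie F_seminorm e_adapted s_sign
  setT_interval setT_points one_parameter_shift_trajectory.
split; first by exists (fun=> speed s *: e2), psi, 0.
by move=> Om' x' TO _ _; apply/seteqP; split.
Qed.

Lemma one_parameter_abnormal : abnormal D q F setT (fun t => h * gs t)%g.
Proof.
have [psi ex] := abnormal_extremal_with g_lie F_seminorm e_adapted s_sign
  setT_interval setT_points one_parameter_shift_trajectory.
by exists psi; split; [exact: one_parameter_extremal|exists (fun=> speed s *: e2)].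
Qed.

Lemma one_parameter_iff :
  nonstrongly_abnormal D q F setT (fun t => h * gs t)%g <->
  exists p : dual, [/\ forall w, w \in q -> p w <= F w, 1 <= p (speed s *: e2) &
    forall v, v \in q -> p (bracket e2 v) = 0].
Proof.
exact: (nonstrongly_abnormal_iff g_lie F_seminorm e_adapted s_sign
  one_parameter_extremal setT_interval setT_points one_parameter_shift_trajectory).
Qed.

Lemma line_case t : bracket e2 e3 = t *: e3 ->
  e3 = bracket e1 e2 \/ bracket e1 e2 = 0 /\ t != 0 ->
  nonstrongly_abnormal D q F setT (fun t => h * gs t)%g <->
  exists k : R, support_fun q F e1 e2 e3 k s 0 = 1 / F (s *: e2).
Proof.
move=> b23 cases.
have H p := bracket_e2_line bC e_adapted p b23 cases.
apply: (iff_trans one_parameter_iff); apply: iff_sym.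
apply: (iff_trans (support_fun_line F_seminorm e_adapted s_sign)).
by split=> -[p [pF pu p3]]; exists p; split=> //; apply/H.
Qed.

Lemma plane_case a t : bracket e2 e3 = a *: e1 + t *: e3 -> a != 0 ->
  e3 = bracket e1 e2 ->
  nonstrongly_abnormal D q F setT (fun t => h * gs t)%g <->
  support_fun q F e1 e2 e3 0 s 0 = 1 / F (s *: e2).
Proof.
move=> b23 a0 e3E.
have H p := bracket_e2_plane bC e_adapted p b23 a0 e3E.
apply: (iff_trans one_parameter_iff); apply: iff_sym.
apply: (iff_trans (support_fun_point F_seminorm e_adapted s_sign)).
by split=> -[p [pF pu p3]]; exists p; split=> //; apply/H.
Qed.

End OneParameter.
End Classification.

(** * Central vectors and scalar actions in the listed algebras *)

Section Centers.
Variables (R : realType) (g : lieAlgebra R).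
Hypothesis bC : forall x y : g, bracket x y = - bracket y x.

Lemma central_has_brackets cs (i : 'I_4) : @has_brackets R g cs ->
  (forall E1 E2 E3 E4 : g, [:: bracket E1 E2; bracket E1 E3; bracket E1 E4;
        bracket E2 E3; bracket E2 E4; bracket E3 E4] = cs E1 E2 E3 E4 ->
    forall y, y \in [:: E1; E2; E3; E4] -> bracket (nth 0 [:: E1; E2; E3; E4] i) y = 0) ->
  exists2 z : g, z != 0 & central z.
Proof.
move=> [E1 [E2 [E3 [E4 [b e]]]]] H; have {}H := H _ _ _ _ e.
exists (nth 0 [:: E1; E2; E3; E4] i).
  apply: (free_not0 (basis_free b)); apply: mem_nth; exact: ltn_ord.
by apply: (central_basis bC b); apply: H; rewrite !inE eqxx ?orbT.
Qed.

Ltac bracket_table :=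
  rewrite ?bracket_alternating;
  repeat match goal with
  | H : bracket ?x ?y = _ |- context [bracket ?x ?y] => rewrite H
  | H : bracket ?x ?y = _ |- context [bracket ?y ?x] => rewrite (bC y x) H
  end;
  rewrite ?subrr ?mulr0 ?scale0r ?scaleN1r ?scaleNr ?scale1r ?opprK ?oppr0.

Lemma nontrivial_center :
  [\/ is_g32_g1 g,
      (exists a : R, [/\ 0 <= a, a != 1 & is_g34_g1 g a]),
      is_g43 g |
      [\/ (exists a : R, 0 <= a /\ is_g35_g1 g a),
          is_g41 g, is_g36_g1 g |
          [\/ is_g37_g1 g, is_g48 g (-1) | is_g49 g 0]]] ->
  exists2 z : g, z != 0 & central z.
Proof.
case=> [H|[a [_ _ H]]|H|[[a [_ H]]|H|H|[H|H|H]]].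
(* The index, counted from 0, selects the central basis vector: [E4] in the sums with a
   one-dimensional summand, [E2] for [is_g43], and [E1] for [is_g41], [is_g48] at -1 and [is_g49] at
   0. *)
- by apply: (central_has_brackets (i := inord 3) H); rewrite inordK // => E1 E2 E3 E4 [? ? ? ? ? ?] y;
    rewrite !inE => /or4P[] /eqP -> /=; bracket_table.
- by apply: (central_has_brackets (i := inord 3) H); rewrite inordK // => E1 E2 E3 E4 [? ? ? ? ? ?] y;
    rewrite !inE => /or4P[] /eqP -> /=; bracket_table.
- by apply: (central_has_brackets (i := inord 1) H); rewrite inordK // => E1 E2 E3 E4 [? ? ? ? ? ?] y;
    rewrite !inE => /or4P[] /eqP -> /=; bracket_table.
- by apply: (central_has_brackets (i := inord 3) H); rewrite inordK // => E1 E2 E3 E4 [? ? ? ? ? ?] y;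
    rewrite !inE => /or4P[] /eqP -> /=; bracket_table.
- by apply: (central_has_brackets (i := inord 0) H); rewrite inordK // => E1 E2 E3 E4 [? ? ? ? ? ?] y;
    rewrite !inE => /or4P[] /eqP -> /=; bracket_table.
- by apply: (central_has_brackets (i := inord 3) H); rewrite inordK // => E1 E2 E3 E4 [? ? ? ? ? ?] y;
    rewrite !inE => /or4P[] /eqP -> /=; bracket_table.
- by apply: (central_has_brackets (i := inord 3) H); rewrite inordK // => E1 E2 E3 E4 [? ? ? ? ? ?] y;
    rewrite !inE => /or4P[] /eqP -> /=; bracket_table.
- by apply: (central_has_brackets (i := inord 0) H); rewrite inordK // => E1 E2 E3 E4 [? ? ? ? ? ?] y;
    rewrite !inE => /or4P[] /eqP -> /=; bracket_table.
- by apply: (central_has_brackets (i := inord 0) H); rewrite inordK // => E1 E2 E3 E4 [? ? ? ? ? ?] y;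
    rewrite !inE => /or4P[] /eqP -> /=; bracket_table.
Qed.

Lemma free_pair (E1 E2 E3 E4 : g) : basis_of {:g} [:: E1; E2; E3; E4] ->
  [/\ free [:: E1; E2], free [:: E2; E3], free [:: E3; E4] & free [:: E1; E4]].
Proof.
move=> /basis_free fr; have fr34 := catr_free (X := [:: E1; E2]) (Y := [:: E3; E4]) fr.
have fr12 := catl_free (X := [:: E1; E2]) (Y := [:: E3; E4]) fr.
have fr234 := catr_free (X := [:: E1]) (Y := [:: E2; E3; E4]) fr.
have fr23 := catl_free (X := [:: E2; E3]) (Y := [:: E4]) fr234.
split=> //; have /permPl pe := perm_catC [:: E1] [:: E2; E3; E4].
have := fr; rewrite (perm_free pe) => fr2341.
rewrite (perm_free (Y := [:: E4; E1])); last by have /permPl := perm_catC [:: E1] [:: E4].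
exact: (catr_free (X := [:: E2; E3]) (Y := [:: E4; E1]) fr2341).
Qed.

Variables (q : {vspace g}) (e1 e2 e3 : g).
Hypothesis e_adapted : adapted_basis q e1 e2 e3.

Lemma central_plane (X Y : g) : free [:: X; Y] -> central X -> central Y ->
  central e2.
Proof.
move=> fr Xc Yc; have [a [b [zq z0]]] := plane_meets e_adapted fr.
apply: (adapted_central bC e_adapted zq z0) => y.
by rewrite bracketDl !bracketZl Xc Yc !scaler0 addr0.
Qed.

(** The centre contains a plane, which meets the hyperplane [q] in a nonzero vector, whatever [q]
    is. *)
Lemma central_e2_big_center : is_g21_2g1 g \/ is_g31_g1 g -> central e2.
Proof.
case=> -[E1 [E2 [E3 [E4 [b [? ? ? ? ? ?]]]]]];
  have [_ _ f34 f14] := free_pair b.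
- apply: (central_plane f34); apply: (central_basis bC b);
    by bracket_table.
- apply: (central_plane f14); apply: (central_basis bC b);
    by bracket_table.
Qed.

(** The plane of scalar action is that of [E1] and [E2], except for [is_g45 g a a], where it is that
    of [E2] and [E3]. The scalars supplied are the eigenvalues of the four basis vectors, followed
    by the nonzero one of [E3] or [E4]. *)
Lemma scalar_action_line_ideal :
  [\/ is_g33_g1 g, is_g42 g 1 |
     exists a : R, [/\ -1 <= a, a < 1, a != 0 & is_g45 g a 1 \/ is_g45 g a a]] ->
  contains_noncentral_line_ideal q.
Proof.
have L (E1 E2 E3 E4 X Y y0 : g) m1 m2 m3 m4 m0 b fr x1 x2 x3 x4 y1 y2 y3 y4 :=
  @plane_line_ideal R g bC q e1 e2 e3 e_adapted X Y y0 m0 fr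
    (@proportional_basis R g E1 E2 E3 E4 X Y m1 m2 m3 m4 b x1 x2 x3 x4 y1 y2 y3 y4).
case=> [[E1 [E2 [E3 [E4 [b [? ? ? ? ? ?]]]]]]|
        [E1 [E2 [E3 [E4 [b [? ? ? ? ? ?]]]]]]|
        [a [_ _ a0 [|] [E1 [E2 [E3 [E4 [b [? ? ? ? ? ?]]]]]]]]];
  have [f12 f23 _ _] := free_pair b.
- apply: (L E1 E2 E3 E4 _ _ E3 0 0 1 0 1 b f12); rewrite ?oner_eq0 //;
    by bracket_table.
- apply: (L E1 E2 E3 E4 _ _ E4 0 0 0 (-1) (-1) b f12); rewrite ?oppr_eq0 ?oner_eq0 //;
    by bracket_table.
- apply: (L E1 E2 E3 E4 _ _ E4 0 0 0 (-1) (-1) b f12); rewrite ?oppr_eq0 ?oner_eq0 //;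
    by bracket_table.
- apply: (L E1 E2 E3 E4 _ _ E4 0 0 0 (- a) (- a) b f23); rewrite ?oppr_eq0 //;
    by bracket_table.
Qed.

End Centers.

(** * Reduction of the listed cases to the structure of [[e2, q]] *)

Theorem theorem5 (R : realType) (G : lieGroupType R 4)
    (G_connected : connected [set: G])
    (g : lieAlgebra R) (D : g -> (G -> R) -> R) (g_lie : lie_algebra_of D)
    (q : {vspace g}) (q_dim : \dim q = 3%N) (q_gen : generating q)
    (F : g -> R) (F_seminorm : seminorm_on q F)
    (d : G -> G -> R) (d_F : is_subFinsler_quasimetric D q F d) :
  (* the extremals g_s and their left shifts are abnormal *)
  (forall (e1 e2 e3 : g) (s : R) (gs : R -> G) (h : G),
    adapted_basis q e1 e2 e3 -> s = 1 \/ s = -1 ->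
    one_parameter_subgroup D ((s / F (s *: e2)) *: e2) gs ->
    abnormal D q F setT (fun t => (h * gs t)%g)) /\
  (* 1 *)
  ([\/ is_g21_2g1 g \/ is_g31_g1 g |
       [\/ is_g32_g1 g,
           (exists a : R, [/\ 0 <= a, a != 1 & is_g34_g1 g a]),
           is_g43 g |
           [\/ (exists a : R, 0 <= a /\ is_g35_g1 g a),
               is_g41 g, is_g36_g1 g |
               [\/ is_g37_g1 g, is_g48 g (-1) | is_g49 g 0]]] /\
       contains_center q] ->
   forall (Om : set R) (x : R -> G),
     abnormal D q F Om x -> continuous_velocity D q Om x ->
     nonstrongly_abnormal D q F Om x) /\
  (* 2 *)
  ([\/ [\/ is_g33_g1 g, is_g42 g 1 |
           exists a : R, [/\ -1 <= a, a < 1, a != 0 &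
             is_g45 g a 1 \/ is_g45 g a a]],
       is_2g21 g /\ contains_line_ideal q,
       is_g36_g1 g /\ (exists e1 e2 e3, [/\ adapted_basis q e1 e2 e3,
         e3 = bracket e1 e2, bracket e2 e3 != 0 &
         collinear (bracket e2 e3) e2]) |
       [\/ is_g32_g1 g,
           (exists a : R, [/\ 0 <= a, a != 1 & is_g34_g1 g a]),
           is_g43 g |
           [\/ (exists a : R, [/\ a != 0, a != 1 & is_g42 g a]),
               is_g44 g,
               (exists a b : R,
                 ([/\ -1 < a, a < b, b < 1 & a * b != 0] \/
                  [/\ a = -1, 0 < b & b < 1]) /\ is_g45 g a b) |
               [\/ (exists a b : R, 0 < a /\ is_g46 g a b),
                   is_g47 g,
                   (exists a : R, [/\ -1 < a, a < 1 & is_g48 g a]) |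
                   (exists a : R, 0 < a /\ is_g49 g a)]]] /\
       contains_noncentral_line_ideal q] ->
   forall (Om : set R) (x : R -> G),
     abnormal D q F Om x -> strongly_abnormal D q F Om x) /\
  (* 3 *)
  (forall e1 e2 e3 : g, adapted_basis q e1 e2 e3 ->
   [\/ is_g410 g /\ e3 = bracket e1 e2,
       is_2g21 g /\ [/\ bracket e1 e2 = 0, bracket e2 e3 != 0 &
         collinear (bracket e2 e3) e3],
       [\/ is_g32_g1 g,
           (exists a : R, [/\ 0 <= a, a != 1 & is_g34_g1 g a]),
           is_g43 g |
           [\/ (exists a : R, 0 <= a /\ is_g35_g1 g a),
               is_g41 g,
               (exists a : R, [/\ a != 0, a != 1 & is_g42 g a]) |
               [\/ is_g44 g,
                   (exists a b : R,
                     ([/\ -1 < a, a < b, b < 1 & a * b != 0] \/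
                      [/\ a = -1, 0 < b & b < 1]) /\ is_g45 g a b) |
                   (exists a b : R, 0 < a /\ is_g46 g a b)]]] /\
       (e3 = bracket e1 e2 /\ bracket e2 e3 = 0) |
       is_g48 g 0 /\ [/\ e3 = bracket e1 e2,
         structure_constant e1 e2 e3 2 3 1 = 0 &
         structure_constant e1 e2 e3 2 3 2 = 0]] ->
   forall (s : R) (gs : R -> G) (h : G), s = 1 \/ s = -1 ->
     one_parameter_subgroup D ((s / F (s *: e2)) *: e2) gs ->
     (nonstrongly_abnormal D q F setT (fun t => (h * gs t)%g) <->
      exists k : R, support_fun q F e1 e2 e3 k s 0 = 1 / F (s *: e2))) /\
  (* 4 *)
  (forall e1 e2 e3 : g, adapted_basis q e1 e2 e3 ->
   [\/ (is_g36_g1 g \/ is_g37_g1 g) /\ [/\ e3 = bracket e1 e2,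
         bracket e2 e3 != 0 & collinear (bracket e2 e3) e1] |
       [\/ is_g47 g,
           (exists a : R, [/\ -1 <= a, a < 1, a != 0 & is_g48 g a]) |
           (exists a : R, 0 <= a /\ is_g49 g a)] /\
       [/\ e3 = bracket e1 e2,
         structure_constant e1 e2 e3 2 3 1 != 0 &
         structure_constant e1 e2 e3 2 3 2 = 0]] ->
   forall (s : R) (gs : R -> G) (h : G), s = 1 \/ s = -1 ->
     one_parameter_subgroup D ((s / F (s *: e2)) *: e2) gs ->
     (nonstrongly_abnormal D q F setT (fun t => (h * gs t)%g) <->
      support_fun q F e1 e2 e3 0 s 0 = 1 / F (s *: e2))).
Proof.
have bC := lie_bracketC g_lie.
have adapted dg := adapted_exists bC dg q_dim q_gen.
split; last split; last split; last split.
- move=> e1 e2 e3 s gs h ea s1 gsX.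
  exact: (one_parameter_abnormal g_lie F_seminorm ea h s1 gsX).
- move=> cases Om x.
  (* The dimension of [g], needed to build an adapted basis, is read off the multiplication
     table. *)
  have dg : \dim {:g} = 4%N.
    case: cases => [[|]|[[H|[a [_ _ H]]|H|[[a [_ H]]|H|H|[H|H|H]]] _]];
      by [exact: has_brackets_dim | exact: has_brackets_dim H].
  have [e1 [e2 [e3 ea]]] := adapted dg.
  apply: (central_nonstrongly g_lie F_seminorm ea).
  case: cases => [big|[/nontrivial_center nc qc]].
    exact: (central_e2_big_center bC ea big).
  have [z z0 zc] := nc bC.
  exact: (adapted_central bC ea (qc z zc) z0 zc).
- move=> cases; have [e1 [e2 [e3 [w [ea wq e2w]]]]] : exists e1 e2 e3 w,
      [/\ adapted_basis q e1 e2 e3, w \in q & bracket e2 w = e2].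
    have line (dg : \dim {:g} = 4%N) : contains_noncentral_line_ideal q ->
        exists e1 e2 e3 w, [/\ adapted_basis q e1 e2 e3, w \in q & bracket e2 w = e2].
      move=> nc; have [e1 [e2 [e3 ea]]] := adapted dg.
      have [w wq e2w] := line_ideal_eigen bC ea q_gen nc.
      by exists e1, e2, e3, w.
    case: cases => [H|[H qI]|[H [e1 [e2 [e3 [ea e3E b23 col]]]]]|[H nc]].
    + have dg : \dim {:g} = 4%N.
        by case: H => [H|H|[a [_ _ _ [H|H]]]]; exact: has_brackets_dim H.
      have [e1 [e2 [e3 ea]]] := adapted dg.
      exact: line dg (scalar_action_line_ideal bC ea H).
    + exact: line (has_brackets_dim H) (line_ideal_2g21 bC H qI).
    (* Here the given basis is used directly: [[e2, e3]] is a nonzero multiple of [e2], so a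
       multiple of [e3] serves as [w]. *)
    + have [t t0 b23E] := collinear_nonzero col b23 (adapted_e2_neq0 ea).
      have [_ _ q3] := adapted_mem ea.
      exists e1, e2, e3, (t^-1 *: e3); split=> //; first exact: memvZ.
      by rewrite (bracketZr bC) b23E scalerA mulVf // scale1r.
    + apply: line nc.
      case: H => [H|[a [_ _ H]]|H|[[a [_ _ H]]|H|[a [b [_ H]]]|
        [[a [b [_ H]]]|H|[a [_ _ H]]|[a [_ H]]]]]; exact: has_brackets_dim H.
  exact: (eigen_strongly g_lie F_seminorm ea wq e2w).
- move=> e1 e2 e3 ea cases s gs h s1 gsX.
  suff [t [b23 e3E]] : exists t, bracket e2 e3 = t *: e3 /\
      (e3 = bracket e1 e2 \/ bracket e1 e2 = 0 /\ t != 0).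
    exact: (line_case g_lie F_seminorm ea h s1 gsX b23 e3E).
  case: cases => [[H e3E]|[H [b12 b23 col]]|[H [e3E b23]]|[H [e3E c1 c2]]].
  + by have [t b23] := g410_bracket bC ea H e3E; exists t; split=> //; left.
  + have e30 : e3 != 0.
      by apply: contra_neq b23 => ->; rewrite (bracket0r bC).
    by have [t t0 b23E] := collinear_nonzero col b23 e30; exists t; split=> //; right.
  + by exists 0; split; [rewrite scale0r|left].
  + exists (frame_coord e1 e2 e3 2 (bracket e2 e3)); split; last by left.
    by rewrite {1}(adapted_bracket_e2_e3 bC ea) c1 c2 !scale0r !add0r.
- move=> e1 e2 e3 ea cases s gs h s1 gsX.
  suff [a [t [b23 a0 e3E]]] : exists a t, [/\ bracket e2 e3 = a *: e1 + t *: e3,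
      a != 0 & e3 = bracket e1 e2].
    exact: (plane_case g_lie F_seminorm ea h s1 gsX b23 a0 e3E).
  case: cases => [[H [e3E b23 col]]|[H [e3E c1 c2]]].
  + have e10 : e1 != 0.
      apply: contra_neq b23 => e10; rewrite e3E e10 bracket0l (bracket0r bC) //.
    have [t t0 b23E] := collinear_nonzero col b23 e10.
    by exists t, 0; rewrite scale0r addr0.
  + exists (structure_constant e1 e2 e3 2 3 1), (frame_coord e1 e2 e3 2 (bracket e2 e3)).
    by rewrite {1}(adapted_bracket_e2_e3 bC ea) c2 scale0r addr0.
Qed.
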